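(* Let $(X_0,X_1)$ be a compatible couple and $1\le q<\infty$. Let $b\in SV(0,\infty)$ satisfy $$\int_0^\infty t^{-1}b^{q}(t)\,dt<\infty .$$ Let $\beta\in SV(0,\infty)$ be such that $$\int_x^\infty t^{-1}\beta^q(t)\,dt<\infty\ \text{ for all } x>0,\qquad \int_0^\infty t^{-1}\beta^q(t)\,dt=\infty,$$ let $B\in SV(0,\infty)$ be given by $$B(x):=b(x)\ \text{ if } x\in[1,\infty),\qquad B(x)\approx\beta(x)\ \text{ if } x\in(0,1),$$ and put $$A(x):=B^{-q/q'}(x)\int_x^\infty t^{-1}B^q(t)\,dt\quad\text{for all } x>0$$ (so $A(x)=\int_x^\infty t^{-1}B(t)\,dt$ if $q=1$). Then $$(X_0,X_1)_{0,q,b;K}=X_0+(X_0,X_1)_{0,q,B;K}=X_0+(X_0,X_1)_{0,q,A;J}.$$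
   Context: A pair $(X_0,X_1)$ of Banach spaces is a compatible couple if there is a Hausdorff topological vector space in which both $X_0$ and $X_1$ are continuously embedded. $X_0\cap X_1$ carries the norm $\max\{\|f\|_{X_0},\|f\|_{X_1}\}$; the sum $X+Y$ of two Banach spaces embedded in a common space carries the norm $\inf\{\|f_0\|_{X}+\|f_1\|_{Y}: f=f_0+f_1\}$. For $t>0$, $$K(f,t;X_0,X_1):=\inf\{\|f_0\|_{X_0}+t\|f_1\|_{X_1}: f=f_0+f_1,\ f_0\in X_0,\ f_1\in X_1\}\quad (f\in X_0+X_1),$$ $$J(f,t;X_0,X_1):=\max\{\|f\|_{X_0},t\|f\|_{X_1}\}\quad (f\in X_0\cap X_1).$$ For $1\le q\le\infty$, $\|\cdot\|_{q,(c,d)}$ is the $L_q$-norm on $(c,d)$, $1/q+1/q'=1$, and $1/\infty=0$. For a weight $v$ on $(0,\infty)$ (non-negative, measurable, finite a.e.): - $(X_0,X_1)_{0,q,v;K}$ is the set of $f\in X_0+X_1$ with $\|f\|_{0,q,v;K}:=\|t^{-1/q}v(t)K(f,t;X_0,X_1)\|_{q,(0,\infty)}<\infty$. - $(X_0,X_1)_{0,q,v;J}$ is the set of $f\in X_0+X_1$ for which there is a strongly measurable $u:(0,\infty)\to X_0\cap X_1$ with $f=\int_0^\infty u(s)\,\frac{ds}{s}$ (convergence in $X_0+X_1$) and for which $\|f\|_{0,q,v;J}:=\inf\|t^{-1/q}v(t)J(u(t),t;X_0,X_1)\|_{q,(0,\infty)}$ is finite, the infimum being over all such representations of $f$. Equality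 of two spaces means that they are equal as sets and their norms are equivalent. For non-negative expressions, $\mathcal A\approx\mathcal B$ means that each is bounded by a positive constant multiple of the other, the constants being independent of the significant quantities (here, of $x$). $SV(0,\infty)$ is the set of slowly varying functions: positive, finite, Lebesgue-measurable functions $b$ on $(0,\infty)$ such that for each $\varepsilon>0$, $t^{\varepsilon}b(t)$ is equivalent ($\approx$) to a non-decreasing function on $(0,\infty)$ and $t^{-\varepsilon}b(t)$ is equivalent to a non-increasing function on $(0,\infty)$. *)

(* Defs.v *)
From HB Require Import structures.
From mathcomp Require Import all_boot all_order all_algebra.
From mathcomp Require Import all_classical all_reals all_analysis.

Set Implicit Arguments.
Unset Strict Implicit.
Unset Printing Implicit Defensive.

Import Order.TTheory GRing.Theory Num.Theory.
Import numFieldNormedType.Exports.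

Local Open Scope classical_set_scope.
Local Open Scope ring_scope.

(* Lebesgue measure on the sigma-algebra of all Lebesgue (not only Borel)
   measurable sets; the carrier of its domain is convertible to R. *)
Notation leb R := (@completed_lebesgue_measure R).
Notation lebType R := (caratheodory_type (@wlength R idfun)^*%mu).

Section SlowlyVarying.
Context {R : realType}.

Definition ppos : set R := `]0, +oo[.

(* One constant suffices: it may be taken as the larger of the two. *)
Definition approx_on (D : set R) (f g : R -> R) : Prop :=
  exists2 C : R, 0 < C &
    forall x, D x -> f x <= C * g x /\ g x <= C * f x.

Definition nondecreasing_on (D : set R) (g : R -> R) : Prop :=
  forall x y, D x -> D y -> x <= y -> g x <= g y.

Definition nonincreasing_on (D : set R) (g : R -> R) : Prop :=
  forall x y, D x -> D y -> x <= y -> g y <= g x.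

Definition slowly_varying (b : R -> R) : Prop :=
  [/\ forall t, ppos t -> 0 < b t,
      measurable_fun (ppos : set (lebType R)) (b : lebType R -> R),
      forall e : R, 0 < e -> exists2 g : R -> R, nondecreasing_on ppos g &
        approx_on ppos (fun t => t `^ e * b t) g
    & forall e : R, 0 < e -> exists2 g : R -> R, nonincreasing_on ppos g &
        approx_on ppos (fun t => t `^ (- e) * b t) g].

Definition Lq_norm (q : \bar R) (D : set R) (f : R -> \bar R) : \bar R :=
  Lnorm (leb R) q ((f : lebType R -> \bar R) \_ D).

End SlowlyVarying.

Section NormedSubspaces.
Context {R : realType} {V : lmodType R}.
Local Open Scope ereal_scope.

(* A normed space sitting inside V: its underlying set and its norm, the
   latter being meaningful on the underlying set only. *)
Record nspace := NSpace { ncarrier : set V ; nnorm : V -> \bar R }.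

Implicit Types E F : nspace.

(* The copy in V of a normed space X embedded by i; for injective i the norm
   of i x is the norm of x. *)
Definition embedded (X : normedModType R) (i : X -> V) : nspace :=
  NSpace (range i)
    (fun f => ereal_inf [set `|x|%R%:E | x in [set x | i x = f]]).

Definition inter_space E F : nspace :=
  NSpace (ncarrier E `&` ncarrier F) (fun f => maxe (nnorm E f) (nnorm F f)).

Definition decompositions E F (f : V) : set (V * V) :=
  [set p | [/\ ncarrier E p.1, ncarrier F p.2 & f = (p.1 + p.2)%R]].

Definition sum_space E F : nspace :=
  NSpace [set f | decompositions E F f !=set0]
    (fun f => ereal_inf
       [set nnorm E p.1 + nnorm F p.2 | p in decompositions E F f]).

Definition space_eq E F : Prop :=
  ncarrier E = ncarrier F /\
  exists2 C : R, (0 < C)%R & forall f, ncarrier E f ->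
    nnorm E f <= C%:E * nnorm F f /\ nnorm F f <= C%:E * nnorm E f.

Definition Kfun E F (f : V) (t : R) : \bar R :=
  ereal_inf
    [set nnorm E p.1 + t%:E * nnorm F p.2 | p in decompositions E F f].

Definition Jfun E F (f : V) (t : R) : \bar R :=
  maxe (nnorm E f) (t%:E * nnorm F f).

Definition simple_fun E (s : R -> V) : Prop :=
  [/\ finite_set (s @` ppos),
      forall t, ppos t -> ncarrier E (s t)
    & forall v, measurable ((ppos `&` s @^-1` [set v]) : set (lebType R))].

Definition strongly_measurable E (u : R -> V) : Prop :=
  (forall t, ppos t -> ncarrier E (u t)) /\
  exists2 s : nat -> R -> V, (forall n, simple_fun E (s n)) &
    {ae leb R, forall t, ppos t ->
      nnorm E (u t - s n t)%R @[n --> \oo] --> 0}.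

Definition haar (A : set R) : \bar R :=
  \int[leb R]_(t in ppos `&` A) (t^-1)%:E.

Definition simple_integral (s : R -> V) : V :=
  (\sum_(v \in s @` ppos) fine (haar (s @^-1` [set v])) *: v)%R.

(* f is the Bochner integral over (0,oo) of u with respect to dt/t, in E. *)
Definition is_bochner_integral E (u : R -> V) (f : V) : Prop :=
  [/\ strongly_measurable E u, ncarrier E f &
    exists s : nat -> R -> V,
      [/\ forall n, simple_fun E (s n),
          forall n, \int[leb R]_(t in ppos) (nnorm E (s n t) * (t^-1)%:E) < +oo,
          \int[leb R]_(t in ppos) (nnorm E (u t - s n t)%R * (t^-1)%:E)
            @[n --> \oo] --> 0
        & nnorm E (f - simple_integral (s n))%R @[n --> \oo] --> 0]].

(* fine q^-1 is 1/q, with 1/oo = 0. *)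
Definition Knorm (q : \bar R) (v : R -> R) E F (f : V) : \bar R :=
  Lq_norm q ppos
    (fun t => (t `^ (- fine q^-1) * v t)%:E * Kfun E F f t).

Definition Kspace (q : \bar R) (v : R -> R) E F : nspace :=
  NSpace [set f | ncarrier (sum_space E F) f /\ Knorm q v E F f < +oo]
    (Knorm q v E F).

Definition J_representation E F (f : V) : set (R -> V) :=
  [set u | strongly_measurable (inter_space E F) u /\
           is_bochner_integral (sum_space E F) u f].

Definition Jnorm (q : \bar R) (v : R -> R) E F (f : V) : \bar R :=
  ereal_inf
    [set Lq_norm q ppos
       (fun t => (t `^ (- fine q^-1) * v t)%:E * Jfun E F (u t) t)
    | u in J_representation E F f].

Definition Jspace (q : \bar R) (v : R -> R) E F : nspace :=
  NSpace [set f | [/\ ncarrier (sum_space E F) f,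
                      J_representation E F f !=set0
                    & Jnorm q v E F f < +oo]]
    (Jnorm q v E F).

End NormedSubspaces.
Arguments nspace {R} V.

(* Scalars are real: a complex couple is a couple of real Banach spaces, and
   nothing below depends on the complex structure. *)
Definition compatible_couple (R : realType) (X0 X1 : completeNormedModType R)
    (V : topologicalLmodType R)
    (i0 : {linear X0 -> V}) (i1 : {linear X1 -> V}) : Prop :=
  [/\ hausdorff_space V, injective i0 /\ continuous i0
    & injective i1 /\ continuous i1].

(* Main.v *)
Require Import Defs.
From mathcomp Require Import all_boot all_order all_algebra.
From mathcomp Require Import all_classical all_reals all_analysis.
From mathcomp Require Import measurable_realfun lra ring.

Set Implicit Arguments.
Unset Strict Implicit.
Unset Printing Implicit Defensive.

Import Order.TTheory GRing.Theory Num.Theory.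
Import numFieldNormedType.Exports.

Local Open Scope classical_set_scope.
Local Open Scope ring_scope.
(** Write [K f t] for the K-functional of the couple.  It is nondecreasing in
    [t], [K f t / t] is nonincreasing, and [K f t] is at most the norm of [f]
    in [X_0] when [f] lies in [X_0].  Since [b ^ q] is integrable for [dt/t] on
    the whole half-line, the values of [K f] on [(0, 1)] cost no more than
    [K f 1]: the norm of the first space is equivalent to the energy
    [int_1^oo B^q (K f)^q dt/t], and here [b] may be replaced by [B].  Hence
    a sum [X_0 + G] embeds into the first space as soon as the norm of [G]
    controls this energy ([sum_embeds_K]), and the first space embeds into
    [X_0 + G] as soon as every [f] of finite energy splits as [f_0 + g], with
    both norms controlled by the energy ([K_embeds_sum]).  Both spaces [G] are
    treated in this way, so that each of the two sums is compared with the
    first space, and thereby with the other.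

    For [G] the K-space with weight [B], the energy is part of the norm.
    Conversely split [f = f_0 + f_1] almost optimally for [K f 1].  Near 0,
    [K f_1 t <= t |f_1|_1], and [t^q B^q] is integrable there, as [B] varies
    slower than any power; on [(1, oo)], [K f_1 <= K f + |f_0|_0 <= 2 K f].

    For [G] the J-space, put [W x = int_x^oo B^q dt/t], so that
    [A^q = B^q (W / B^q)^q].  If [f = int u ds/s] then
    [K f t <= int min(1, t/s) J(u s, s) ds/s], and the energy of [f] is bounded
    by [int A^q J(u)^q ds/s] through a Hardy inequality ([hardy_majorant]).
    After discretization into dyadic blocks, the two halves of the kernel
    become the discrete Hardy inequalities [discrete_hardy] and
    [discrete_hardy_dual]; the second one uses that [B^q] grows less than
    [t^q].

    Conversely ([K_to_J]), when [f] has finite energy, choose powers of two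
    [x_0 < x_1 < ...] along which [W] is halved, up to bounded factors, and
    decompositions [f = a_k + b_k] almost optimal for [K f x_k].  Since
    [|b_k|_1 <= K f x_k / x_k] tends to 0, [b_1] is the sum of the differences
    [a_(k+1) - a_k], [k >= 1].  Each difference is spread over one level
    between consecutive [x_k], in proportion to the mass that [B^q dt/t] puts
    on the dyadic blocks of the level, and this gives a step function [u] with
    integral [b_1].  On a block of mass [w] in a level of mass [m], [J(u)] is of
    the order of [(w / m) K f x_k], and [A] multiplies it by [w^(1/q) (W / w)].
    As [W] is comparable to [m], the block contributes [w (K f x_k)^q], and
    the sum of these terms is the energy. *)

(** * Integrals for the measure dt/t *)

Section HaarIntegral.
Context {R : realType}.
Implicit Types (D E : set R) (g : R -> R).

Lemma leb_measurableS D : measurable (D : set (measurableTypeR R)) ->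
  measurable (D : set (lebType R)).
Proof. by move=> mD; apply: sub_caratheodory. Qed.

Lemma leb_measurable_itv (i : interval R) :
  measurable ([set` i] : set (lebType R)).
Proof. by apply: leb_measurableS; exact: measurable_itv. Qed.

Lemma leb_measurable_funS D g :
  measurable (D : set (measurableTypeR R)) ->
  measurable_fun (D : set (measurableTypeR R)) g ->
  measurable_fun (D : set (lebType R)) (g : lebType R -> R).
Proof. by move=> mD mg _ B mB; apply: leb_measurableS; exact: mg. Qed.

Lemma leb_itv_oc (a c : R) : a <= c ->
  leb R (`]a, c]%classic : set (lebType R)) = (c - a)%:E.
Proof.
move=> ac; rewrite /completed_lebesgue_measure.
rewrite /completed_lebesgue_stieltjes_measure /completed_measure_extension /=.
by rewrite measurable_mu_extE/= ?wlength_itv_bnd//; exact: is_ocitv.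
Qed.

Lemma nondecreasing_leb_measurable (i : interval R) g :
  nondecreasing_on [set` i] g ->
  measurable_fun ([set` i] : set (lebType R)) (g : lebType R -> R).
Proof.
move=> gnd; apply: leb_measurable_funS; first exact: measurable_itv.
apply: (measurability (@RGenCInfty.G R)) => [|/= _ [_] [r] -> <-].
  exact: RGenCInfty.measurableE.
apply: is_interval_measurable => s t /= [Ds gs] [Dt gt] u /andP[su ut].
move: gs; rewrite in_itv/= andbT => gs.
have Du : [set` i] u.
  by apply: (@interval_is_interval _ i s t Ds Dt u); rewrite su ut.
by split => //; apply/andP; split => //; rewrite bnd_simp (le_trans gs) ?gnd.
Qed.

Lemma nonincreasing_leb_measurable (i : interval R) g :
  nonincreasing_on [set` i] g ->
  measurable_fun ([set` i] : set (lebType R)) (g : lebType R -> R).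
Proof.
move=> gni; rewrite -(opprK g); apply/measurable_funN.
by apply: nondecreasing_leb_measurable => s t Ds Dt st; rewrite lerN2 gni.
Qed.

End HaarIntegral.

Section LowerIntegral.
Local Open Scope ereal_scope.
Context d (T : measurableType d) (R : realType).
Variable mu : {measure set T -> \bar R}.

(** The integral of a nonnegative function is a supremum over the simple
    functions below it, so it is monotone without any measurability: norms
    of vector-valued functions can be compared before they are known to be
    measurable. *)
Lemma ge0_le_integralW (D : set T) (f g : T -> \bar R) :
  (forall x, D x -> 0 <= f x) -> (forall x, D x -> f x <= g x) ->
  \int[mu]_(x in D) f x <= \int[mu]_(x in D) g x.
Proof.
move=> f0 fg; have g0 x : D x -> 0 <= g x.
  by move=> Dx; exact: le_trans (f0 _ Dx) (fg _ Dx).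
rewrite !ge0_integralE//; apply: ereal_sup_le => _ [h /= hf <-]; exists h => //= x.
by apply: (le_trans (hf x)); rewrite lee_restrict.
Qed.

Lemma ge0_le_integral_subset (D E : set T) (f : T -> \bar R) :
  (forall x, E x -> 0 <= f x) -> D `<=` E ->
  \int[mu]_(x in D) f x <= \int[mu]_(x in E) f x.
Proof.
move=> f0 DE; rewrite integral_mkcond [leRHS]integral_mkcond.
apply: ge0_le_integralW => x _.
  by apply: erestrict_ge0 => y /DE; exact: f0.
rewrite /patch; case: ifPn => [/set_mem xD|_]; first by rewrite mem_set//; exact: DE.
by case: ifPn => // /set_mem; exact: f0.
Qed.

End LowerIntegral.

Notation oc y z := ([set` `]y, z]%R]) (only parsing).
Notation ray y := ([set` `]y, +oo[%R]) (only parsing).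

Section haarint.
Context {R : realType}.
Implicit Types (D E : set R) (f g : R -> R).
Local Open Scope ereal_scope.

(** The integral for the Haar measure [dt/t] of the multiplicative half-line. *)
Definition haarint D g : \bar R := \int[leb R]_(t in D) ((t^-1 * g t)%R)%:E.

(** Lebesgue rather than Borel measurability, which is what a slowly varying
    function comes with. *)
Definition lmeas g := measurable_fun (ppos : set (lebType R)) (g : lebType R -> R).

Lemma ppos_gt0 (t : R) : ppos t <-> (0 < t)%R.
Proof. by rewrite /ppos /= in_itv/= andbT. Qed.

Lemma measurable_ppos : measurable (ppos : set (lebType R)).
Proof. exact: leb_measurable_itv. Qed.

Lemma itv_ppos (i : interval R) : ((BRight 0%R : itv_bound R) <= i.1)%O ->
  [set` i] `<=` (ppos : set R).
Proof.
case: i => a c /= a0 x /=; rewrite itv_boundlr => /andP[/= ax _]; apply/ppos_gt0.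
by move: (le_trans a0 ax); rewrite bnd_simp.
Qed.

Lemma lmeas_invM g : lmeas g ->
  measurable_fun (ppos : set (lebType R)) (fun t : lebType R => ((t^-1 * g t)%R)%:E).
Proof.
move=> mg; apply/measurable_EFinP; apply: measurable_funM => //.
apply: nonincreasing_leb_measurable => x y /ppos_gt0 x0 /ppos_gt0 y0 xy.
by rewrite lef_pV2.
Qed.

Lemma haarint_ge0 D g : D `<=` ppos -> (forall t, D t -> (0 <= g t)%R) -> 0 <= haarint D g.
Proof.
move=> DP g0; apply: integral_ge0 => t Dt.
by rewrite lee_fin mulr_ge0 ?invr_ge0 ?g0// ltW//; exact/ppos_gt0/DP.
Qed.

Lemma haarint_le D f g : D `<=` ppos -> (forall t, D t -> (0 <= f t)%R) ->
  (forall t, D t -> (f t <= g t)%R) -> haarint D f <= haarint D g.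
Proof.
move=> DP f0 fg; apply: ge0_le_integralW => t Dt; rewrite lee_fin.
  by rewrite mulr_ge0 ?invr_ge0 ?f0// ltW//; exact/ppos_gt0/DP.
by rewrite ler_wpM2l ?fg// invr_ge0 ltW//; exact/ppos_gt0/DP.
Qed.

Lemma haarint_subset D E g : D `<=` E -> E `<=` ppos ->
  (forall t, E t -> (0 <= g t)%R) -> haarint D g <= haarint E g.
Proof.
move=> DE EP g0; apply: ge0_le_integral_subset => // t Et.
by rewrite lee_fin mulr_ge0 ?invr_ge0 ?g0// ltW//; exact/ppos_gt0/EP.
Qed.

Lemma eq_haarint D f g : (forall t, D t -> f t = g t) -> haarint D f = haarint D g.
Proof. by move=> fg; apply: eq_integral => t /set_mem Dt; rewrite fg. Qed.

Lemma haarintD D f g : measurable (D : set (lebType R)) -> D `<=` ppos ->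
  lmeas f -> lmeas g ->
  (forall t, D t -> (0 <= f t)%R) -> (forall t, D t -> (0 <= g t)%R) ->
  haarint D (fun t => f t + g t)%R = haarint D f + haarint D g.
Proof.
move=> mD DP mf mg f0 g0.
have nn f' : (forall t, D t -> (0 <= f' t)%R) -> forall t, D t -> 0 <= ((t^-1 * f' t)%R)%:E.
  by move=> f'0 t Dt; rewrite lee_fin mulr_ge0 ?invr_ge0 ?f'0// ltW//; exact/ppos_gt0/DP.
have := @ge0_integralD _ _ _ (leb R) D mD _ _ (nn f f0)
  (measurable_funS measurable_ppos DP (lmeas_invM mf)) (nn g g0)
  (measurable_funS measurable_ppos DP (lmeas_invM mg)).
move=> <-; apply: eq_integral => t _; by rewrite -EFinD mulrDr.
Qed.

Lemma haarintZ D g (c : R) : measurable (D : set (lebType R)) -> D `<=` ppos ->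
  lmeas g -> (forall t, D t -> (0 <= g t)%R) -> (0 <= c)%R ->
  haarint D (fun t => c * g t)%R = c%:E * haarint D g.
Proof.
move=> mD DP mg g0 c0.
have nn t : D t -> 0 <= ((t^-1 * g t)%R)%:E.
  by move=> Dt; rewrite lee_fin mulr_ge0 ?invr_ge0 ?g0// ltW//; exact/ppos_gt0/DP.
have := @ge0_integralZl_EFin _ _ _ (leb R) D mD _ nn
  (measurable_funS measurable_ppos DP (lmeas_invM mg)) c c0.
move=> <-; apply: eq_integral => t _; by rewrite -EFinM mulrCA.
Qed.

Lemma haarintU D E g : measurable (D : set (lebType R)) -> measurable (E : set (lebType R)) ->
  D `<=` ppos -> E `<=` ppos -> [disjoint D & E] ->
  lmeas g -> (forall t, (D `|` E) t -> (0 <= g t)%R) ->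
  haarint (D `|` E) g = haarint D g + haarint E g.
Proof.
move=> mD mE DP EP DE mg g0; have DEP : D `|` E `<=` ppos by move=> t [/DP|/EP].
have nn t : (D `|` E) t -> 0 <= ((t^-1 * g t)%R)%:E.
  by move=> Dt; rewrite lee_fin mulr_ge0 ?invr_ge0 ?g0// ltW//; exact/ppos_gt0/DEP.
exact: (@ge0_integral_setU _ _ _ (leb R) D E mD mE _
  (measurable_funS measurable_ppos DEP (lmeas_invM mg)) nn DE).
Qed.

(** The upper end is any interval bound, to cover both [ ]a, e] ] and [ ]a, +oo[ ]. *)
Lemma haarint_split (a c : R) (e : itv_bound R) g : (0 <= a)%R -> (a <= c)%R ->
  (BRight c <= e)%O -> lmeas g -> (forall t, (0 < t)%R -> (0 <= g t)%R) ->
  haarint [set` Interval (BRight a) e] g =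
  haarint `]a, c] g + haarint [set` Interval (BRight c) e] g.
Proof.
move=> a0 ac ce mg g0.
have P1 : [set` Interval (BRight a) (BRight c)] `<=` (ppos : set R) by exact: itv_ppos.
have P2 : [set` Interval (BRight c) e] `<=` (ppos : set R).
  by apply: itv_ppos; rewrite bnd_simp (le_trans a0).
rewrite -haarintU//.
- by rewrite -itv_bndbnd_setU// bnd_simp.
- exact: leb_measurable_itv.
- exact: leb_measurable_itv.
- apply/eqP; rewrite -subset0 => t [/=]; rewrite !itv_boundlr/= => /andP[_ h] /andP[h' _].
  by move: h h'; rewrite !bnd_simp => h /(le_lt_trans h); rewrite ltxx.
- by move=> t [/P1|/P2] /ppos_gt0; exact: g0.
Qed.

(** Monotone convergence, in the form in which infinite ranges are reduced to
    finite unions of dyadic blocks. *)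
Lemma haarint_bigcup_le (F : (set R)^nat) g (C : \bar R) : nondecreasing_seq F ->
  (forall n, measurable (F n : set (lebType R))) -> (forall n, F n `<=` ppos) ->
  lmeas g -> (forall t, (0 < t)%R -> (0 <= g t)%R) ->
  (forall n, haarint (F n) g <= C) -> haarint (\bigcup_n F n) g <= C.
Proof.
move=> ndF mF FP mg g0 FC.
have h := @ge0_nondecreasing_set_cvg_integral _ (lebType R) R F
  (fun t : lebType R => ((t^-1 * g t)%R)%:E) (leb R) ndF mF.
have {}h : haarint (F n) g @[n --> \oo] --> haarint (\bigcup_n F n) g.
  apply: h => [i|i t /FP /ppos_gt0 t0].
    exact: measurable_funS measurable_ppos (FP i) (lmeas_invM mg).
  by rewrite lee_fin mulr_ge0 ?invr_ge0 ?g0// ltW.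
rewrite -(cvg_lim _ h)//; apply: lime_le; first by apply/cvg_ex; eexists; exact: h.
by apply: nearW.
Qed.

(** The exact value is [ln 2]; these bounds follow from [y <= t <= 2 y]. *)
Lemma haarint_dyadic_bounds (y : R) : (0 < y)%R ->
  (2^-1)%:E <= haarint `]y, (y * 2)%R] (cst 1%R) <= 1.
Proof.
move=> y0; have yP : `]y, (y * 2)%R]%classic `<=` (ppos : set R).
  by apply: itv_ppos; rewrite bnd_simp ltW.
have cE (c : R) : \int[leb R]_(t in `]y, (y * 2)%R]) (cst c%:E) t = (c * y)%:E.
  rewrite integral_cst; last exact: leb_measurable_itv.
  transitivity (c%:E * (y * 2 - y)%:E); first by congr (_ * _); apply: leb_itv_oc; lra.
  by rewrite -EFinM; congr (_%:E); lra.
apply/andP; split.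
  have -> : (2^-1 : R)%R = ((y * 2)^-1 * y)%R by field; rewrite gt_eqF.
  rewrite -cE; apply: ge0_le_integralW => t /=.
    by rewrite lee_fin invr_ge0 mulr_ge0// ltW.
  rewrite in_itv/= => /andP[yt ty]; rewrite lee_fin mulr1 lef_pV2// posrE; lra.
have -> : 1 = (y^-1 * y)%:E :> \bar R by rewrite mulVf// gt_eqF.
rewrite -cE; apply: ge0_le_integralW => t /=; rewrite in_itv/= => /andP[yt ty].
  by rewrite lee_fin mulr1 invr_ge0; lra.
by rewrite lee_fin mulr1 lef_pV2// ?posrE; lra.
Qed.

Lemma haarint_dyadic_sum (y : R) n g : (0 < y)%R -> lmeas g ->
  (forall t, (0 < t)%R -> (0 <= g t)%R) ->
  haarint `]y, (y * 2 ^+ n)%R] g =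
  \sum_(i < n) haarint `](y * 2 ^+ i)%R, (y * 2 ^+ i * 2)%R] g.
Proof.
move=> y0 mg g0; elim: n => [|n IH].
  by rewrite big_ord0 expr0 mulr1 set_itv_ge ?bnd_simp ?ltxx// /haarint integral_set0.
have p0 : (0 < (2 : R) ^+ n)%R by rewrite exprn_gt0.
have p1 : (1 <= (2 : R) ^+ n)%R by rewrite exprn_ege1// ler1n.
rewrite big_ord_recr/= -IH exprSr mulrA.
rewrite [LHS](@haarint_split _ (y * 2 ^+ n)%R) ?(ltW y0)//.
- by rewrite ler_peMr// ltW.
- by rewrite bnd_simp ler_peMr ?ler1n// mulr_ge0// ltW.
Qed.

End haarint.

Section Measurability.
Context {R : realType}.

Lemma lmeas_powR (g : R -> R) (q : R) : lmeas g -> lmeas (fun t => g t `^ q).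
Proof.
move=> mg; rewrite /lmeas; apply: (@measurableT_comp _ _ _ _ _ _ (fun x : R => x `^ q)) => //.
Qed.

Lemma lmeasM (f g : R -> R) : lmeas f -> lmeas g -> lmeas (fun t => f t * g t).
Proof. by move=> mf mg; exact: measurable_funM. Qed.

Lemma lmeas_id : lmeas (fun t : R => t).
Proof. by apply: nondecreasing_leb_measurable => x y. Qed.

End Measurability.

Section DyadicBlocks.
Context {R : realType}.

Lemma dyadic_ppos (y : R) : 0 < y -> `]y, (y * 2)]%classic `<=` (ppos : set R).
Proof. by move=> y0; apply: itv_ppos; rewrite bnd_simp ltW. Qed.

Lemma tail_ppos (y : R) : 0 < y -> `]y, +oo[%classic `<=` (ppos : set R).
Proof. by move=> y0; apply: itv_ppos; rewrite bnd_simp ltW. Qed.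

Lemma haarint_dyadic_cst (y k : R) : 0 < y -> 0 <= k ->
  ((k / 2)%:E <= haarint (oc y (y * 2)) (fun=> k) <= k%:E)%E.
Proof.
move=> y0 k0; have -> : haarint (oc y (y * 2)) (fun=> k) = (k%:E * haarint (oc y (y * 2)) (cst 1%R))%E.
  rewrite -haarintZ//; first by apply: eq_haarint => t _; rewrite mulr1.
  - exact: leb_measurable_itv.
  - exact: dyadic_ppos.
  - exact: measurable_cst.
have /andP[h1 h2] := haarint_dyadic_bounds y0.
apply/andP; split; first by rewrite EFinM lee_wpmul2l.
by rewrite -[leRHS]mule1 lee_wpmul2l.
Qed.

Lemma pow2_ge_n n : (n%:R : R) <= 2 ^+ n.
Proof. by rewrite -natrX ler_nat ltnW// ltn_expl. Qed.

Lemma pow2_ge1 n : 1 <= (2 : R) ^+ n.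
Proof. by rewrite exprn_ege1// ler1n. Qed.

Lemma pow2_unbounded (x : R) : exists n, x <= 2 ^+ n.
Proof.
exists (Num.truncn x).+1; apply: le_trans (pow2_ge_n _); exact/ltW/truncnS_gt.
Qed.

Lemma haarint_ray1_le (g : R -> R) (T : \bar R) : lmeas g -> (forall t, 0 < t -> 0 <= g t) ->
  (forall n, haarint (oc 1 (2 ^+ n)) g <= T)%E -> (haarint (ray 1) g <= T)%E.
Proof.
move=> mg g0 gT; have -> : ray 1 = \bigcup_n oc 1 (2 ^+ n : R).
  apply/seteqP; split => t /=; rewrite in_itv/= ?andbT.
    move=> t1; have [n tn] := pow2_unbounded t; exists n => //=.
    by rewrite in_itv/= t1.
  by move=> [n _ /=]; rewrite in_itv/= => /andP[].
apply: haarint_bigcup_le => //.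
- move=> m n mn; apply/subsetPset => t /=; rewrite !in_itv/= => /andP[-> /le_trans]; apply.
  by rewrite ler_eXn2l ?ltr1n.
- by move=> n; exact: leb_measurable_itv.
- by move=> n; apply: itv_ppos; rewrite bnd_simp.
Qed.

End DyadicBlocks.

(** * Discrete Hardy inequalities *)
Section Hardy.
Context {R : realType}.
Variable q : R.
Hypothesis q1 : 1 <= q.

Let q0 : 0 < q. Proof. exact: lt_le_trans ltr01 q1. Qed.
Let q_ge0 : 0 <= q. Proof. exact: ltW. Qed.

Lemma powR_le (x y : R) : 0 <= x -> x <= y -> x `^ q <= y `^ q.
Proof. by move=> x0 xy; apply: ge0_ler_powR; rewrite ?nnegrE// (le_trans x0). Qed.

Lemma powRD_le (x y : R) : 0 <= x -> 0 <= y ->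
  (x + y) `^ q <= 2 `^ q * (x `^ q + y `^ q).
Proof.
move=> x0 y0; wlog xy : x y x0 y0 / x <= y.
  move=> H; have [/H|/ltW/H] := leP x y; first exact.
  by rewrite (addrC y) (addrC (y `^ q)); apply.
apply: (@le_trans _ _ ((2 * y) `^ q)).
  by apply: powR_le; [exact: addr_ge0|lra].
by rewrite powRM// ler_pM2l ?powR_gt0// lerDr powR_ge0.
Qed.

Lemma bernoulli (y : R) n : 0 <= y <= 1 -> 1 - y ^+ n <= n%:R * (1 - y).
Proof.
move=> /andP[y0 y1]; elim: n => [|n IH]; first by rewrite expr0 subrr mul0r.
have -> : 1 - y ^+ n.+1 = (1 - y) + y * (1 - y ^+ n) by rewrite exprS; ring.
rewrite -natr1 mulrDl mul1r addrC lerD2r (le_trans _ IH)// ler_piMl//.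
by rewrite subr_ge0 exprn_ile1.
Qed.

Definition ceil_exp : R := (Num.truncn q).+1%:R.

(** A mean value inequality for the power [q].  By homogeneity it reduces to
    [P = 1], where it follows from the Bernoulli inequality for an integer
    exponent above [q]. *)
Lemma powR_sub_le (P p : R) : 0 <= p <= P ->
  P `^ q - p `^ q <= ceil_exp * P `^ (q - 1) * (P - p).
Proof.
move=> /andP[p0 pP]; have [P0|P0] := eqVneq P 0.
  have -> : p = 0 by apply/le_anti; rewrite p0 -P0 pP.
  by rewrite P0 !subrr mulr0.
have {}P0 : 0 < P by rewrite lt_def P0 (le_trans p0).
have y01 : 0 <= p / P <= 1 by rewrite divr_ge0 ?(ltW P0)//= ler_pdivrMr// mul1r.
have qc : q <= ceil_exp by apply/ltW/truncnS_gt.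
have -> : p `^ q = P `^ q * (p / P) `^ q.
  by rewrite -powRM ?(ltW P0)//; [rewrite mulrC divfK ?gt_eqF|case/andP: y01].
have -> : ceil_exp * P `^ (q - 1) * (P - p) = P `^ q * (ceil_exp * (1 - p / P)).
  rewrite -(@mulr_powRB1 _ P q) ?(ltW P0)//; field; exact: lt0r_neq0.
rewrite -{1}(mulr1 (P `^ q)) -mulrBr ler_pM2l ?powR_gt0//.
rewrite (le_trans _ (bernoulli _ y01))// lerD2l lerN2.
have [->|y0] := eqVneq (p / P) 0; first by rewrite expr0n powR_ge0.
rewrite -powR_mulrn ?(andP y01).1//; apply: ger_powR => //.
by rewrite lt_def y0.
Qed.

(** If [c <= a / 2] the first term on the right suffices; otherwise [a <= 2 c]
    and the second one does. *)
Lemma young_half (a c : R) : 0 <= a -> 0 <= c ->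
  a `^ (q - 1) * c <= a `^ q / 2 + 2 `^ (q - 1) * c `^ q.
Proof.
move=> a0 c0; have [ca|ac] := leP c (a / 2).
  apply: (@le_trans _ _ (a `^ q / 2)); last by rewrite lerDl mulr_ge0 ?powR_ge0.
  rewrite -(mulr_powRB1 a0 q0) mulrAC mulrC ler_wpM2r ?powR_ge0//.
apply: (@le_trans _ _ (2 `^ (q - 1) * c `^ q)); last by rewrite lerDr divr_ge0 ?powR_ge0.
rewrite -(mulr_powRB1 c0 q0) (mulrC c) mulrA ler_wpM2r// -powRM//.
by apply: ge0_ler_powR; rewrite ?nnegrE ?subr_ge0 ?mulr_ge0//; lra.
Qed.

(** One term of a Hardy sum after summation by parts.  The half of [w * P ^ q]
    on the right is to be absorbed by the left side of the Hardy inequality,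
    where the same quantity occurs with coefficient 1. *)
Lemma hardy_term (P p w W : R) : 0 <= p <= P -> 0 < w -> 0 <= W ->
  (P `^ q - p `^ q) * W <=
  w * P `^ q / 2 + 2 `^ (q - 1) * ceil_exp `^ q * (w * (W * (P - p) / w) `^ q).
Proof.
move=> pP w0 W0; have /andP[p0 pP'] := pP.
have P0 : 0 <= P := le_trans p0 pP'.
have e0 : 0 <= ceil_exp by rewrite /ceil_exp.
have c0 : 0 <= W * (P - p) / w by rewrite divr_ge0 ?(ltW w0)// mulr_ge0// subr_ge0.
apply: (@le_trans _ _ (w * (P `^ (q - 1) * (ceil_exp * (W * (P - p) / w))))).
  apply: (@le_trans _ _ ((ceil_exp * P `^ (q - 1) * (P - p)) * W)).
    by rewrite ler_wpM2r// powR_sub_le.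
  rewrite le_eqVlt; apply/orP; left; apply/eqP; field; exact: lt0r_neq0.
apply: (@le_trans _ _ (w * (P `^ q / 2 + 2 `^ (q - 1) * (ceil_exp * (W * (P - p) / w)) `^ q))).
  by rewrite ler_pM2l// young_half// mulr_ge0.
rewrite powRM// le_eqVlt; apply/orP; left; apply/eqP; ring.
Qed.

Definition hardy_const : R := 2 * (2 `^ (q - 1) * ceil_exp `^ q).

Lemma hardy_const_gt0 : 0 < hardy_const.
Proof. by rewrite /hardy_const !mulr_gt0 ?powR_gt0// /ceil_exp ltr0n. Qed.

Lemma abel_tail (w T : nat -> R) n : T 0 = 0 ->
  \sum_(i < n) w i * T i.+1 = \sum_(j < n) (T j.+1 - T j) * \sum_(j <= k < n) w k.
Proof.
move=> T0; elim: n => [|n IH]; first by rewrite !big_ord0.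
rewrite !big_ord_recr/= big_nat1 IH.
have -> : \sum_(i < n) (T i.+1 - T i) * \sum_(i <= k < n.+1) w k =
   \sum_(i < n) (T i.+1 - T i) * \sum_(i <= k < n) w k + w n * T n.
  have -> : T n = \sum_(i < n) (T i.+1 - T i).
    by rewrite -(big_mkord xpredT (fun i => T i.+1 - T i)) telescope_sumr// T0 subr0.
  rewrite mulr_sumr -big_split/=; apply: eq_bigr => i _.
  by rewrite big_nat_recr/= 1?ltnW// mulrDr (mulrC (w n)).
ring.
Qed.

Lemma abel_head (w T : nat -> R) n :
  \sum_(i < n) w i * T i =
  \sum_(j < n) (T j - T j.+1) * (\sum_(k < j.+1) w k) + T n * \sum_(k < n) w k.
Proof.
elim: n => [|n IH]; first by rewrite !big_ord0 mulr0 addr0.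
rewrite !big_ord_recr/= IH; ring.
Qed.

(** All sums are finite, so that [L] can be subtracted from both sides. *)
Lemma hardy_absorb n (w S RHS : nat -> R) (L : R) :
  L = \sum_(i < n) w i * S i `^ q ->
  L <= \sum_(i < n) (w i * S i `^ q / 2 + 2 `^ (q - 1) * ceil_exp `^ q * RHS i) ->
  L <= hardy_const * \sum_(i < n) RHS i.
Proof.
move=> LE; rewrite big_split/= -mulr_suml -LE -mulr_sumr /hardy_const; lra.
Qed.

(** The weight is arbitrary: summation by parts moves the sum to the weight and
    leaves the increments of the powers of the head sums of [h], which
    [hardy_term] estimates. *)
Lemma discrete_hardy n (w h : nat -> R) : (forall i, 0 < w i) -> (forall i, 0 <= h i) ->
  \sum_(i < n) w i * (\sum_(j < i.+1) h j) `^ q <=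
  hardy_const * \sum_(i < n) w i * ((\sum_(i <= k < n) w k) * h i / w i) `^ q.
Proof.
move=> w0 h0; apply: (@hardy_absorb n w (fun i => \sum_(j < i.+1) h j)
  (fun i => w i * ((\sum_(i <= k < n) w k) * h i / w i) `^ q)) => //.
have T0 : (\sum_(j < 0) h j) `^ q = 0 by rewrite big_ord0 powR0// gt_eqF.
rewrite (@abel_tail w (fun l => (\sum_(j < l) h j) `^ q))//.
apply: ler_sum => i _.
have hE : h i = \sum_(j < i.+1) h j - \sum_(j < i) h j by rewrite big_ord_recr/= addrAC subrr add0r.
rewrite hE; apply: hardy_term => //; last by apply: sumr_ge0 => k _; exact: ltW.
by rewrite sumr_ge0//= big_ord_recr/= lerDl.
Qed.

(** The same argument, with heads and tails exchanged. *)
Lemma discrete_hardy_dual n (w h : nat -> R) : (forall i, 0 < w i) -> (forall i, 0 <= h i) ->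
  \sum_(i < n) w i * (\sum_(i <= k < n) h k) `^ q <=
  hardy_const * \sum_(i < n) w i * ((\sum_(k < i.+1) w k) * h i / w i) `^ q.
Proof.
move=> w0 h0; apply: (@hardy_absorb n w (fun i => \sum_(i <= k < n) h k)
  (fun i => w i * ((\sum_(k < i.+1) w k) * h i / w i) `^ q)) => //.
rewrite (@abel_head w (fun l => (\sum_(l <= k < n) h k) `^ q))//.
rewrite big_geq// powR0 ?gt_eqF// mul0r addr0.
apply: ler_sum => i _.
have hE : h i = \sum_(i <= k < n) h k - \sum_(i.+1 <= k < n) h k.
  by rewrite (big_ltn (ltn_ord i)) addrK.
rewrite hE; apply: hardy_term => //; last by apply: sumr_ge0 => k _; exact: ltW.
by rewrite sumr_ge0//= (big_ltn (ltn_ord i)) lerDr.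
Qed.

End Hardy.

Section Geometric.
Context {R : realType}.

Lemma geometric_le (r : R) n : 0 <= r < 1 -> \sum_(i < n) r ^+ i <= (1 - r)^-1.
Proof.
move=> /andP[r0 r1]; have r1' : 0 < 1 - r by rewrite subr_gt0.
rewrite -(ler_pM2l r1') mulfV ?gt_eqF//.
have := subrX1 r n; rewrite -opprB => h.
have -> : (1 - r) * \sum_(i < n) r ^+ i = 1 - r ^+ n by rewrite -[RHS]opprB subrX1; ring.
by rewrite lerBlDr lerDl exprn_ge0.
Qed.

Lemma geometric_tail_le (r : R) m n : 0 <= r < 1 ->
  \sum_(m <= i < n) r ^+ i <= r ^+ m / (1 - r).
Proof.
move=> r01; rewrite -{1}(add0n m) big_addn big_mkord.
rewrite (eq_bigr (fun i : 'I_(n - m) => r ^+ m * r ^+ i)); last first.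
  by move=> i _; rewrite exprD mulrC.
rewrite -mulr_sumr ler_wpM2l ?geometric_le//.
by rewrite exprn_ge0//; case/andP: r01.
Qed.

(** The ratio of the geometric series in which [sqrt t] is compared with [t]
    along the powers of two. *)
Definition sqrt2i : R := (Num.sqrt 2)^-1.

Lemma sqrt2i_bounds : 0 < sqrt2i < 1.
Proof.
have s1 : 1 < Num.sqrt (2 : R) by rewrite -{1}sqrtr1 ltr_sqrt// ltr1n.
by rewrite /sqrt2i invr_gt0 (lt_trans ltr01 s1)//= invf_lt1// (lt_trans ltr01 s1).
Qed.

Lemma sqrt2iX n : Num.sqrt (2 ^+ n) / 2 ^+ n = sqrt2i ^+ n.
Proof.
have -> : Num.sqrt ((2 : R) ^+ n) = Num.sqrt 2 ^+ n.
  elim: n => [|n IH]; first by rewrite !expr0 sqrtr1.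
  by rewrite !exprS sqrtrM// IH.
have s0 : Num.sqrt (2 : R) != 0 by rewrite gt_eqF// sqrtr_gt0.
rewrite -expr_div_n; congr (_ ^+ _); rewrite /sqrt2i -{2}(@sqr_sqrtr _ (2:R))//.
by field.
Qed.

End Geometric.

(** * Weights, their dyadic blocks and their tails *)
Section Growth.
Context {R : realType}.
Implicit Types (b : R -> R).

(** Slow variation is used through this bound alone.  Any exponent below 1
    could replace that of the square root: the point is that [t] grows
    faster. *)
Definition half_growth (C : R) (B : R -> R) := forall y t : R, 0 < y -> y <= t ->
  B t <= C * Num.sqrt (t / y) * B y /\ B y <= C * Num.sqrt (t / y) * B t.

(** Slow variation with the exponent [1 / (2 q)] bounds [b t / b y] and its
    inverse by multiples of [(t / y) ^ (1 / (2 q))]; then take the power [q]. *)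
Lemma sv_growth (q : R) b : 1 <= q -> slowly_varying b ->
  exists2 C : R, 1 <= C & half_growth C (fun t => b t `^ q).
Proof.
move=> q1 [b0 mb hup hdown]; have q0 : 0 < q := lt_le_trans ltr01 q1.
pose e := (2 * q)^-1; have e0 : 0 < e by rewrite /e invr_gt0 mulr_gt0.
have [g1 g1nd [C1 C1p h1]] := hup e e0; have [g2 g2ni [C2 C2p h2]] := hdown e e0.
exists (1 + (C1 ^+ 2) `^ q + (C2 ^+ 2) `^ q); first by rewrite -addrA lerDl addr_ge0 ?powR_ge0.
move=> y t y0 yt; have t0 := lt_le_trans y0 yt.
have Py : ppos y by apply/ppos_gt0. have Pt : ppos t by apply/ppos_gt0.
have by0 := b0 _ Py; have bt0 := b0 _ Pt.
have ty0 : 0 < t / y by rewrite divr_gt0.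
have sE : ((t / y) `^ e) `^ q = Num.sqrt (t / y).
  rewrite -powRrM -powR12_sqrt ?(ltW ty0)//; congr (_ `^ _); rewrite /e.
  by field; rewrite gt_eqF.
have key (u v D : R) : 0 < u -> 0 < v -> 0 < D -> u <= D ^+ 2 * (t / y) `^ e * v ->
    D = C1 \/ D = C2 ->
    u `^ q <= (1 + (C1 ^+ 2) `^ q + (C2 ^+ 2) `^ q) * Num.sqrt (t / y) * v `^ q.
  move=> u0 v0 D0 uv DC; apply: (@le_trans _ _ ((D ^+ 2 * (t / y) `^ e * v) `^ q)).
    by apply: ge0_ler_powR; rewrite ?nnegrE ?(ltW q0) ?(ltW u0)// !mulr_ge0 ?powR_ge0 ?(ltW v0)// ?exprn_ge0// ltW.
  have D2 : 0 <= D ^+ 2 by rewrite exprn_ge0// ltW.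
  rewrite (@powRM _ (D ^+ 2 * (t / y) `^ e)) ?(ltW v0)//; last by rewrite mulr_ge0 ?powR_ge0.
  rewrite (@powRM _ (D ^+ 2)) ?powR_ge0// sE.
  rewrite ler_wpM2r ?powR_ge0// ler_wpM2r ?sqrtr_ge0//.
  have := powR_ge0 (C1 ^+ 2) q; have := powR_ge0 (C2 ^+ 2) q.
  by case: DC => ->; lra.
have te0 := powR_gt0 e t0; have ye0 := powR_gt0 e y0.
have divE : (t / y) `^ e = t `^ e / y `^ e.
  by rewrite powRM ?(ltW t0) ?invr_ge0 ?(ltW y0)// -powR_inv1 ?(ltW y0)// powRAC powR_inv1// ltW.
split.
  apply: (key _ _ C2) => //; last by right.
  have [ht _] := h2 _ Pt; have [_ hy] := h2 _ Py; have gg := g2ni _ _ Py Pt yt.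
  rewrite !powRN in ht hy.
  have : (t `^ e)^-1 * b t <= C2 ^+ 2 * ((y `^ e)^-1 * b y).
    apply: (le_trans ht); rewrite expr2 -mulrA ler_pM2l//; exact: le_trans gg hy.
  rewrite -(ler_pM2l te0) mulrA mulfV ?gt_eqF// mul1r divE => /le_trans; apply.
  by rewrite le_eqVlt; apply/orP; left; apply/eqP; ring.
apply: (key _ _ C1) => //; last by left.
have [_ ht] := h1 _ Pt; have [hy _] := h1 _ Py; have gg := g1nd _ _ Py Pt yt.
have : y `^ e * b y <= C1 ^+ 2 * (t `^ e * b t).
  apply: (le_trans hy); rewrite expr2 -mulrA ler_pM2l//; exact: le_trans gg ht.
rewrite -ler_pdivlMl// => /le_trans; apply; rewrite divE.
by rewrite le_eqVlt; apply/orP; left; apply/eqP; ring.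
Qed.

End Growth.

(** Such a weight [B] is the density, for [dt/t], of the energies below: it plays
    the part of the power [q] of a slowly varying function. *)
Record half_weight {R : realType} (C : R) (B : R -> R) : Prop := HalfWeight {
  hw_gt0 : forall t : R, 0 < t -> 0 < B t ;
  hw_meas : lmeas B ;
  hw_ge1 : 1 <= C ;
  hw_growth : half_growth C B ;
  hw_fin : (haarint (ray 1) B < +oo)%E }.

Section Weight.
Context {R : realType}.
Variables (B : R -> R) (C : R).
Hypothesis wB : half_weight C B.

Let B0 := hw_gt0 wB.
Let mB := hw_meas wB.
Let C1 := hw_ge1 wB.
Let grB := hw_growth wB.
Let finB := hw_fin wB.

Let Bge (t : R) : 0 < t -> 0 <= B t. Proof. by move=> /B0/ltW. Qed.
Let c := 2 * C.
Let c1 : 1 <= c. Proof. rewrite /c; have := C1; lra. Qed.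
Let c0 : 0 < c. Proof. exact: lt_le_trans c1. Qed.

Lemma weight_dyadic (y t : R) : 0 < y -> y <= t <= y * 2 -> B t <= c * B y /\ B y <= c * B t.
Proof.
move=> y0 /andP[yt ty]; have t0 := lt_le_trans y0 yt.
have [h1 h2] := grB y0 yt; have s2 : Num.sqrt (t / y) <= 2.
  have -> : 2 = Num.sqrt ((2 : R) ^+ 2) by rewrite sqrtr_sqr ger0_norm.
  rewrite ler_wsqrtr// ler_pdivrMr//; lra.
have Cs : C * Num.sqrt (t / y) <= c by rewrite /c mulrC ler_pM2r//; have := C1; lra.
by split; [apply: (le_trans h1)|apply: (le_trans h2)]; rewrite ler_wpM2r// ?Bge.
Qed.

Definition block_mass (y : R) : R := fine (haarint (oc y (y * 2)) B).
Local Notation w := block_mass.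

Lemma block_mass_bounds (y : R) : 0 < y ->
  [/\ haarint (oc y (y * 2)) B = (w y)%:E, B y <= 2 * c * w y & w y <= c * B y].
Proof.
move=> y0; have yP := dyadic_ppos y0; have By := B0 y0.
have up : (haarint (oc y (y * 2)) B <= (c * B y)%:E)%E.
  have /andP[_ ] := @haarint_dyadic_cst _ y (c * B y) y0 (mulr_ge0 (ltW c0) (ltW By)).
  apply: le_trans; apply: haarint_le => // t; first by move=> /yP/ppos_gt0/Bge.
  by rewrite /= in_itv/= => /andP[yt ty]; have [] := @weight_dyadic y t y0; rewrite ?(ltW yt) ?ty.
have lo : ((B y / c / 2)%:E <= haarint (oc y (y * 2)) B)%E.
  have /andP[+ _] := @haarint_dyadic_cst _ y (B y / c) y0 (divr_ge0 (ltW By) (ltW c0)).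
  move=> /le_trans; apply; apply: haarint_le => // t; first by move=> _; rewrite divr_ge0 ?ltW.
  rewrite /= in_itv/= => /andP[yt ty]; have [|_ h] := @weight_dyadic y t y0; first by rewrite (ltW yt) ty.
  by rewrite ler_pdivrMr// mulrC.
have fin : haarint (oc y (y * 2)) B \is a fin_num.
  rewrite ge0_fin_numE ?(le_lt_trans up) ?ltry//.
  by apply: haarint_ge0 => // t /yP/ppos_gt0/Bge.
have E : haarint (oc y (y * 2)) B = (w y)%:E by rewrite /w fineK.
split => //; last by rewrite -lee_fin -E.
move: lo; rewrite E lee_fin ler_pdivrMr// ler_pdivrMr// => /le_trans; apply.
by rewrite le_eqVlt; apply/orP; left; apply/eqP; ring.
Qed.

Lemma block_mass_gt0 (y : R) : 0 < y -> 0 < w y.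
Proof.
move=> y0; have [_ h _] := block_mass_bounds y0.
have := lt_le_trans (B0 y0) h; rewrite pmulr_rgt0//; have := c0; lra.
Qed.

Definition tail_mass (y : R) : R := fine (haarint (ray y) B).
Local Notation W := tail_mass.

Lemma tail_split (y z : R) : 0 < y -> y <= z ->
  (haarint (ray y) B = haarint (oc y z) B + haarint (ray z) B)%E.
Proof. by move=> y0 yz; apply: haarint_split => //; rewrite ltW. Qed.

Lemma haarint_blocks (y : R) n : 0 < y ->
  (haarint (oc y (y * 2 ^+ n)) B = (\sum_(i < n) w (y * 2 ^+ i))%:E)%E.
Proof.
move=> y0; rewrite haarint_dyadic_sum//.
rewrite -sumEFin; apply: eq_bigr => i _.
by have [] := @block_mass_bounds (y * 2 ^+ i); rewrite ?mulr_gt0 ?exprn_gt0.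
Qed.

Lemma tail_massE (y : R) : 0 < y -> haarint (ray y) B = (W y)%:E.
Proof.
move=> y0; rewrite /W fineK//.
have [n hn] := pow2_unbounded y^-1.
have n1 : 1 <= y * 2 ^+ n by rewrite mulrC -ler_pdivrMr// mul1r.
rewrite ge0_fin_numE; last first.
  by apply: haarint_ge0 => [|t /(tail_ppos y0)/ppos_gt0/Bge//]; exact: tail_ppos.
rewrite (@tail_split _ (y * 2 ^+ n))//; last by rewrite ler_peMr ?pow2_ge1// ltW.
rewrite haarint_blocks// lte_add_pinfty ?ltry//; apply: le_lt_trans finB.
apply: haarint_subset => [t /=||t /(tail_ppos ltr01)/ppos_gt0/Bge//]; last exact: tail_ppos.
by rewrite !in_itv/= !andbT; exact: le_lt_trans.
Qed.

Lemma tail_mass_step (y : R) : 0 < y -> W y = w y + W (y * 2).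
Proof.
move=> y0; have y20 : 0 < y * 2 by rewrite mulr_gt0.
apply: EFin_inj; rewrite EFinD -(tail_massE y0) -(tail_massE y20).
have [<- _ _] := block_mass_bounds y0; apply: tail_split => //; lra.
Qed.

Lemma tail_mass_gt0 (y : R) : 0 < y -> 0 < W y.
Proof.
move=> y0; rewrite tail_mass_step// ltr_pwDl ?block_mass_gt0//.
have y20 : 0 < y * 2 by rewrite mulr_gt0.
rewrite -lee_fin -tail_massE//; apply: haarint_ge0; first exact: tail_ppos.
by move=> t /(tail_ppos y20)/ppos_gt0/Bge.
Qed.

Lemma block_le_tail (y : R) : 0 < y -> w y <= W y.
Proof. by move=> y0; rewrite tail_mass_step// lerDl ltW// tail_mass_gt0// mulr_gt0. Qed.

Lemma tail_mass_ni (y z : R) : 0 < y -> y <= z -> W z <= W y.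
Proof.
move=> y0 yz; have z0 := lt_le_trans y0 yz; rewrite -lee_fin -!tail_massE//.
apply: haarint_subset => [t /=||t /(tail_ppos y0)/ppos_gt0/Bge//]; last exact: tail_ppos.
by rewrite !in_itv/= !andbT; exact: le_lt_trans.
Qed.

Lemma tail_mass_sum (y : R) n : 0 < y ->
  W y = \sum_(i < n) w (y * 2 ^+ i) + W (y * 2 ^+ n).
Proof.
move=> y0; apply: EFin_inj; rewrite EFinD -haarint_blocks// -!tail_massE//.
  by apply: tail_split => //; rewrite ler_peMr ?pow2_ge1// ltW.
by rewrite mulr_gt0// exprn_gt0.
Qed.

Definition tail_ratio : R := 1 + 2 * c ^+ 3.
Local Notation kap := tail_ratio.

Lemma tail_ratio_ge1 : 1 <= kap.
Proof. by rewrite /kap lerDl mulr_ge0// exprn_ge0// ltW. Qed.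

(** The block at [y] is comparable to the block at [2 y], which is a part of the
    tail from [2 y] on. *)
Lemma tail_mass_double (y : R) : 0 < y -> W y <= kap * W (y * 2).
Proof.
move=> y0; have y20 : 0 < y * 2 by rewrite mulr_gt0.
rewrite tail_mass_step// /kap mulrDl mul1r addrC lerD2l.
have [_ _ h1] := block_mass_bounds y0; have [_ h2 _] := block_mass_bounds y20.
have [_ h3] : B (y * 2) <= c * B y /\ B y <= c * B (y * 2).
  by apply: weight_dyadic => //; lra.
apply: (le_trans h1); have h4 := block_le_tail y20.
have : c * B y <= c * (c * (2 * c * W (y * 2))).
  rewrite ler_pM2l// (le_trans h3)// ler_pM2l// (le_trans h2)// ler_pM2l//; have := c0; lra.
move=> /le_trans; apply.
by rewrite le_eqVlt; apply/orP; left; apply/eqP; ring.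
Qed.

(** Otherwise the integrals over [ ]1, 2^n] ] would all be at most [W 1 - e],
    and so would their limit [W 1]. *)
Lemma tail_mass_small (e : R) : 0 < e -> exists n, W (2 ^+ n) <= e.
Proof.
move=> e0; apply: contrapT => /forallNP H.
have {}H n : e < W (2 ^+ n) by rewrite ltNge; apply/negP/H.
have : (haarint (ray 1) B <= (W 1 - e)%:E)%E.
  apply: haarint_ray1_le => //.
  move=> n; have := @haarint_blocks 1 n ltr01; rewrite mul1r => ->.
  rewrite lee_fin (@tail_mass_sum 1 n)// mul1r; have := H n; lra.
by rewrite tail_massE// lee_fin; lra.
Qed.

Section AWeight.
(* When [B] is the power [q] of the weight of a K-space, [al] is the power [q]
   of the weight of the corresponding J-space. *)
Variables (q : R) (al : R -> R).
Hypothesis q1 : 1 <= q.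
Hypothesis alE : forall t, 0 < t -> al t = B t * (W t / B t) `^ q.

Let D := 2 * c ^+ 2.
Definition dual_weight_const : R := D * (kap * D) `^ q.

Let D0 : 0 < D. Proof. by rewrite /D mulr_gt0// exprn_gt0. Qed.
Let kap0 : 0 < kap. Proof. exact: lt_le_trans tail_ratio_ge1. Qed.

Lemma dual_weight_const_gt0 : 0 < dual_weight_const.
Proof. by rewrite /dual_weight_const mulr_gt0// powR_gt0// mulr_gt0. Qed.

(** On a dyadic block both [B] and its tail mass vary by bounded factors. *)
Lemma dual_weight_bounds (y t : R) : 0 < y -> y < t <= y * 2 ->
  al t <= dual_weight_const * (w y * (W y / w y) `^ q) /\
  w y * (W y / w y) `^ q <= dual_weight_const * al t.
Proof.
move=> y0 /andP[yt ty]; have t0 := lt_trans y0 yt; have y20 : 0 < y * 2 by lra.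
have yty : y <= t <= y * 2 by rewrite ty ltW.
have [h1 h2] := weight_dyadic y0 yty; have [_ h3 h4] := block_mass_bounds y0.
have w0 := block_mass_gt0 y0; have Bt := B0 t0; have By := B0 y0.
have Bw : B t <= D * w y.
  apply: (le_trans h1); apply: (@le_trans _ _ (c * (2 * c * w y))); first by rewrite ler_pM2l.
  by rewrite /D le_eqVlt; apply/orP; left; apply/eqP; ring.
have wleB : w y <= D * B t.
  apply: (le_trans h4); apply: (@le_trans _ _ (c * (c * B t))); first by rewrite ler_pM2l.
  have : 0 <= c * (c * B t) by apply: mulr_ge0; [exact: ltW|apply: mulr_ge0; exact: ltW].
  rewrite /D; lra.
have Wty := tail_mass_ni y0 (ltW yt).
have Wyt : W y <= kap * W t.
  by apply: (le_trans (tail_mass_double y0)); rewrite ler_pM2l// tail_mass_ni.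
have Wt0 := tail_mass_gt0 t0; have Wy0 := tail_mass_gt0 y0.
have kD : D <= kap * D by rewrite ler_peMl ?tail_ratio_ge1// ltW.
have kD0 : 0 < kap * D by rewrite mulr_gt0.
have rat (W1 W2 b1 b2 k : R) : 0 < W1 -> 0 < W2 -> 0 < b1 -> 0 < b2 -> 0 < k ->
    W1 <= k * W2 -> b1 <= D * b2 -> b2 <= D * b1 -> k <= kap ->
    b1 * (W1 / b1) `^ q <= dual_weight_const * (b2 * (W2 / b2) `^ q).
  move=> W10 W20 b10 b20 k0 WW b12 b21 kk.
  have -> : dual_weight_const * (b2 * (W2 / b2) `^ q) = D * b2 * (kap * D * (W2 / b2)) `^ q.
    by rewrite (@powRM _ (kap * D)) ?(ltW kD0) ?divr_ge0 ?ltW// /dual_weight_const; ring.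
  apply: ler_pM => //; rewrite ?powR_ge0 ?(ltW b10)//.
  apply: powR_le => //; first by rewrite divr_ge0 ?ltW.
  rewrite ler_pdivrMr// (le_trans WW)//.
  apply: (@le_trans _ _ (kap * W2)); first by rewrite ler_pM2r.
  have -> : kap * D * (W2 / b2) * b1 = kap * W2 * (D * b1 / b2) by field; rewrite gt_eqF.
  by rewrite ler_peMr ?mulr_ge0 ?(ltW kap0) ?(ltW W20)// ler_pdivlMr// mul1r.
rewrite alE//; split.
  by apply: (rat _ _ _ _ 1) => //; rewrite ?mul1r ?tail_ratio_ge1.
by apply: (rat _ _ _ _ kap).
Qed.

End AWeight.
End Weight.

(** * A Hardy inequality for the kernel min(1, y / s) *)
Section HardyKernel.
Context {R : realType}.

(** The Jensen inequality on a dyadic block, up to a factor.  It results from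
    [h <= l + l ^ (1 - q) * h ^ q], where [l = 1] gives the finiteness, and
    [l] equal to half the integral of [h] gives the estimate. *)
Lemma haarint_block_powR (q y : R) (h : R -> R) : 1 <= q -> 0 < y -> lmeas h ->
  (forall t, 0 < t -> 0 <= h t) -> (haarint (oc y (y * 2)) (fun t => h t `^ q)%R < +oo)%E ->
  haarint (oc y (y * 2)) h \is a fin_num /\
  fine (haarint (oc y (y * 2)) h) `^ q <=
    2 `^ q * fine (haarint (oc y (y * 2)) (fun t => h t `^ q)).
Proof.
move=> q1 y0 mh h0; have q0 : 0 < q := lt_le_trans ltr01 q1.
have yP := @dyadic_ppos R y y0.
have mD : measurable (oc y (y * 2) : set (lebType R)) by exact: leb_measurable_itv.
set s := haarint _ _ => sfin.
have s0 : (0 <= s)%E by apply: haarint_ge0 => // t _; exact: powR_ge0.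
have sE : s = (fine s)%:E by rewrite fineK// ge0_fin_numE.
have main (l : R) : 0 < l -> (haarint (oc y (y * 2)) h <= (l + l `^ (1 - q) * fine s)%:E)%E.
  move=> l0; rewrite EFinD EFinM -sE.
  have h1 : (haarint (oc y (y * 2)) h <= haarint (oc y (y * 2)) (fun t => l + l `^ (1 - q) * h t `^ q)%R)%E.
    apply: haarint_le => // t Dt; have t0 : 0 < t by apply/ppos_gt0/yP.
      exact: h0.
    have [hl|lh] := leP (h t) l; first by rewrite (le_trans hl)// lerDl mulr_ge0 ?powR_ge0.
    rewrite ler_wpDl ?(ltW l0)//.
    have ht : 0 < h t := lt_trans l0 lh.
    rewrite -(mulr_powRB1 (ltW ht) q0) mulrCA ler_peMr ?(ltW ht)//.
    have -> : 1 - q = - (q - 1) by ring.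
    rewrite powRN mulrC ler_pdivlMr ?powR_gt0// mul1r.
    by apply: ge0_ler_powR; rewrite ?nnegrE ?subr_ge0 ?(ltW l0) ?(ltW ht)// ltW.
  apply: (le_trans h1).
  have mq := lmeas_powR q mh.
  rewrite (@haarintD _ _ (fun=> l))//; last first.
  - by move=> t _; rewrite mulr_ge0 ?powR_ge0.
  - by move=> t _; exact: ltW.
  - by apply: measurable_funM => //; exact: measurable_cst.
  - exact: measurable_cst.
  apply: leeD; first by have /andP[] := haarint_dyadic_cst y0 (ltW l0).
  by rewrite haarintZ// ?powR_ge0// => t _; exact: powR_ge0.
have hge : (0 <= haarint (oc y (y * 2)) h)%E by apply: haarint_ge0 => // t /yP/ppos_gt0/h0.
have hfin : haarint (oc y (y * 2)) h \is a fin_num.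
  by rewrite ge0_fin_numE// (le_lt_trans (main 1 ltr01))// ltry.
split => //; set x := fine _; have x0 : 0 <= x by exact: fine_ge0.
have {}main (l : R) : 0 < l -> x <= l + l `^ (1 - q) * fine s.
  by move=> l0; have := main l l0; rewrite -(fineK hfin) lee_fin.
have fs0 : 0 <= fine s by exact: fine_ge0.
have [xz|xn] := eqVneq x 0; first by rewrite xz powR0 ?gt_eqF// mulr_ge0 ?powR_ge0.
have {xn}x0 : 0 < x by rewrite lt_def xn.
have := main (x / 2); rewrite divr_gt0// => /(_ isT).
have l0 : 0 < x / 2 by rewrite divr_gt0.
move: l0; have -> : x `^ q = 2 `^ q * (x / 2) `^ q.
  by rewrite -powRM// ?divr_ge0 ?(ltW x0)//; congr (_ `^ _); field.
set l := x / 2 => l0 hl; rewrite ler_pM2l ?powR_gt0//.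
have {}hl : l <= l `^ (1 - q) * fine s.
  by move: hl; have -> : x = l + l by [rewrite /l; field]; rewrite lerD2l.
have lq : 0 < l `^ (q - 1) by rewrite powR_gt0.
rewrite -(mulr_powRB1 (ltW l0) q0) mulrC -ler_pdivlMl//.
by rewrite -powRN opprB.
Qed.

(** The kernel by which the J-functional controls the K-functional:
    [K x t <= min(1, t / s) * J x s]. *)
Definition kmin (y s : R) : R := Num.min 1 (y / s).

Lemma kmin_ge0 (y s : R) : 0 < y -> 0 < s -> 0 <= kmin y s.
Proof. by move=> y0 s0; rewrite /kmin le_min ler01 divr_ge0 ?ltW. Qed.

Lemma lmeas_kmin (y : R) : 0 < y -> lmeas (kmin y).
Proof.
move=> y0; apply: measurable_minr; first exact: measurable_cst.
apply: measurable_funM; first exact: measurable_cst.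
by apply: nonincreasing_leb_measurable => x z /ppos_gt0 x0 /ppos_gt0 z0 xz; rewrite lef_pV2.
Qed.

Variables (B : R -> R) (C q : R) (al : R -> R).
Hypothesis wB : half_weight C B.
Hypothesis q1 : 1 <= q.
Hypothesis alE : forall t, 0 < t -> al t = B t * (tail_mass B t / B t) `^ q.
Hypothesis mal : lmeas al.

Local Notation w := (block_mass B).
Local Notation W := (tail_mass B).
Let q0 : 0 < q. Proof. exact: lt_le_trans ltr01 q1. Qed.
Let al0 t : 0 < t -> 0 <= al t.
Proof.
by move=> t0; rewrite alE// mulr_ge0 ?powR_ge0// ltW// (hw_gt0 wB).
Qed.

Definition head_const : R := 8 * C ^+ 3 / (1 - sqrt2i).

Let C0 : 0 < C. Proof. exact: lt_le_trans ltr01 (hw_ge1 wB). Qed.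

Lemma head_const_gt0 : 0 < head_const.
Proof.
have /andP[_ r1] := @sqrt2i_bounds R.
by rewrite /head_const divr_gt0 ?subr_gt0// mulr_gt0// exprn_gt0.
Qed.

(** Going down from the last block, [B] increases at most like a square root
    while [t ^ q] decreases at least linearly, so that the terms are dominated by
    a geometric series of ratio [1 / sqrt 2]. *)
Lemma head_mass_le (y : R) i : 0 < y ->
  \sum_(k < i.+1) w (y * 2 ^+ k) * (y * 2 ^+ k) `^ q <=
  head_const * (w (y * 2 ^+ i) * (y * 2 ^+ i) `^ q).
Proof.
move=> y0; have p2 n : 0 < (2 : R) ^+ n by rewrite exprn_gt0.
have yp n : 0 < y * 2 ^+ n by rewrite mulr_gt0.
set yi := y * 2 ^+ i; set Z := w yi * yi `^ q.
have Z0 : 0 <= Z by rewrite /Z mulr_ge0 ?powR_ge0// ltW// (block_mass_gt0 wB)// /yi.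
apply: (@le_trans _ _ (\sum_(k < i.+1) (8 * C ^+ 3 * Z) * sqrt2i ^+ (i - k))).
  apply: ler_sum => k _; set yk := y * 2 ^+ k.
  have ki : (k <= i)%N by rewrite -ltnS.
  have yiE : yi = yk * 2 ^+ (i - k) by rewrite /yi /yk -mulrA -exprD subnKC.
  have yk0 : 0 < yk by rewrite /yk.
  have yi0 : 0 < yi by rewrite /yi.
  have [_ _ h1] := block_mass_bounds wB yk0.
  have [_ h2 _] := block_mass_bounds wB yi0.
  have [_ h3] : B yi <= C * Num.sqrt (yi / yk) * B yk /\ B yk <= C * Num.sqrt (yi / yk) * B yi.
    by apply: (hw_growth wB) => //; rewrite yiE ler_peMr ?pow2_ge1// ltW.
  have rE : yi / yk = 2 ^+ (i - k) by rewrite yiE mulrC mulKf// gt_eqF.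
  rewrite rE in h3; set s := Num.sqrt _ in h3; set p := 2 ^+ (i - k) in rE yiE s h3 *.
  have pp : 1 <= p by rewrite /p pow2_ge1.
  have p0 : 0 < p := lt_le_trans ltr01 pp.
  have s0 : 0 <= s by rewrite sqrtr_ge0.
  have powE : yk `^ q <= yi `^ q / p.
    rewrite ler_pdivlMr// yiE powRM ?(ltW yk0) ?(ltW p0)// ler_pM2l ?powR_gt0//.
    by apply: le1r_powR.
  have wE : w yk <= 8 * C ^+ 3 * s * w yi.
    apply: (le_trans h1); apply: (@le_trans _ _ (2 * C * (C * s * (2 * (2 * C) * w yi)))).
      by rewrite ler_pM2l ?mulr_gt0// (le_trans h3)// ler_wpM2l// mulr_ge0// ltW.
    by rewrite le_eqVlt; apply/orP; left; apply/eqP; ring.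
  apply: (@le_trans _ _ ((8 * C ^+ 3 * s * w yi) * (yi `^ q / p))).
    by apply: ler_pM => //; rewrite ?powR_ge0// ltW// (block_mass_gt0 wB).
  rewrite -sqrt2iX -/p -/s /Z le_eqVlt; apply/orP; left; apply/eqP; ring.
have -> : head_const * Z = 8 * C ^+ 3 * Z * (1 - sqrt2i)^-1 by rewrite /head_const; ring.
rewrite -mulr_sumr ler_wpM2l//.
  by rewrite mulr_ge0// mulr_ge0// exprn_ge0// ltW.
rewrite (reindex_inj rev_ord_inj)/=.
rewrite (eq_bigr (fun k : 'I_i.+1 => sqrt2i ^+ k)); last first.
  by move=> k _; rewrite subSS subKn// -ltnS.
by apply: geometric_le; have /andP[/ltW-> ->] := @sqrt2i_bounds R.
Qed.

Definition hardyK_const : R :=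
  2 `^ q * (hardy_const q * (1 + head_const `^ q) * (2 `^ q * dual_weight_const C q)).

Lemma hardyK_const_gt0 : 0 < hardyK_const.
Proof.
have h1 := hardy_const_gt0 q; have h2 := dual_weight_const_gt0 wB q.
have h3 : 0 < 1 + head_const `^ q by rewrite ltr_wpDr ?powR_ge0.
by do !apply: mulr_gt0 => //; exact: powR_gt0.
Qed.

(** With [y_i = y0 * 2 ^ i], the kernel at [y_i] is at most 1 on the blocks up to
    [y_i], which leads to the head sums of [discrete_hardy], and at most
    [y_i / y_k] on a later block at [y_k], which leads to the tail sums of
    [discrete_hardy_dual] for the weight [w (y_i) * y_i ^ q].  In the first case
    the tails of the weight are at most [W]; in the second its heads are
    estimated by [head_mass_le]. *)
Lemma hardy_kernel (y0 : R) n (h : R -> R) (T : R) : 0 < y0 -> lmeas h ->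
  (forall t, 0 < t -> 0 <= h t) ->
  (haarint ppos (fun t => al t * h t `^ q)%R <= T%:E)%E ->
  exists G : nat -> R, [/\ forall i, 0 <= G i,
    forall i, (i < n)%N ->
      (haarint (oc y0 (y0 * 2 ^+ n)) (fun s => kmin (y0 * 2 ^+ i) s * h s)%R <= (G i)%:E)%E &
    \sum_(i < n) w (y0 * 2 ^+ i) * G i `^ q <= hardyK_const * T].
Proof.
move=> y00 mh h0 hT.
pose y i : R := y0 * 2 ^+ i.
have yp i : 0 < y i by rewrite /y mulr_gt0// exprn_gt0.
have yS i : y i.+1 = y i * 2 by rewrite /y exprSr mulrA.
have wp i : 0 < w (y i) by exact: block_mass_gt0 wB _ _.
have Wp i : 0 < W (y i) by exact: tail_mass_gt0 wB _ _.
pose D i := oc (y i) (y i * 2).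
have DP i : D i `<=` (ppos : set R) by exact: dyadic_ppos.
have mD i : measurable (D i : set (lebType R)) by exact: leb_measurable_itv.
pose ra i := w (y i) * (W (y i) / w (y i)) `^ q.
have ra0 i : 0 < ra i by rewrite /ra mulr_gt0 ?powR_gt0// divr_gt0.
have ac0 : 0 < dual_weight_const C q := dual_weight_const_gt0 wB q.
have mq := lmeas_powR q mh.
(* Up to a factor, [al] is the constant [ra i] on the block [D i]. *)
have sle i : ((ra i)%:E * haarint (D i) (fun t => h t `^ q)%R <=
   (dual_weight_const C q)%:E * haarint (D i) (fun t => al t * h t `^ q)%R)%E.
  rewrite -!haarintZ ?(ltW ac0) ?(ltW (ra0 i))//; first last.
  - by move=> t /DP/ppos_gt0 t0; rewrite mulr_ge0 ?powR_ge0 ?al0.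
  - exact: lmeasM.
  - by move=> t _; exact: powR_ge0.
  apply: haarint_le => // t Dt; first by rewrite mulr_ge0 ?powR_ge0// ltW.
  rewrite mulrA ler_wpM2r ?powR_ge0//.
  by move: Dt; rewrite /D /= in_itv/= => Dt; have [] := dual_weight_bounds wB q1 alE (yp i) Dt.
have sub i : (i < n)%N -> D i `<=` oc y0 (y0 * 2 ^+ n).
  move=> i_n t; rewrite /D /= !in_itv/= => /andP[yt ty]; apply/andP; split.
    by apply: le_lt_trans yt; rewrite /y ler_peMr ?pow2_ge1// ltW.
  apply: (le_trans ty); rewrite -yS /y ler_pM2l// ler_eXn2l// ltr1n//.
have sumT : (\sum_(i < n) haarint (D i) (fun t => al t * h t `^ q)%R <= T%:E)%E.
  rewrite -(@haarint_dyadic_sum R y0 n)//; last 2 first.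
  - exact: lmeasM.
  - by move=> t t0; rewrite mulr_ge0 ?powR_ge0 ?al0.
  apply: le_trans hT; apply: haarint_subset => // [|t /ppos_gt0 t0].
    by apply: itv_ppos; rewrite bnd_simp ltW.
  by rewrite mulr_ge0 ?powR_ge0 ?al0.
have alge i : (0 <= haarint (D i) (fun t => al t * h t `^ q)%R)%E.
  by apply: haarint_ge0 => // t /DP/ppos_gt0 t0; rewrite mulr_ge0 ?powR_ge0 ?al0.
have alfin i : (i < n)%N -> (haarint (D i) (fun t => al t * h t `^ q)%R < +oo)%E.
  move=> i_n; apply: le_lt_trans (ltry T); apply: le_trans hT.
  apply: haarint_subset => // t /ppos_gt0 t0; by rewrite mulr_ge0 ?powR_ge0 ?al0.
have sfin i : (i < n)%N -> (haarint (D i) (fun t => h t `^ q)%R < +oo)%E.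
  move=> i_n; have := le_lt_trans (sle i) (lte_mul_pinfty (ltW (ac0 : (0 < (dual_weight_const C q)%:E)%E)) isT (alfin i i_n)).
  case: (haarint (D i) (fun t => h t `^ q)) => [r _| |]//; first by rewrite ltry.
  by rewrite gt0_muley ?lte_fin.
pose hb i := if (i < n)%N then fine (haarint (D i) h) else 0.
have hbE i : (i < n)%N -> haarint (D i) h = (hb i)%:E.
  move=> i_n; have [f _] := haarint_block_powR q1 (yp i) mh h0 (sfin i i_n).
  by rewrite /hb i_n fineK.
have hb0 i : 0 <= hb i.
  rewrite /hb; case: ifP => // _; apply: fine_ge0; apply: haarint_ge0 => // t /DP/ppos_gt0; exact: h0.
have base : \sum_(i < n) w (y i) * (W (y i) * hb i / w (y i)) `^ q <= 2 `^ q * dual_weight_const C q * T.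
  rewrite -lee_fin -sumEFin EFinM.
  apply: (@le_trans _ _ (\sum_(i < n) (2 `^ q * dual_weight_const C q)%:E * haarint (D i) (fun t => al t * h t `^ q)%R)%E); last first.
    rewrite -ge0_sume_distrr; last by move=> i _; exact: alge.
    by apply: lee_wpmul2l => //; rewrite lee_fin mulr_ge0 ?powR_ge0// ltW.
  apply: lee_sum => i _; have i_n := ltn_ord i.
  have [_ f2] := haarint_block_powR q1 (yp i) mh h0 (sfin i i_n).
  have sge : (0 <= haarint (D i) (fun t => h t `^ q)%R)%E by apply: haarint_ge0 => // t _; exact: powR_ge0.
  have sE : haarint (D i) (fun t => h t `^ q)%R = (fine (haarint (D i) (fun t => h t `^ q)))%:E.
    by rewrite fineK// ge0_fin_numE// sfin.
  apply: (@le_trans _ _ ((2 `^ q)%:E * ((ra i)%:E * haarint (D i) (fun t => h t `^ q)%R)))%E; last first.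
    by rewrite [(2 `^ q * _)%:E]EFinM -muleA lee_wpmul2l// lee_fin powR_ge0.
  rewrite sE -!EFinM lee_fin.
  have -> : W (y i) * hb i / w (y i) = W (y i) / w (y i) * hb i by rewrite mulrAC.
  rewrite powRM ?divr_ge0 ?(ltW (Wp i)) ?(ltW (wp i))// mulrA -/(ra i) mulrCA.
  rewrite ler_pM2l ?ra0// /hb i_n; exact: f2.
have T0 : 0 <= T.
  rewrite -lee_fin; apply: le_trans hT; apply: haarint_ge0 => // t /ppos_gt0 t0.
  by rewrite mulr_ge0 ?powR_ge0 ?al0.
have hardy0 : 0 < hardy_const q by exact: hardy_const_gt0.
have E1 : \sum_(i < n) w (y i) * (\sum_(j < i.+1) hb j) `^ q <=
    hardy_const q * (2 `^ q * dual_weight_const C q * T).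
  apply: (le_trans (discrete_hardy q1 n wp hb0)); rewrite ler_pM2l//.
  apply: le_trans base; apply: ler_sum => i _; rewrite ler_pM2l//.
  apply: powR_le => //.
    by rewrite divr_ge0 ?(ltW (wp i))// mulr_ge0// sumr_ge0// => k _; exact: ltW.
  rewrite ler_pM2r ?invr_gt0// ler_wpM2r//.
  rewrite (tail_mass_sum wB (n - i) (yp i)).
  rewrite -{1}(add0n (i : nat)) big_addn big_mkord.
  rewrite (eq_bigr (fun k : 'I_(n - i) => w (y i * 2 ^+ k))); last first.
    by move=> k _; rewrite /y -mulrA -exprD addnC.
  by rewrite lerDl ltW// (tail_mass_gt0 wB)// mulr_gt0// exprn_gt0.
(* In the tail sums, the factor [y i] goes into the weight. *)
pose wt i := w (y i) * y i `^ q.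
have wt0 i : 0 < wt i by rewrite /wt mulr_gt0// powR_gt0.
pose ht i := hb i / y i.
have ht0 i : 0 <= ht i by rewrite /ht divr_ge0// ltW.
have E2 : \sum_(i < n) w (y i) * (y i * \sum_(i <= k < n) ht k) `^ q <=
    hardy_const q * head_const `^ q * (2 `^ q * dual_weight_const C q * T).
  rewrite (eq_bigr (fun i : 'I_n => wt i * (\sum_(i <= k < n) ht k) `^ q)); last first.
    by move=> i _; rewrite powRM ?(ltW (yp i))// ?sumr_ge0// /wt mulrA.
  apply: (le_trans (discrete_hardy_dual q1 n wt0 ht0)); rewrite -mulrA ler_pM2l//.
  apply: (@le_trans _ _ (head_const `^ q * \sum_(i < n) w (y i) * (W (y i) * hb i / w (y i)) `^ q)); last first.
    by rewrite ler_pM2l ?powR_gt0 ?head_const_gt0.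
  rewrite mulr_sumr; apply: ler_sum => i _.
  have yi0 := yp i; have wi0 := wp i; have wti := wt0 i; have hc0 := head_const_gt0.
  apply: (@le_trans _ _ (wt i * (head_const * ht i) `^ q)).
    rewrite ler_pM2l//; apply: powR_le => //.
      by rewrite divr_ge0 ?(ltW wti)// mulr_ge0// sumr_ge0// => k _; exact: ltW.
    rewrite ler_pdivrMr// mulrAC ler_wpM2r//; exact: head_mass_le.
  rewrite powRM ?(ltW hc0)// mulrCA ler_pM2l ?powR_gt0//.
  have -> : wt i * ht i `^ q = w (y i) * hb i `^ q.
    rewrite /wt /ht -mulrA -powRM ?(ltW yi0) ?divr_ge0// ?(ltW yi0)//.
    by congr (_ * _ `^ _); rewrite mulrC divfK// gt_eqF.
  rewrite ler_pM2l//; apply: powR_le => //.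
  by rewrite mulrAC ler_peMl// ler_pdivlMr// mul1r (block_le_tail wB).
pose P i := \sum_(j < i.+1) hb j; pose Q i := y i * \sum_(i <= k < n) ht k.
have P0 i : 0 <= P i by rewrite sumr_ge0.
have Q0 i : 0 <= Q i by rewrite /Q mulr_ge0 ?sumr_ge0// ltW.
exists (fun i => P i + Q i); split => [i|i i_n|]; first exact: addr_ge0.
- have kn (s : R) : 0 < s -> 0 <= kmin (y i) s by exact: kmin_ge0.
  have mk : lmeas (kmin (y i)) by exact: lmeas_kmin.
  rewrite (@haarint_dyadic_sum R y0 n)//; last 2 first.
  - exact: lmeasM.
  - by move=> t t0; rewrite mulr_ge0 ?kn ?h0.
  apply: (@le_trans _ _ (\sum_(k < n) ((if (k <= i)%N then hb k else 0) + (if (i <= k)%N then y i * ht k else 0))%:E)%E).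
    apply: lee_sum => k _; have k_n := ltn_ord k.
    have Dk : haarint (oc (y0 * 2 ^+ k) (y0 * 2 ^+ k * 2)) (fun s => kmin (y i) s * h s) =
       haarint (D k) (fun s => kmin (y i) s * h s) by [].
    rewrite Dk; have [ki|ik] := leqP k i.
      apply: (@le_trans _ _ (haarint (D k) h)).
        apply: haarint_le => // t /DP/ppos_gt0 t0; first by rewrite mulr_ge0 ?kn ?h0.
        by rewrite ler_piMl ?h0// /kmin ge_min lexx.
      rewrite hbE// lee_fin lerDl; case: ifP => // _.
      by rewrite mulr_ge0 ?ht0// ltW.
    rewrite add0r (ltnW ik).
    apply: (@le_trans _ _ (haarint (D k) (fun s => y i / y k * h s)%R)).
      apply: haarint_le => // t Dt; have t0 : 0 < t by apply/ppos_gt0/(DP k).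
        by rewrite mulr_ge0 ?kn ?h0.
      rewrite ler_wpM2r ?h0// /kmin ge_min; apply/orP; right.
      rewrite ler_pM2l// lef_pV2 ?posrE//; move: Dt; rewrite /D /= in_itv/= => /andP[/ltW].
      by [].
    rewrite haarintZ//; first by rewrite hbE// -EFinM lee_fin /ht mulrA mulrAC -mulrA.
    - by move=> t /DP/ppos_gt0; exact: h0.
    - by rewrite divr_ge0 ?ltW.
  rewrite sumEFin lee_fin big_split/= -!big_mkcond/= /P /Q big_geq_mkord/= mulr_sumr lerD2r.
  rewrite (eq_bigl (fun k : 'I_n => (k < i.+1)%N)); last by move=> k; rewrite ltnS.
  by rewrite (big_ord_narrow i_n).
- apply: (@le_trans _ _ (\sum_(i < n) 2 `^ q * (w (y i) * P i `^ q + w (y i) * Q i `^ q))).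
    apply: ler_sum => i _.
    have PQ := ler_wpM2l (ltW (wp i)) (powRD_le q1 (P0 i) (Q0 i)).
    by apply: (le_trans PQ); rewrite mulrCA mulrDr.
  rewrite -mulr_sumr big_split/= /hardyK_const -mulrA ler_pM2l ?powR_gt0//.
  apply: (le_trans (lerD E1 E2)).
  by rewrite le_eqVlt; apply/orP; left; apply/eqP; ring.
Qed.

(** Because of the doubling condition only the values of [k] at powers of two
    matter.  On a finite range of them [hardy_kernel] applies once the integral
    over the half-line is replaced by an integral over a bounded range. *)
Lemma hardy_majorant (k h : R -> R) (T : R) : lmeas h ->
  (forall t, 0 < t -> 0 <= h t) ->
  (forall t, 0 < t -> 0 <= k t) -> nondecreasing_on ppos k ->
  (forall y, 0 < y -> k (y * 2) <= 2 * k y) ->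
  (forall y, 0 < y -> ((k y)%:E <= haarint ppos (fun s => kmin y s * h s)%R)%E) ->
  (haarint ppos (fun t => al t * h t `^ q)%R <= T%:E)%E ->
  (haarint (ray 1) (fun t => B t * k t `^ q)%R <= (2 `^ q * (2 `^ q * (hardyK_const * T)))%:E)%E.
Proof.
move=> mh h0 k0 knd k2 kh hT.
have p2 n : 0 < (2 : R) ^+ n by rewrite exprn_gt0.
have mk : lmeas k by apply: nondecreasing_leb_measurable.
have mBk : lmeas (fun t => B t * k t `^ q) by apply: lmeasM; [exact: hw_meas wB|exact: lmeas_powR].
have Bk0 t : 0 < t -> 0 <= B t * k t `^ q.
  by move=> t0; rewrite mulr_ge0 ?powR_ge0// ltW// (hw_gt0 wB).
apply: (haarint_ray1_le mBk Bk0).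
move=> M; have := @haarint_dyadic_sum R 1 M _ ltr01 mBk Bk0; rewrite mul1r => ->.
apply: (@le_trans _ _ (\sum_(j < M) (2 `^ q * (w (2 ^+ j) * k (2 ^+ j) `^ q))%:E)%E).
  apply: lee_sum => j _; rewrite mul1r.
  have jp := p2 j; set y := 2 ^+ j in jp *.
  have [wE _ _] := block_mass_bounds wB jp.
  have ky0 := k0 _ jp.
  apply: (@le_trans _ _ (haarint (oc y (y * 2)) (fun t => (2 `^ q * k y `^ q) * B t)%R)).
    have DP := @dyadic_ppos R y jp.
    apply: haarint_le => // t Dt; have t0 : 0 < t by apply/ppos_gt0/DP.
      exact: Bk0.
    rewrite mulrC ler_wpM2r ?(ltW (hw_gt0 wB t0))// -powRM//.
    apply: powR_le => //; first exact: k0.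
    apply: le_trans (k2 _ jp); apply: knd; [exact/ppos_gt0|apply/ppos_gt0; exact: mulr_gt0|].
    by move: Dt; rewrite /= in_itv/= => /andP[].
  rewrite haarintZ ?mulr_ge0 ?powR_ge0//; first by rewrite wE -EFinM lee_fin (mulrC (w y)) mulrA.
  - exact: leb_measurable_itv.
  - exact: dyadic_ppos.
  - exact: hw_meas wB.
  - by move=> t /(@dyadic_ppos R y jp)/ppos_gt0 t0; rewrite ltW// (hw_gt0 wB).
rewrite sumEFin lee_fin -mulr_sumr ler_pM2l ?powR_gt0//.
(* By monotone convergence, the integral over [E N] exceeds half of [k (2 ^ j)]
   for large [N]; giving up a factor 2 allows one [N] to serve all [j < M]. *)
have kmh0 (y : R) : 0 < y -> forall t, ppos t -> 0 <= kmin y t * h t.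
  by move=> y0 t /ppos_gt0 t0; rewrite mulr_ge0 ?h0 ?kmin_ge0.
pose E (N : nat) := oc ((2 ^+ N)^-1 : R) (2 ^+ N).
have EP N : E N `<=` (ppos : set R).
  by apply: itv_ppos; rewrite bnd_simp invr_ge0 ltW.
have Emono N N' : (N <= N')%N -> E N `<=` E N'.
  move=> NN t; rewrite /E /= !in_itv/= => /andP[t1 t2].
  have N2 : (2 : R) ^+ N <= 2 ^+ N' by rewrite ler_eXn2l ?ltr1n.
  by rewrite (le_trans t2 N2) (le_lt_trans _ t1)// lef_pV2 ?posrE ?p2.
have /choice[N1 HN1] : forall j : nat, exists N, forall N', (N <= N')%N ->
    ((k (2 ^+ j) / 2)%:E <= haarint (E N') (fun s => kmin (2 ^+ j) s * h s)%R)%E.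
  move=> j; have jp := p2 j; have [kz|kn] := eqVneq (k (2 ^+ j)) 0.
    by exists 0 => N' _; rewrite kz mul0r; apply: haarint_ge0 => // t /EP; exact: kmh0.
  have kp : 0 < k (2 ^+ j) by rewrite lt_def kn k0.
  apply: contrapT => /forallNP H.
  have {}H N : (haarint (E N) (fun s => kmin (2 ^+ j) s * h s)%R <= (k (2 ^+ j) / 2)%:E)%E.
    rewrite leNgt; apply/negP => lt; apply: (H N) => N' NN'.
    apply: (le_trans (ltW lt)); apply: haarint_subset; [exact: Emono|exact: EP|].
    by move=> t /EP; exact: kmh0.
  have : (haarint (\bigcup_N E N) (fun s => kmin (2 ^+ j) s * h s)%R <= (k (2 ^+ j) / 2)%:E)%E.
    apply: haarint_bigcup_le => //.
    - by move=> m n mn; apply/subsetPset; exact: Emono.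
    - by move=> n; exact: leb_measurable_itv.
    - by apply: lmeasM => //; exact: lmeas_kmin.
    - by move=> t /ppos_gt0; exact: kmh0.
  have -> : \bigcup_N E N = ppos.
    apply/seteqP; split => t; first by move=> [N _ /EP].
    move=> /ppos_gt0 t0; have [n1 h1] := pow2_unbounded t; have [n2 h2] := pow2_unbounded (t^-1 + 1).
    exists (maxn n1 n2) => //; rewrite /E /= in_itv/=; apply/andP; split.
      rewrite invf_plt ?posrE//; apply: (@lt_le_trans _ _ (2 ^+ n2)); first lra.
      by rewrite ler_eXn2l ?ltr1n// leq_maxr.
    by apply: (le_trans h1); rewrite ler_eXn2l ?ltr1n// leq_maxl.
  move=> H2; have := le_trans (kh _ jp) H2; rewrite lee_fin; lra.
pose N := maxn M (\max_(j < M) N1 j).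
have MN : (M <= N)%N by rewrite leq_maxl.
have N1N (j : 'I_M) : (N1 j <= N)%N.
  by rewrite (leq_trans _ (leq_maxr _ _))// (leq_bigmax (F := fun j : 'I_M => N1 j)).
have y00 : 0 < ((2 : R) ^+ N)^-1 by rewrite invr_gt0.
have [G [G0 Gk GT]] := @hardy_kernel _ (N + N)%N h T y00 mh h0 hT.
have yE j : (2 ^+ N)^-1 * 2 ^+ (N + j) = (2 : R) ^+ j.
  by rewrite exprD mulKf// gt_eqF.
apply: (@le_trans _ _ (2 `^ q * \sum_(j < M) w (2 ^+ j) * G (N + j)%N `^ q)).
  rewrite mulr_sumr; apply: ler_sum => j _.
  rewrite mulrCA ler_pM2l; last exact: block_mass_gt0 wB _ _.
  rewrite -powRM//; apply: powR_le => //; first exact: k0.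
  rewrite mulrC -ler_pdivrMr// -lee_fin.
  apply: (le_trans (HN1 j N (N1N j))).
  have := Gk (N + j)%N; rewrite !yE; apply; rewrite ltn_add2l; exact: leq_trans (ltn_ord j) MN.
rewrite ler_pM2l ?powR_gt0//; apply: le_trans GT.
have pos i : 0 <= w ((2 ^+ N)^-1 * 2 ^+ i) * G i `^ q.
  by rewrite mulr_ge0 ?powR_ge0// ltW// (block_mass_gt0 wB)// mulr_gt0.
rewrite big_split_ord/= -[leLHS]add0r lerD//; first by apply: sumr_ge0 => i _; exact: pos.
rewrite (eq_bigr (fun j : 'I_N => w (2 ^+ j) * G (N + j)%N `^ q)); last by move=> j _; rewrite yE.
rewrite -(big_mkord xpredT (fun j => w (2 ^+ j) * G (N + j)%N `^ q)).
rewrite -(big_mkord xpredT (fun j => w (2 ^+ j) * G (N + j)%N `^ q)).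
rewrite [leRHS](big_cat_nat _ MN)//= lerDl; apply: sumr_ge0 => j _.
by have := pos (N + j)%N; rewrite yE.
Qed.

End HardyKernel.

(** * Levels of the tail mass *)
Section Levels.
Context {R : realType}.
Variables (B : R -> R) (C : R).
Hypothesis wB : half_weight C B.
Local Notation w := (block_mass B).
Local Notation W := (tail_mass B).
Local Notation kap := (tail_ratio C).

Let p2 n : 0 < (2 : R) ^+ n. Proof. by rewrite exprn_gt0. Qed.
Let W0 n : 0 < W (2 ^+ n). Proof. exact: tail_mass_gt0 wB _ _. Qed.

(** The least index at which the tail mass is halved.  At the preceding index it
    is not, and one step loses at most the factor [kap]. *)
Lemma next_level j : exists i, [/\ (j < i)%N, W (2 ^+ i) <= W (2 ^+ j) / 2 &
  W (2 ^+ j) <= 2 * kap * W (2 ^+ i)].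
Proof.
have ex : exists i, W (2 ^+ i) <= W (2 ^+ j) / 2.
  by apply: (tail_mass_small wB); rewrite divr_gt0.
case: (ex_minnP ex) => i Wi imin; exists i.
have ji : (j < i)%N.
  rewrite ltnNge; apply/negP => ij.
  have : W (2 ^+ j) <= W (2 ^+ i).
    by apply: (tail_mass_ni wB) => //; rewrite ler_eXn2l ?ltr1n.
  by have := W0 j; lra.
split => //; have i0 : (0 < i)%N := leq_ltn_trans (leq0n j) ji.
have h : W (2 ^+ j) / 2 < W (2 ^+ i.-1).
  by rewrite ltNge; apply/negP => /imin; rewrite -ltnS prednK// ltnn.
have := tail_mass_double wB (p2 i.-1); rewrite -exprSr prednK// => h2.
by have := lt_le_trans h h2; lra.
Qed.

Definition level_mass (n : nat -> nat) k := W (2 ^+ n k) - W (2 ^+ n k.+1).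

(** Tails of [B] may be much larger than single blocks, as [B] may decrease very
    slowly.  Grouping blocks into levels along which the tail is halved makes
    the mass of a level comparable both to the tail where it starts and to the
    mass of the next level. *)
Lemma levels_exist : exists n : nat -> nat,
  [/\ n 0%N = 0%N, forall k, (n k < n k.+1)%N,
      forall k, W (2 ^+ n k) <= 2 * level_mass n k &
      forall k, level_mass n k <= 4 * kap * level_mass n k.+1].
Proof.
have [nx nxP] := choice next_level.
pose n k := iter k nx 0%N; exists n.
have h k : W (2 ^+ n k) <= 2 * level_mass n k.
  by have [_ ? _] := nxP (n k); rewrite /level_mass /n iterS; lra.
split => // k; first by have [] := nxP (n k).
have [_ _ h2] := nxP (n k); have h3 := h k.+1.
apply: (@le_trans _ _ (W (2 ^+ n k))); first by rewrite /level_mass gerBl ltW.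
apply: (le_trans h2); have -> : 4 * kap = 2 * kap * 2 by ring.
rewrite -[leRHS]mulrA; apply: ler_wpM2l h3.
by rewrite mulr_ge0// (le_trans ler01)// (tail_ratio_ge1 wB).
Qed.

Variable n : nat -> nat.
Hypothesis n0 : n 0%N = 0%N.
Hypothesis nS : forall k, (n k < n k.+1)%N.

Lemma level_mono k l : (k <= l)%N -> (n k <= n l)%N.
Proof. by move=> /(homo_leq leqnn leq_trans (fun i => ltnW (nS i))). Qed.

Lemma level_ge k : (k <= n k)%N.
Proof. by elim: k => // k IH; exact: leq_ltn_trans IH (nS k). Qed.

Lemma level_mass_gt0 k : 0 < level_mass n k.
Proof.
rewrite /level_mass subr_gt0.
apply: (@le_lt_trans _ _ (W (2 ^+ (n k).+1))).
  by apply: (tail_mass_ni wB) => //; rewrite ler_eXn2l ?ltr1n.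
rewrite exprSr [ltRHS](tail_mass_step wB)// ltrDr; exact: block_mass_gt0 wB _ _.
Qed.

Lemma level_mass_sum k : \sum_(n k <= j < n k.+1) w (2 ^+ j) = level_mass n k.
Proof.
rewrite /level_mass (tail_mass_sum wB (n k.+1 - n k) (p2 (n k))).
rewrite -exprD subnKC ?(ltnW (nS k))// addrK.
rewrite -{1}(add0n (n k)) big_addn big_mkord.
by apply: eq_bigr => i _; rewrite exprD mulrC.
Qed.

Lemma level_of_exists j : exists k, (n k <= j < n k.+1)%N.
Proof.
have ex : exists k, (n k <= j)%N by exists 0%N; rewrite n0.
have ub k : (n k <= j)%N -> (k <= j)%N by exact: leq_trans (level_ge k).
case: (ex_maxnP ex ub) => k nk kmax; exists k; rewrite nk/= ltnNge.
by apply/negP => /kmax; rewrite ltnn.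
Qed.

Definition level_of j : nat := sval (cid (level_of_exists j)).

Lemma level_ofP j : (n (level_of j) <= j < n (level_of j).+1)%N.
Proof. by rewrite /level_of; case: cid. Qed.

Lemma level_of_eq k j : (n k <= j < n k.+1)%N -> level_of j = k.
Proof.
move=> /andP[kj jk]; have /andP[lj jl] := level_ofP j.
apply/eqP; rewrite eqn_leq -ltnS -(ltnS k); apply/andP; split.
  rewrite ltnNge; apply/negP => /level_mono h.
  by have := leq_trans (leq_trans jk h) lj; rewrite ltnn.
rewrite ltnNge; apply/negP => /level_mono h.
by have := leq_trans (leq_trans jl h) kj; rewrite ltnn.
Qed.

Lemma level_blocks (U : nmodType) (F : nat -> U) k l : (k <= l)%N ->
  (\sum_(n k <= j < n l) F j = \sum_(k <= i < l) \sum_(n i <= j < n i.+1) F j)%R.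
Proof.
move=> kl; rewrite -(subnKC kl); elim: (l - k)%N => [|m IH].
  by rewrite addn0 !big_geq.
rewrite addnS [RHS]big_nat_recr ?leq_addr//= -IH.
by rewrite (@big_cat_nat _ _ _ (n (k + m))) ?level_mono ?leq_addr// ltnW.
Qed.

End Levels.

(** * Normed subspaces and their Bochner integrals *)
Section Seminormed.
Context {R : realType} {V : lmodType R}.
Implicit Types (E F G : nspace V) (x y : V).
Local Open Scope ereal_scope.

(** Seminorms rather than norms: this property passes to sums, where the
    infimum over decompositions is not obviously definite. *)
Record seminormed E : Prop := Seminormed {
  sn_0 : ncarrier E 0%R ;
  sn_D : forall x y, ncarrier E x -> ncarrier E y -> ncarrier E (x + y)%R ;
  sn_Z : forall (a : R) x, ncarrier E x -> ncarrier E (a *: x)%R ;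
  sn_fin : forall x, ncarrier E x -> nnorm E x \is a fin_num ;
  sn_ge0 : forall x, 0 <= nnorm E x ;
  sn_tri : forall x y, ncarrier E x -> ncarrier E y ->
    nnorm E (x + y)%R <= nnorm E x + nnorm E y ;
  sn_hom : forall (a : R) x, ncarrier E x ->
    nnorm E (a *: x)%R <= `|a|%:E * nnorm E x }.

Lemma sn_norm0 E : seminormed E -> nnorm E 0%R = 0.
Proof.
move=> sE; apply/le_anti; rewrite sn_ge0// andbT.
by have := sn_hom sE 0%R (sn_0 sE); rewrite scale0r normr0 mul0e.
Qed.

Lemma sn_N E x : seminormed E -> ncarrier E x -> ncarrier E (- x)%R.
Proof. by move=> sE Ex; rewrite -scaleN1r; exact: sn_Z. Qed.

Lemma sn_B E x y : seminormed E -> ncarrier E x -> ncarrier E y -> ncarrier E (x - y)%R.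
Proof. by move=> sE Ex Ey; apply: sn_D => //; exact: sn_N. Qed.

Lemma sn_normN E x : seminormed E -> ncarrier E x -> nnorm E (- x)%R <= nnorm E x.
Proof.
move=> sE Ex; have := sn_hom sE (-1)%R Ex.
by rewrite scaleN1r normrN1 mul1e.
Qed.

Lemma sn_triB E x y : seminormed E -> ncarrier E x -> ncarrier E y ->
  nnorm E (x - y)%R <= nnorm E x + nnorm E y.
Proof.
move=> sE Ex Ey; apply: (le_trans (sn_tri sE Ex (sn_N sE Ey))).
by rewrite leeD2l// sn_normN.
Qed.

Lemma sn_sum E (I : Type) (r : seq I) (f : I -> V) : seminormed E ->
  (forall i, ncarrier E (f i)) ->
  ncarrier E (\sum_(i <- r) f i)%R /\
  nnorm E (\sum_(i <- r) f i)%R <= \sum_(i <- r) nnorm E (f i).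
Proof.
move=> sE Ef; elim: r => [|i r [IH1 IH2]].
  by rewrite !big_nil sn_norm0//; split => //; exact: sn_0.
rewrite !big_cons; split; first exact: sn_D.
by apply: (le_trans (sn_tri sE (Ef i) IH1)); rewrite leeD2l.
Qed.

Lemma embedded_norm (X : normedModType R) (i : {linear X -> V}) (x : X) :
  injective i -> nnorm (embedded i) (i x) = `|x|%R%:E.
Proof.
move=> inj; rewrite /embedded /=.
have -> : [set x0 | i x0 = i x] = [set x] by apply/seteqP; split => y /= => [/inj|->].
by rewrite image_set1 ereal_inf1.
Qed.

Lemma seminormed_embedded (X : normedModType R) (i : {linear X -> V}) :
  injective i -> seminormed (embedded i).
Proof.
move=> inj; split.
- by exists 0%R => //; rewrite linear0.
- by move=> _ _ [x _ <-] [y _ <-]; exists (x + y)%R => //; rewrite linearD.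
- by move=> a _ [x _ <-]; exists (a *: x)%R => //; rewrite linearZ.
- by move=> _ [x _ <-]; rewrite embedded_norm.
- by move=> x; apply: le_ereal_inf_tmp => _ [y _ <-]; rewrite lee_fin.
- by move=> _ _ [x _ <-] [y _ <-]; rewrite -linearD !embedded_norm// -EFinD lee_fin ler_normD.
- by move=> a _ [x _ <-]; rewrite -linearZ !embedded_norm// -EFinM lee_fin normrZ.
Qed.

(** With [F] rescaled by [t], the K-functional at [t] is by definition the norm
    of a sum ([KfunE]), and inherits its properties from [seminormed_sum]. *)
Definition scale_space (t : R) F : nspace V := NSpace (ncarrier F) (fun x => t%:E * nnorm F x).

Lemma seminormed_scale (t : R) F : (0 <= t)%R -> seminormed F -> seminormed (scale_space t F).
Proof.
move=> t0 sF; split => /=; do ?[exact: sn_0|exact: sn_D|exact: sn_Z].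
- by move=> x Fx; rewrite fin_numM// sn_fin.
- by move=> x; rewrite mule_ge0 ?sn_ge0.
- move=> x y Fx Fy; rewrite -ge0_muleDr ?sn_ge0//; apply: lee_wpmul2l => //; exact: sn_tri.
- move=> a x Fx; rewrite muleCA; apply: lee_wpmul2l => //; exact: sn_hom.
Qed.

Lemma KfunE E F x t : Kfun E F x t = nnorm (sum_space E (scale_space t F)) x.
Proof. by []. Qed.

Lemma sum_space_le E F x y0 y1 : decompositions E F x (y0, y1) ->
  nnorm (sum_space E F) x <= nnorm E y0 + nnorm F y1.
Proof. by move=> d; apply: ereal_inf_lbound; exists (y0, y1). Qed.

Lemma sum_space_lt E F x (e : R) : seminormed E -> seminormed F ->
  ncarrier (sum_space E F) x -> (0 < e)%R ->
  exists y0 y1, decompositions E F x (y0, y1) /\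
    nnorm E y0 + nnorm F y1 <= nnorm (sum_space E F) x + e%:E.
Proof.
move=> sE sF [[z0 z1] dz] e0.
have ge : 0 <= nnorm (sum_space E F) x.
  by apply: le_ereal_inf_tmp => _ [p _ <-]; rewrite adde_ge0 ?sn_ge0.
have fin : nnorm (sum_space E F) x \is a fin_num.
  rewrite ge0_fin_numE//; apply: (le_lt_trans (sum_space_le dz)).
  by case: dz => /= h1 h2 _; rewrite lte_add_pinfty// ltey_eq sn_fin.
have [_ [[y0 y1] dy <-] h] := lb_ereal_inf_adherent e0 fin.
by exists y0, y1; split => //; exact: ltW.
Qed.

Lemma seminormed_sum E F : seminormed E -> seminormed F -> seminormed (sum_space E F).
Proof.
move=> sE sF; split.
- by exists (0, 0)%R; split => /=; rewrite ?addr0//; exact: sn_0.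
- move=> x y [[x0 x1] [/= h1 h2 ->]] [[y0 y1] [/= h3 h4 ->]].
  by exists (x0 + y0, x1 + y1)%R; split => /=; [exact: sn_D|exact: sn_D|rewrite addrACA].
- move=> a x [[x0 x1] [/= h1 h2 ->]].
  by exists (a *: x0, a *: x1)%R; split => /=; [exact: sn_Z|exact: sn_Z|rewrite scalerDr].
- move=> x [[z0 z1] dz]; rewrite ge0_fin_numE; last first.
    by apply: le_ereal_inf_tmp => _ [p _ <-]; rewrite adde_ge0 ?sn_ge0.
  apply: (le_lt_trans (sum_space_le dz)).
  by case: dz => /= h1 h2 _; rewrite lte_add_pinfty// ltey_eq sn_fin.
- by move=> x; apply: le_ereal_inf_tmp => _ [p _ <-]; rewrite adde_ge0 ?sn_ge0.
- move=> x y hx hy; apply/lee_addgt0Pr => e e0.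
  have e20 : (0 < e / 2)%R by rewrite divr_gt0.
  have [x0 [x1 [[/= h1 h2 hxE] hxn]]] := sum_space_lt sE sF hx e20.
  have [y0 [y1 [[/= h3 h4 hyE] hyn]]] := sum_space_lt sE sF hy e20.
  have d : decompositions E F (x + y)%R (x0 + y0, x1 + y1)%R.
    by split => /=; [exact: sn_D|exact: sn_D|rewrite hxE hyE addrACA].
  apply: (le_trans (sum_space_le d)).
  apply: (le_trans (leeD (sn_tri sE h1 h3) (sn_tri sF h2 h4))).
  rewrite addeACA; apply: (le_trans (leeD hxn hyn)).
  by rewrite addeACA -EFinD -splitr.
- move=> a x hx; have [->|a0] := eqVneq a 0%R.
    rewrite scale0r normr0 mul0e.
    have d : decompositions E F 0%R (0, 0)%R by split => /=; rewrite ?addr0//; exact: sn_0.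
    by apply: (le_trans (sum_space_le d)); rewrite !sn_norm0// adde0.
  have na : (0 < `|a|)%R by rewrite normr_gt0.
  apply/lee_addgt0Pr => e e0.
  have [x0 [x1 [[/= h1 h2 hxE] hxn]]] := sum_space_lt sE sF hx (divr_gt0 e0 na).
  have d : decompositions E F (a *: x)%R (a *: x0, a *: x1)%R.
    by split => /=; [exact: sn_Z|exact: sn_Z|rewrite hxE scalerDr].
  apply: (le_trans (sum_space_le d)).
  apply: (le_trans (leeD (sn_hom sE a h1) (sn_hom sF a h2))).
  rewrite -ge0_muleDr ?sn_ge0//; apply: (le_trans (lee_wpmul2l _ hxn)); first by rewrite lee_fin.
  rewrite muleDr//; first by rewrite -EFinM mulrC divfK// gt_eqF.
  by rewrite fin_num_adde_defl.
Qed.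

Definition rnorm E x : R := fine (nnorm E x).

Lemma rnormE E x : seminormed E -> ncarrier E x -> nnorm E x = (rnorm E x)%:E.
Proof. by move=> sE Ex; rewrite /rnorm fineK// sn_fin. Qed.

Lemma rnorm_ge0 E x : seminormed E -> (0 <= rnorm E x)%R.
Proof. by move=> sE; apply: fine_ge0; exact: sn_ge0. Qed.

Lemma seminormed_inter E F : seminormed E -> seminormed F -> seminormed (inter_space E F).
Proof.
move=> sE sF; split => /=.
- by split; exact: sn_0.
- by move=> y z [? ?] [? ?]; split; exact: sn_D.
- by move=> z y [? ?]; split; exact: sn_Z.
- by move=> y [Ey Fy]; rewrite !rnormE// -EFin_max.
- by move=> y; rewrite le_max sn_ge0.
- move=> y z [Ey Fy] [Ez Fz]; rewrite ge_max; apply/andP; split.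
    by apply: (le_trans (sn_tri sE Ey Ez)); apply: leeD; rewrite le_max lexx.
  by apply: (le_trans (sn_tri sF Fy Fz)); apply: leeD; rewrite le_max lexx orbT.
- move=> z y [Ey Fy]; rewrite ge_max; apply/andP; split.
    apply: (le_trans (sn_hom sE z Ey)); apply: lee_wpmul2l => //; rewrite ?lee_fin//.
    by rewrite le_max lexx.
  apply: (le_trans (sn_hom sF z Fy)); apply: lee_wpmul2l => //; rewrite ?lee_fin//.
  by rewrite le_max lexx orbT.
Qed.

Lemma simple_comp_measurable E (s : R -> V) (phi : V -> R) : simple_fun E s ->
  lmeas (fun t => phi (s t)).
Proof.
move=> [fs _ ms] _ Y mY.
rewrite [X in measurable X](_ : _ =
    \bigcup_(v in s @` ppos `&` (phi @^-1` Y)) (ppos `&` s @^-1` [set v])).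
  apply: fin_bigcup_measurable => [|v _]; last exact: ms.
  by apply: sub_finite_set fs; exact: subIsetl.
apply/seteqP; split => t /=.
  by move=> [Pt Yt]; exists (s t) => //; split => //; exists t.
by move=> [v [[t' _ <-] Yv] [Pt /= ->]].
Qed.

Lemma simple_integral_norm_le E G (s : R -> V) : seminormed E ->
  seminormed G -> ncarrier E `<=` ncarrier G -> simple_fun E s ->
  ncarrier G (simple_integral s) /\
  nnorm G (simple_integral s) <= haarint ppos (fun t => rnorm G (s t)).
Proof.
move=> sE sG EG ss; have [fs Es ms] := ss.
pose A := s @` ppos; pose l : seq V := finmap.enum_fset (fset_set A).
pose c v : R := fine (haar (s @^-1` [set v])).
have hge v : 0 <= haar (s @^-1` [set v]).
  by apply: integral_ge0 => t [/ppos_gt0 t0 _]; rewrite lee_fin invr_ge0 ltW.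
have c0 v : (0 <= c v)%R by apply: fine_ge0.
pose f v := if v \in A then (c v *: v)%R else 0%R.
have SE : simple_integral s = (\sum_(v <- l) f v)%R.
  rewrite /simple_integral fsbig_finite//=; apply: eq_big_seq => v.
  by rewrite in_fset_set// /f => ->.
have Gf v : ncarrier G (f v).
  rewrite /f; case: ifP => [/set_mem [t Pt <-]|_]; last exact: sn_0.
  by apply: sn_Z => //; apply: EG; exact: Es.
have [h1 h2] := sn_sum l sG Gf; rewrite SE; split => //; apply: (le_trans h2).
pose Fv v : set R := ppos `&` s @^-1` [set v].
pose D := \big[setU/set0]_(v <- l) Fv v.
have DP : D `<=` ppos.
  rewrite /D; elim: l {SE h1 h2 D} => [|v r IH]; first by rewrite big_nil.
  by rewrite big_cons => t [[]//|/IH].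
have ml := simple_comp_measurable (rnorm G) ss.
have rg0 v : (0 <= rnorm G v)%R by exact: rnorm_ge0.
apply: (@le_trans _ _ (haarint D (fun t => rnorm G (s t)))); last exact: haarint_subset.
have ge0 t : D t -> 0 <= ((t^-1 * rnorm G (s t))%R)%:E.
  by move=> /DP/ppos_gt0 t0; rewrite lee_fin mulr_ge0// invr_ge0 ltW.
have mFv v : measurable (Fv v : set (lebType R)) by exact: ms.
have mD : measurable_fun (D : set (lebType R)) (fun t : lebType R => ((t^-1 * rnorm G (s t))%R)%:E).
  by apply: measurable_funS (lmeas_invM ml) => //; exact: measurable_ppos.
have tr : trivIset [set` l] Fv.
  by move=> v v' _ _ [t [[_ /= <-] [_ /= <-]]].
rewrite /haarint /D (@ge0_integral_bigsetU _ _ _ (leb R) V Fv _ l mFv (finmap.fset_uniq _) tr mD ge0).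
apply: lee_sum => v _.
rewrite /f; case: ifP => [/set_mem [t0 Pt0 vE]|_]; last first.
  rewrite sn_norm0//; apply: integral_ge0 => t [/ppos_gt0 tp _].
  by rewrite lee_fin mulr_ge0// invr_ge0 ltW.
have Gv : ncarrier G v by rewrite -vE; apply: EG; exact: Es.
apply: (le_trans (sn_hom sG (c v) Gv)); rewrite ger0_norm// (rnormE sG Gv).
have -> : \int[leb R]_(t in Fv v) ((t^-1 * rnorm G (s t))%R)%:E =
    haarint (Fv v) (fun t => rnorm G v * 1)%R.
  by apply: eq_integral => t /set_mem [_ /= ->]; rewrite mulr1.
have FP : Fv v `<=` ppos by move=> t [].
rewrite haarintZ//; last exact: measurable_cst.
rewrite muleC; apply: lee_wpmul2l; first by rewrite lee_fin.
have -> : haarint (Fv v) (fun=> 1%R) = haar (s @^-1` [set v]).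
  by apply: eq_integral => t _; rewrite mulr1.
(* A level set of infinite measure has coefficient 0 in [simple_integral]. *)
by rewrite /c; have := hge v; case: (haar _) => //= r; rewrite leey.
Qed.

Lemma cvge0_le (u : nat -> \bar R) (e : R) : u n @[n --> \oo] --> 0 -> (0 < e)%R ->
  exists N, forall n, (N <= n)%N -> u n <= e%:E.
Proof.
move=> u0 e0; have : nbhs (0 : \bar R) [set x | x < e%:E].
  by apply: open_ereal_lt'; rewrite lte_fin.
by move=> /u0 [N _ H]; exists N => n Nn; apply/ltW/H.
Qed.

(** The integral of [u] is only given by simple functions [s n], whose norms may
    exceed the majorant [g] of the norm of [u].  The excess is at most the norm
    of [u - s n], hence has a small integral. *)
Lemma bochner_norm_le E G (u : R -> V) (f : V) (g : R -> R) (c : R) :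
  seminormed E -> seminormed G -> ncarrier E `<=` ncarrier G ->
  (0 < c)%R -> (forall x, ncarrier E x -> nnorm G x <= c%:E * nnorm E x) ->
  is_bochner_integral E u f -> lmeas g -> (forall t, (0 < t)%R -> (0 <= g t)%R) ->
  (forall t, (0 < t)%R -> nnorm G (u t) <= (g t)%:E) ->
  nnorm G f <= haarint ppos g.
Proof.
move=> sE sG EG c0 GE [[Eu _] Ef [s [ss sint su sf]]] mg g0 ug.
apply/lee_addgt0Pr => e e0.
have e20 : (0 < e / (2 * c))%R by rewrite divr_gt0// mulr_gt0.
have [N1 H1] := cvge0_le su e20; have [N2 H2] := cvge0_le sf e20.
pose n := maxn N1 N2; have {}H1 := H1 n (leq_maxl _ _); have {}H2 := H2 n (leq_maxr _ _).
have [GS hS] := simple_integral_norm_le sE sG EG (ss n).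
have [ES _] := simple_integral_norm_le sE sE (@subset_refl _ _) (ss n).
have [fs Es ms] := ss n.
pose r t := rnorm G (s n t).
have mr : lmeas r by exact: simple_comp_measurable (ss n).
have r0 t : (0 <= r t)%R by exact: rnorm_ge0.
pose e' t := (c^-1 * Num.max 0 (r t - g t))%R.
have e'0 t : (0 <= e' t)%R by rewrite /e' mulr_ge0 ?invr_ge0 ?(ltW c0)// le_max lexx.
have me' : lmeas e'.
  apply: measurable_funM; first exact: measurable_cst.
  apply: measurable_maxr; first exact: measurable_cst.
  exact: measurable_funB.
have e'le t : (0 < t)%R -> (e' t)%:E <= nnorm E (u t - s n t)%R.
  move=> t0; have Pt : ppos t by apply/ppos_gt0.
  have Eust := sn_B sE (Eu t Pt) (Es t Pt).
  rewrite (rnormE sE Eust) lee_fin /e' ler_pdivrMl// ge_max mulr_ge0 ?(ltW c0) ?rnorm_ge0//=.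
  rewrite lerBlDl -lee_fin EFinD EFinM -(rnormE sE Eust).
  apply: (@le_trans _ _ (nnorm G (u t) + nnorm G (u t - s n t)%R)).
    rewrite /r -(rnormE sG (EG _ (Es t Pt))).
    have stE : s n t = (u t - (u t - s n t))%R by rewrite opprB addrC subrK.
    rewrite {1}stE.
    by apply: sn_triB => //; apply: EG => //; exact: Eu.
  by apply: leeD; [exact: ug|exact: GE].
have hr : haarint ppos r <= haarint ppos g + c%:E * haarint ppos e'.
  rewrite -(haarintZ measurable_ppos (@subset_refl _ _) me' (fun t _ => e'0 t) (ltW c0)).
  rewrite -haarintD//; first last.
  - by move=> t _; rewrite mulr_ge0 ?(ltW c0).
  - by move=> t /ppos_gt0; exact: g0.
  - by apply: measurable_funM => //; exact: measurable_cst.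
  - exact: measurable_ppos.
  apply: haarint_le => // t _; rewrite /e' mulrA mulfV ?gt_eqF// mul1r.
  by rewrite -lerBlDl le_max lexx orbT.
have he' : haarint ppos e' <= (e / (2 * c))%:E.
  apply: le_trans H1; apply: ge0_le_integralW => t /ppos_gt0 t0.
    by rewrite lee_fin mulr_ge0// invr_ge0 ltW.
  rewrite mulrC EFinM lee_wpmul2r//; last exact: e'le.
  by rewrite lee_fin invr_ge0 ltW.
have GfS : ncarrier G (f - simple_integral (s n))%R by apply: EG; exact: sn_B.
have -> : f = ((f - simple_integral (s n)) + simple_integral (s n))%R by rewrite subrK.
apply: (le_trans (sn_tri sG GfS GS)).
have cec : (c * (e / (2 * c)) = e / 2)%R by field; rewrite gt_eqF.
have b1 : nnorm G (f - simple_integral (s n))%R <= (e / 2)%:E.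
  apply: (le_trans (GE _ _)); first exact: sn_B.
  by rewrite -cec EFinM; apply: lee_wpmul2l => //; rewrite lee_fin ltW.
have b2 : c%:E * haarint ppos e' <= (e / 2)%:E.
  by rewrite -cec EFinM; apply: lee_wpmul2l => //; rewrite lee_fin ltW.
apply: (le_trans (leeD b1 (le_trans hS (le_trans hr (leeD2l _ b2))))).
by rewrite addeCA -EFinD -splitr.
Qed.

Definition Jreal E F (t : R) x : R := Num.max (rnorm E x) (t * rnorm F x)%R.

Lemma JfunE E F t x : seminormed E -> seminormed F -> ncarrier E x -> ncarrier F x ->
  Jfun E F x t = (Jreal E F t x)%:E.
Proof. by move=> sE sF Ex Fx; rewrite /Jfun !rnormE// -EFinM -EFin_max. Qed.

Lemma Jreal_ge0 E F t x : seminormed E -> (0 <= Jreal E F t x)%R.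
Proof. by move=> sE; rewrite /Jreal le_max rnorm_ge0. Qed.

Lemma rnorm_dist E x y : seminormed E -> ncarrier E x -> ncarrier E y ->
  (`|rnorm E x - rnorm E y| <= rnorm E (x - y))%R.
Proof.
move=> sE Ex Ey.
have key z z' : ncarrier E z -> ncarrier E z' -> (rnorm E z <= rnorm E z' + rnorm E (z - z'))%R.
  move=> Ez Ez'; have h := sn_B sE Ez Ez'.
  rewrite -lee_fin EFinD -!rnormE//; have := sn_tri sE Ez' h.
  by rewrite addrC subrK.
have sym : rnorm E (y - x) = rnorm E (x - y).
  apply/le_anti/andP; split; rewrite -lee_fin -!rnormE//; try exact: sn_B.
    by rewrite -(opprB x y); apply: sn_normN => //; exact: sn_B.
  by rewrite -(opprB y x); apply: sn_normN => //; exact: sn_B.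
have := key x y Ex Ey; have := key y x Ey Ex; rewrite sym ler_norml; lra.
Qed.

(** Almost everywhere, [J (u t)] is the limit of [J (s n t)] for simple [s n];
    as the sigma-algebra is complete, this suffices. *)
Lemma measurable_Jreal E F u : seminormed E -> seminormed F ->
  strongly_measurable (inter_space E F) u -> lmeas (fun t => Jreal E F t (u t)).
Proof.
move=> sE sF [Eu [s ss aes]].
pose hn n (t : lebType R) : \bar R := (Jreal E F t (s n t))%:E.
have mhn n : measurable_fun (ppos : set (lebType R)) (hn n).
  apply/measurable_EFinP; apply: measurable_maxr.
    exact: simple_comp_measurable (rnorm E) (ss n).
  by apply: measurable_funM; [exact: lmeas_id|exact: simple_comp_measurable (rnorm F) (ss n)].
apply/measurable_EFinP.
apply: (@ae_measurable_fun _ (lebType R) R (leb R)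
  completed_lebesgue_measure_is_complete ppos (fun t => limn_esup (hn ^~ t))); last first.
  exact: measurable_fun_limn_esup.
have [N0 [mN0 N00 sN0]] := aes; exists N0; split => // t nt; apply: sN0 => /= ut.
apply: nt => /= Pt; have {}ut := ut Pt.
have t0 : (0 < t)%R by apply/ppos_gt0.
have [Ex Fx] := Eu t Pt.
suff : hn n t @[n --> \oo] --> (Jreal E F t (u t))%:E.
  by move=> /cvg_limn_einf_sup[_ ->].
apply: cvg_EFin; first by near=> n.
apply/cvgrPdist_le => e e0.
have m0 : (0 < Num.max 1 t)%R by rewrite lt_max ltr01.
have [N HN] := cvge0_le ut (divr_gt0 e0 m0).
near=> n; have /HN : (N <= n)%N by near: n; exact: nbhs_infty_ge.
have [_ Es _] := ss n; have [Ey Fy] := Es t Pt.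
rewrite /= (rnormE sE (sn_B sE Ex Ey)) (rnormE sF (sn_B sF Fx Fy)) -EFin_max lee_fin.
rewrite ge_max => /andP[hE hF].
have dE := rnorm_dist sE Ex Ey; have dF := rnorm_dist sF Fx Fy.
have m1 : (1 <= Num.max 1 t)%R by rewrite le_max lexx.
have mt : (t <= Num.max 1 t)%R by rewrite le_max lexx orbT.
have a1 : (`|rnorm E (u t) - rnorm E (s n t)| <= e)%R.
  apply: (le_trans dE); apply: (le_trans hE); rewrite ler_pdivrMr// ler_peMr// ltW//.
have a2 : (`|t * rnorm F (u t) - t * rnorm F (s n t)| <= e)%R.
  rewrite -mulrBr normrM (gtr0_norm t0).
  apply: (@le_trans _ _ (t * (e / Num.max 1 t))%R); first by rewrite ler_pM2l// (le_trans dF).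
  by rewrite mulrCA ler_piMr// ?(ltW e0)// ler_pdivrMr// mul1r.
move: a1 a2; rewrite /Jreal !ler_norml => /andP[a1 a2] /andP[a3 a4].
set A := rnorm E (u t) in a1 a2 *; set B := (t * rnorm F (u t))%R in a3 a4 *.
set A' := rnorm E (s n t) in a1 a2 *; set B' := (t * rnorm F (s n t))%R in a3 a4 *.
have := le_max A A B; have := le_max B A B; have := le_max A' A' B'; have := le_max B' A' B'.
rewrite !lexx !orbT /= => c1 c2 c3 c4.
apply/andP; split.
  have [->|->] : Num.max A' B' = A' \/ Num.max A' B' = B' by rewrite /Num.max; case: ifP; [right|left].
    lra.
  lra.
have [->|->] : Num.max A B = A \/ Num.max A B = B by rewrite /Num.max; case: ifP; [right|left].
  lra.
lra.
Unshelve. all: by end_near. Qed.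

Lemma Kfun_le_J E F x (s t : R) : seminormed E -> seminormed F ->
  ncarrier E x -> ncarrier F x -> (0 < s)%R -> (0 < t)%R ->
  Kfun E F x t <= (kmin t s * Jreal E F s x)%:E.
Proof.
move=> sE sF Ex Fx s0 t0.
have d1 : decompositions E (scale_space t F) x (x, 0%R).
  by split => //=; rewrite ?addr0//; exact: sn_0.
have d2 : decompositions E (scale_space t F) x (0%R, x).
  by split => //=; rewrite ?add0r//; exact: sn_0.
have h1 : Kfun E F x t <= (rnorm E x)%:E.
  rewrite KfunE; apply: (le_trans (sum_space_le d1)).
  by rewrite /= (sn_norm0 sF) mule0 adde0 rnormE.
have h2 : Kfun E F x t <= (t * rnorm F x)%:E.
  rewrite KfunE; apply: (le_trans (sum_space_le d2)).
  by rewrite /= (sn_norm0 sE) add0e (rnormE sF Fx).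
have J1 : (rnorm E x <= Jreal E F s x)%R by rewrite /Jreal le_max lexx.
have J2 : (s * rnorm F x <= Jreal E F s x)%R by rewrite /Jreal le_max lexx orbT.
have [m|m] := leP (t / s)%R 1%R; rewrite /kmin.
  rewrite min_r//; apply: (le_trans h2); rewrite lee_fin.
  apply: (@le_trans _ _ (t / s * (s * rnorm F x))%R); last by rewrite ler_wpM2l// divr_ge0 ?ltW.
  by rewrite mulrA divfK// gt_eqF.
by rewrite min_l ?(ltW m)// mul1r; apply: (le_trans h1); rewrite lee_fin.
Qed.

(** The representation converges in the norm of [E + F], which dominates
    [K (.) t / max(1, t)]; so [bochner_norm_le] applies with the norm
    [K (.) t]. *)
Lemma J_representation_K E F f u : seminormed E -> seminormed F ->
  J_representation E F f u -> forall t, (0 < t)%R ->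
  Kfun E F f t <= haarint ppos (fun s => kmin t s * Jreal E F s (u s))%R.
Proof.
move=> sE sF [su bu] t t0; rewrite KfunE.
have sS := seminormed_sum sE sF.
have sT := seminormed_sum sE (seminormed_scale (ltW t0) sF).
have m1 : (1 <= Num.max 1 t)%R by rewrite le_max lexx.
have mt : (t <= Num.max 1 t)%R by rewrite le_max lexx orbT.
have mpos : (0 < Num.max 1 t)%R by rewrite lt_max ltr01.
have mJ := measurable_Jreal sE sF su.
have [Eu _] := su.
apply: (bochner_norm_le sS sT _ mpos _ bu).
- by [].
- move=> x Sx; apply/lee_addgt0Pr => e e0.
  have [y0 [y1 [d hy]]] := sum_space_lt sE sF Sx (divr_gt0 e0 mpos).
  have d' : decompositions E (scale_space t F) x (y0, y1) by [].
  apply: (le_trans (sum_space_le d')).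
  apply: (@le_trans _ _ ((Num.max 1 t)%:E * (nnorm E y0 + nnorm F y1))).
    rewrite ge0_muleDr ?sn_ge0//; apply: leeD.
      by rewrite -[leLHS]mul1e; apply: lee_wpmul2r; rewrite ?sn_ge0.
    by apply: lee_wpmul2r; rewrite ?sn_ge0.
  apply: (le_trans (lee_wpmul2l _ hy)); first by rewrite lee_fin ltW.
  rewrite muleDr//; first by rewrite -EFinM mulrC divfK// gt_eqF.
  by rewrite fin_num_adde_defl.
- by apply: lmeasM => //; exact: lmeas_kmin.
- by move=> s s0; rewrite mulr_ge0 ?kmin_ge0 ?Jreal_ge0.
- move=> s s0; have [Ex Fx] : ncarrier (inter_space E F) (u s) by apply: Eu; apply/ppos_gt0.
  by rewrite -KfunE; exact: Kfun_le_J.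
Qed.

End Seminormed.

(** * Dyadic step functions *)
Section DyadicStep.
Context {R : realType}.

(** The index is 0 on [ ]0, 1] ] and [j.+1] on the block [ ]2^j, 2^(j+1)] ]. *)
Definition dyadic_idx (t : R) : nat := ex_minn (pow2_unbounded t).
Local Notation idx := dyadic_idx.

Lemma dyadic_idx_le (t : R) i : (idx t <= i)%N = (t <= 2 ^+ i).
Proof.
rewrite /idx; case: ex_minnP => m tm mmin; apply/idP/idP => [mi|/mmin//].
by apply: (le_trans tm); rewrite ler_eXn2l ?ltr1n.
Qed.

Lemma dyadic_idx0 (t : R) : (idx t == 0) = (t <= 1).
Proof. by rewrite -leqn0 dyadic_idx_le expr0. Qed.

Lemma dyadic_idxS (t : R) j : (idx t == j.+1) = (2 ^+ j < t <= 2 ^+ j * 2).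
Proof. by rewrite eqn_leq dyadic_idx_le exprSr andbC (ltnNge j) dyadic_idx_le -ltNge. Qed.

Lemma dyadic_idx_mem j (t : R) : oc (2 ^+ j) (2 ^+ j * 2) t -> idx t = j.+1.
Proof. by rewrite /= in_itv/= -dyadic_idxS => /eqP. Qed.

Lemma measurable_idx (Y : set nat) :
  measurable ((ppos `&` idx @^-1` Y) : set (lebType R)).
Proof.
rewrite (_ : _ `&` _ = \bigcup_(i in Y) (ppos `&` idx @^-1` [set i])).
  apply: bigcup_measurable => i _.
  rewrite [X in measurable X](_ : _ = ppos `&` [set` (if i is j.+1 then `]2 ^+ j, 2 ^+ j * 2] else `]-oo, 1] : interval R)]).
    by apply: measurableI; [exact: measurable_ppos|exact: leb_measurable_itv].
  congr (_ `&` _); apply/seteqP; split => t; case: i => [|j] /=; rewrite in_itv/=.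
  - by move=> /eqP; rewrite dyadic_idx0.
  - by move=> /eqP; rewrite dyadic_idxS.
  - by rewrite -dyadic_idx0 => /eqP.
  - by rewrite -dyadic_idxS => /eqP.
apply/seteqP; split => t.
  by move=> [Pt Yt]; exists (idx t).
by move=> [i Yi [Pt /= ->]].
Qed.

Lemma lmeas_idx (phi : nat -> R) : lmeas (fun t => phi (idx t)).
Proof. by move=> _ Y mY; exact: (measurable_idx (phi @^-1` Y)). Qed.

Definition block_haar j : R := fine (haarint (oc (2 ^+ j) (2 ^+ j * 2)) (fun=> 1)).

Let p2 n : 0 < (2 : R) ^+ n. Proof. by rewrite exprn_gt0. Qed.

Lemma block_haarP j : [/\ haarint (oc (2 ^+ j) (2 ^+ j * 2)) (fun=> 1) = (block_haar j)%:E,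
   2^-1 <= block_haar j & block_haar j <= 1].
Proof.
have /andP[h1 h2] := haarint_dyadic_bounds (p2 j).
have E : haarint (oc (2 ^+ j) (2 ^+ j * 2)) (fun=> 1) = (block_haar j)%:E.
  rewrite /block_haar fineK// fin_numE; apply/andP; split.
    by rewrite gt_eqF// (lt_le_trans _ h1)// ltNyr.
  by rewrite lt_eqF// (le_lt_trans h2)// ltry.
by split; rewrite -?lee_fin -?E.
Qed.

Lemma block_haar_gt0 j : 0 < block_haar j.
Proof. by have [_ h _] := block_haarP j; apply: lt_le_trans h; rewrite invr_gt0. Qed.

Lemma haarint_step_le (phi : nat -> R) (M : R) : (forall i, 0 <= phi i) -> phi 0%N = 0 ->
  (forall l, \sum_(j < l) block_haar j * phi j.+1 <= M) ->
  (haarint ppos (fun t => phi (idx t)) <= M%:E)%E.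
Proof.
move=> phi0 phi00 HM.
have mphi := lmeas_idx phi.
have pos t : 0 < t -> 0 <= phi (idx t) by [].
have -> : (ppos : set R) = \bigcup_l oc 0 (2 ^+ l : R).
  apply/seteqP; split => t; last by move=> [l _ /=]; rewrite in_itv/= => /andP[? _]; exact/ppos_gt0.
  move=> /ppos_gt0 t0; have [l tl] := pow2_unbounded t; exists l => //=.
  by rewrite in_itv/= t0.
apply: haarint_bigcup_le => //.
- move=> m n mn; apply/subsetPset => t /=; rewrite !in_itv/= => /andP[-> /le_trans]; apply.
  by rewrite ler_eXn2l ?ltr1n.
- by move=> n; exact: leb_measurable_itv.
- by move=> n; apply: itv_ppos; rewrite bnd_simp.
move=> l; rewrite (@haarint_split _ 0 1)//; last by rewrite bnd_simp pow2_ge1.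
have -> : haarint (oc 0 1) (fun t => phi (idx t)) = 0%E.
  rewrite (@eq_haarint _ _ _ (fun=> 0)).
    by rewrite /haarint; under eq_integral do rewrite mulr0; rewrite integral0.
  by move=> t /=; rewrite in_itv/= => /andP[_]; rewrite -dyadic_idx0 => /eqP ->.
rewrite add0e; have := @haarint_dyadic_sum R 1 l _ ltr01 mphi pos; rewrite mul1r => ->.
apply: (@le_trans _ _ (\sum_(j < l) (block_haar j * phi j.+1)%:E)%E); last first.
  by rewrite sumEFin lee_fin.
apply: lee_sum => j _; rewrite mul1r.
rewrite (@eq_haarint _ _ _ (fun t => phi j.+1 * 1)); last first.
  by move=> t Dt; rewrite mulr1 (dyadic_idx_mem Dt).
rewrite haarintZ//; last 3 first.
- exact: leb_measurable_itv.
- exact: dyadic_ppos.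
- exact: measurable_cst.
by have [-> _ _] := block_haarP j; rewrite -EFinM mulrC.
Qed.

End DyadicStep.

Section StepIntegral.
Context {R : realType} {V : lmodType R}.
Local Notation idx := dyadic_idx.
Implicit Types (E F G : nspace V) (r : nat -> V).

(** The value [r 0] is taken near 0, and [r j.+1] on the block at [2 ^ j]. *)
Definition step r (t : R) : V := r (idx t).

Definition trunc N r i : V := if (i <= N)%N then r i else 0.

Let p2 n : 0 < (2 : R) ^+ n. Proof. by rewrite exprn_gt0. Qed.

Lemma simple_step E r N : seminormed E -> (forall i, ncarrier E (r i)) ->
  simple_fun E (step (trunc N r)).
Proof.
move=> sE Er; split.
- apply: (@sub_finite_set _ _ ((trunc N r) @` `I_N.+2)).
    move=> v [t _ <-]; rewrite /step.
    have [h|h] := leqP (idx t) N; first by exists (idx t) => //=; rewrite ltnW.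
    by exists N.+1 => //=; rewrite /trunc ltnn leqNgt h.
  exact/finite_image/finite_II.
- move=> t _; rewrite /step /trunc; case: ifP => // _; exact: sn_0.
- by move=> v; exact: (measurable_idx ((trunc N r) @^-1` [set v])).
Qed.

(** The definition of [simple_integral] collects the points where the function
    has a given value [v]: several blocks may share it.  The set of zeros is
    unbounded, but contributes 0. *)
Lemma simple_integral_step r N : r 0%N = 0 ->
  simple_integral (step (trunc N r)) = \sum_(j < N) block_haar j *: r j.+1 :> V.
Proof.
move=> r0.
pose s := step (trunc N r); pose A := s @` ppos.
have fA : finite_set A.
  apply: (@sub_finite_set _ _ ((trunc N r) @` `I_N.+2)).
    move=> v [t _ <-]; rewrite /s /step.
    have [h|h] := leqP (idx t) N; first by exists (idx t) => //=; rewrite ltnW.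
    by exists N.+1 => //=; rewrite /trunc ltnn leqNgt h.
  exact/finite_image/finite_II.
have cE v : v != 0 -> fine (haar (s @^-1` [set v])) = \sum_(j < N | r j.+1 == v) block_haar j.
  move=> v0; pose D j : set R := oc (2 ^+ j) (2 ^+ j * 2).
  pose l := [seq j <- iota 0 N | r j.+1 == v].
  have DP j : D j `<=` ppos by exact: dyadic_ppos.
  have sE : ppos `&` s @^-1` [set v] = \big[setU/set0]_(j <- l) D j.
    rewrite -bigcup_seq; apply/seteqP; split => t.
      move=> [Pt /=]; rewrite /s /step /trunc; case: ifP => [tN rt|_ v00]; last first.
        by rewrite v00 eqxx in v0.
      case E : (idx t) => [|j]; first by move: rt v0; rewrite E r0 => <-; rewrite eqxx.
      exists j => /=.
        by rewrite mem_filter mem_iota add0n /=; move: rt tN; rewrite E => -> ->; rewrite eqxx.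
      by rewrite /D /= in_itv/= -dyadic_idxS E.
    move=> [j /=]; rewrite mem_filter mem_iota add0n /= => /andP[/eqP rj jN] Dj.
    split; first exact: DP Dj.
    by rewrite /s /step /trunc (dyadic_idx_mem Dj) jN.
  have -> : haar (s @^-1` [set v]) = haarint (\big[setU/set0]_(j <- l) D j) (fun=> 1).
    by rewrite /haar sE; apply: eq_integral => t _; rewrite mulr1.
  have lP : \big[setU/set0]_(j <- l) D j `<=` ppos by rewrite -sE; exact: subIsetl.
  have mD j : measurable (D j : set (lebType R)) by exact: leb_measurable_itv.
  have tr : trivIset [set` l] D.
    move=> i j _ _ [t [Di Dj]]; have := dyadic_idx_mem Di; by rewrite (dyadic_idx_mem Dj) => -[].
  have m1 : measurable_fun (\big[setU/set0]_(j <- l) D j : set (lebType R))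
      (fun t : lebType R => ((t^-1 * 1)%R)%:E).
    have mc : lmeas (fun=> 1 : R) by exact: measurable_cst.
    exact: measurable_funS measurable_ppos lP (lmeas_invM mc).
  have ge0 t : (\big[setU/set0]_(j <- l) D j) t -> (0 <= ((t^-1 * 1)%R)%:E)%E.
    by move=> /lP/ppos_gt0 t0; rewrite lee_fin mulr1 invr_ge0 ltW.
  rewrite /haarint (@ge0_integral_bigsetU _ _ _ (leb R) _ D _ l mD (filter_uniq _ (iota_uniq _ _)) tr m1 ge0).
  rewrite (eq_bigr (fun j => (block_haar j)%:E)); last first.
    by move=> j _; have [h _ _] := @block_haarP R j; exact: h.
  rewrite sumEFin /= big_filter -(big_mkord (fun j => r j.+1 == v)).
  by rewrite /index_iota subn0.
rewrite /simple_integral -/s fsbig_finite//=.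
rewrite (eq_big_seq (fun v => \sum_(j < N | r j.+1 == v) block_haar j *: r j.+1)); last first.
  move=> v _; have [->|v0] := eqVneq v 0.
    by rewrite scaler0 big1// => j /eqP ->; rewrite scaler0.
  by rewrite cE// scaler_suml; apply: eq_bigr => j /eqP ->.
rewrite (exchange_big_dep xpredT)//=; apply: eq_bigr => j _.
have rA : r j.+1 \in finmap.enum_fset (fset_set A).
  rewrite in_fset_set//; apply/mem_set; exists (2 ^+ j * 2); first by apply/ppos_gt0; rewrite mulr_gt0.
  have /eqP i : idx ((2 : R) ^+ j * 2) == j.+1 by rewrite dyadic_idxS lexx andbT; have := p2 j; lra.
  by rewrite /s /step i /trunc ltn_ord.
rewrite big_mkcond (bigD1_seq (r j.+1))//= ?eqxx ?finmap.fset_uniq//.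
by rewrite big1 ?addr0// => v; rewrite eq_sym => /negbTE ->.
Qed.

Lemma strongly_measurable_step E r : seminormed E -> (forall i, ncarrier E (r i)) ->
  strongly_measurable E (step r).
Proof.
move=> sE Er; split => [t _|]; first exact: Er.
exists (fun n => step (trunc n r)) => [n|]; first exact: simple_step.
apply: aeW => t Pt.
apply: cvg_near_cst; near=> n.
have h : (idx t <= n)%N by near: n; exact: nbhs_infty_ge.
by rewrite /step /trunc h subrr sn_norm0.
Unshelve. all: by end_near. Qed.

Lemma cvg0_of_le (u : nat -> \bar R) (e : nat -> R) : (forall n, 0 <= u n)%E ->
  (forall n, (u n <= (e n)%:E)%E) -> e n @[n --> \oo] --> 0 -> u n @[n --> \oo] --> 0%E.
Proof.
move=> u0 ue e0; apply: (@squeeze_cvge _ _ _ _ (fun=> 0%E) u (fun n => (e n)%:E)).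
- by near=> n; rewrite u0 ue.
- exact: cvg_cst.
- by apply: cvg_EFin; [near=> n|exact: e0].
Unshelve. all: by end_near. Qed.

(** The approximating simple functions are the truncations of the step function
    after [N m] blocks.  One sequence [e] bounds the tails of the integral of
    the norm and the distances of the partial sums to [f]. *)
Lemma bochner_step G r (f : V) (N : nat -> nat) (e : nat -> R) :
  seminormed G -> (forall i, ncarrier G (r i)) -> r 0%N = 0 -> ncarrier G f ->
  e n @[n --> \oo] --> 0 ->
  (forall m l, \sum_(j < l | (N m <= j)%N) block_haar j * rnorm G (r j.+1) <= e m) ->
  (forall m, (nnorm G (f - \sum_(j < N m) block_haar j *: r j.+1) <= (e m)%:E)%E) ->
  is_bochner_integral G (step r) f.
Proof.
move=> sG Gr r0 Gf e0 He Hf; split => //; first exact: strongly_measurable_step.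
have G0 := sn_0 sG.
have Gt n i : ncarrier G (trunc n r i) by rewrite /trunc; case: ifP.
exists (fun m => step (trunc (N m) r)); split.
- by move=> m; exact: simple_step.
- move=> m; pose phi i := rnorm G (trunc (N m) r i).
  have -> : (\int[leb R]_(t in ppos) (nnorm G (step (trunc (N m) r) t) * (t^-1)%:E) = haarint ppos (fun t => phi (idx t)))%E.
    by apply: eq_integral => t _; rewrite (rnormE sG (Gt _ _)) -EFinM mulrC.
  apply: le_lt_trans (ltry (\sum_(j < N m) block_haar j * phi j.+1)).
  apply: haarint_step_le => [i||l]; first exact: rnorm_ge0.
    by rewrite /phi /trunc leq0n r0 /rnorm sn_norm0.
  have pos j : 0 <= block_haar j * phi j.+1.
    by rewrite mulr_ge0 ?rnorm_ge0// ltW// block_haar_gt0.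
  have [lN|Nl] := leqP l (N m).
    rewrite -!(big_mkord xpredT (fun j => block_haar j * phi j.+1)).
    by rewrite [leRHS](big_cat_nat _ lN)//= lerDl; apply: sumr_ge0.
  rewrite -!(big_mkord xpredT (fun j => block_haar j * phi j.+1)).
  rewrite [leLHS](@big_cat_nat _ _ _ (N m))//=; last exact: ltnW.
  have Z : \sum_(N m <= j < l) block_haar j * phi j.+1 = 0.
    rewrite big_nat_cond big1// => j /andP[/andP[Nj _] _].
    by rewrite /phi /trunc ltnNge Nj/= /rnorm sn_norm0// mulr0.
  by rewrite Z addr0.
- apply: (cvg0_of_le _ _ e0) => m.
    by apply: integral_ge0 => t /ppos_gt0 t0; rewrite mule_ge0 ?sn_ge0// lee_fin invr_ge0 ltW.
  pose phi i := rnorm G (r i - trunc (N m) r i).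
  have -> : (\int[leb R]_(t in ppos) (nnorm G (step r t - step (trunc (N m) r) t)%R * (t^-1)%:E) = haarint ppos (fun t => phi (idx t)))%E.
    by apply: eq_integral => t _; rewrite (rnormE sG (sn_B sG (Gr _) (Gt _ _))) -EFinM mulrC.
  apply: haarint_step_le => [i||l]; first exact: rnorm_ge0.
    by rewrite /phi /trunc leq0n subrr /rnorm sn_norm0.
  apply: le_trans (He m l); rewrite [leRHS]big_mkcond/=; apply: ler_sum => j _.
  rewrite /phi /trunc; case: leqP => [Nj|jN]; last by rewrite subrr /rnorm sn_norm0// mulr0.
  by rewrite subr0.
- apply: (cvg0_of_le _ _ e0) => m; first exact: sn_ge0.
  by rewrite simple_integral_step.
Qed.

End StepIntegral.

(** * From the K-functional to J-representations *)
Section Kfunctional.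
Context {R : realType} {V : lmodType R}.
Variables E F : nspace V.
Hypothesis sE : seminormed E.
Hypothesis sF : seminormed F.

Definition Kreal (f : V) (t : R) : R := fine (Kfun E F f t).

Variable f : V.
Hypothesis Sf : ncarrier (sum_space E F) f.

Lemma KrealE t : 0 < t -> Kfun E F f t = (Kreal f t)%:E.
Proof.
move=> t0; have sT := seminormed_sum sE (seminormed_scale (ltW t0) sF).
by rewrite /Kreal fineK// KfunE; apply: (sn_fin sT).
Qed.

Lemma Kreal_ge0 t : 0 < t -> 0 <= Kreal f t.
Proof.
move=> t0; have sT := seminormed_sum sE (seminormed_scale (ltW t0) sF).
by apply: fine_ge0; rewrite KfunE; exact: (sn_ge0 sT).
Qed.

(** Any decomposition of [f] that is tested at [x] can be tested at [y].  The
    case [c = 1] says that [K f] is nondecreasing, the case [c = y / x] that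
    [K f t / t] is nonincreasing. *)
Lemma Kfun_ratio (c x y : R) : 0 < x -> 0 < y -> 1 <= c -> y <= c * x ->
  (Kfun E F f y <= c%:E * Kfun E F f x)%E.
Proof.
move=> x0 y0 c1 yx; have c0 : 0 < c := lt_le_trans ltr01 c1.
rewrite -lee_pdivrMl//; apply: le_ereal_inf_tmp => _ [[p0 p1] /= d <-].
rewrite lee_pdivrMl//; apply: (le_trans (sum_space_le (E := E) (F := scale_space y F) d)) => /=.
rewrite ge0_muleDr ?sn_ge0 ?mule_ge0 ?sn_ge0 ?lee_fin ?(ltW x0)//.
apply: leeD; first by rewrite -[leLHS]mul1e; apply: lee_wpmul2r; rewrite ?sn_ge0// lee_fin.
by rewrite muleA -EFinM; apply: lee_wpmul2r; rewrite ?sn_ge0// lee_fin.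
Qed.

Lemma Kreal_nd : nondecreasing_on ppos (Kreal f).
Proof.
move=> x y /ppos_gt0 x0 /ppos_gt0 y0 xy; rewrite -lee_fin -!KrealE//.
by have := @Kfun_ratio 1 y x y0 x0 (lexx _); rewrite mul1r mul1e => /(_ xy).
Qed.

Lemma Kreal_ratio x y : 0 < x -> x <= y -> Kreal f y * x <= Kreal f x * y.
Proof.
move=> x0 xy; have y0 := lt_le_trans x0 xy.
have := @Kfun_ratio (y / x) x y x0 y0; rewrite ler_pdivlMr// mul1r divfK ?gt_eqF//.
move=> /(_ xy (lexx _)); rewrite !KrealE// -EFinM lee_fin => h.
by rewrite -ler_pdivlMr//; apply: (le_trans h); rewrite mulrC mulrA.
Qed.

Lemma Kreal_double y : 0 < y -> Kreal f (y * 2) <= 2 * Kreal f y.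
Proof.
move=> y0; have y2 : 0 < y * 2 by rewrite mulr_gt0.
have := @Kfun_ratio 2 y (y * 2) y0 y2; rewrite ler1n (mulrC 2 y) => /(_ isT (lexx _)).
by rewrite !KrealE// -EFinM lee_fin.
Qed.

Lemma Kreal_decomposition (t e : R) : 0 < t -> 0 < e -> exists p : V * V,
  [/\ decompositions E F f p, rnorm E p.1 <= Kreal f t + e &
      t * rnorm F p.2 <= Kreal f t + e].
Proof.
move=> t0 e0; have [p0 [p1 [[/= h0 h1 h2] hn]]] :=
  sum_space_lt sE (seminormed_scale (ltW t0) sF) Sf e0.
have {}hn : (nnorm E p0 + t%:E * nnorm F p1 <= Kfun E F f t + e%:E)%E by exact: hn.
exists (p0, p1); move: hn; rewrite KrealE//= !rnormE// -EFinM -!EFinD lee_fin => hn.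
have r0 := @rnorm_ge0 _ _ E p0 sE; have r1 : 0 <= t * rnorm F p1 by rewrite mulr_ge0 ?rnorm_ge0// ltW.
by split => //=; apply: le_trans hn; rewrite ?lerDl ?lerDr.
Qed.

End Kfunctional.

Section KtoJ.
Context {R : realType} {V : lmodType R}.
Variables E F : nspace V.
Hypothesis sE : seminormed E.
Hypothesis sF : seminormed F.
Variables (B : R -> R) (C q : R) (al : R -> R).
Hypothesis wB : half_weight C B.
Hypothesis q1 : 1 <= q.
Hypothesis alE : forall t, 0 < t -> al t = B t * (tail_mass B t / B t) `^ q.
Local Notation w := (block_mass B).
Local Notation W := (tail_mass B).
Local Notation kap := (tail_ratio C).
Local Notation h := (@block_haar R).

Let p2 n : 0 < (2 : R) ^+ n. Proof. by rewrite exprn_gt0. Qed.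
Let w0 j : 0 < w (2 ^+ j). Proof. exact: block_mass_gt0 wB _ _. Qed.
Let q0 : 0 < q. Proof. exact: lt_le_trans ltr01 q1. Qed.
Let C0 : 0 < C. Proof. exact: lt_le_trans ltr01 (hw_ge1 wB). Qed.

Section Energy.
Variables (k : R -> R) (T : R).
Hypothesis k0 : forall t, 0 < t -> 0 <= k t.
Hypothesis knd : nondecreasing_on ppos k.
Hypothesis kT : (haarint (ray 1) (fun t => B t * k t `^ q)%R <= T%:E)%E.

Lemma energy_blocks N : \sum_(j < N) w (2 ^+ j) * k (2 ^+ j) `^ q <= T.
Proof.
have mBk : lmeas (fun t => B t * k t `^ q)%R.
  by apply: lmeasM; [exact: hw_meas wB|apply: lmeas_powR; exact: nondecreasing_leb_measurable].
have Bk0 t : 0 < t -> 0 <= B t * k t `^ q.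
  by move=> t0; rewrite mulr_ge0 ?powR_ge0// ltW// (hw_gt0 wB).
rewrite -lee_fin; apply: le_trans kT.
apply: (@le_trans _ _ (haarint (oc 1 (1 * 2 ^+ N)) (fun t => B t * k t `^ q)%R)); last first.
  apply: haarint_subset; last by move=> t /(tail_ppos ltr01)/ppos_gt0; exact: Bk0.
    by move=> t /=; rewrite !in_itv/= andbT => /andP[].
  exact: tail_ppos.
rewrite (@haarint_dyadic_sum R 1 N _ ltr01 mBk Bk0) -sumEFin; apply: lee_sum => j _.
rewrite mul1r; set y := 2 ^+ j; have yp : 0 < y := p2 j.
have [wE _ _] := block_mass_bounds wB yp.
have DP := @dyadic_ppos R y yp.
apply: (@le_trans _ _ (haarint (oc y (y * 2)) (fun t => k y `^ q * B t)%R)).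
  rewrite haarintZ ?powR_ge0//; first by rewrite wE -EFinM mulrC.
  - exact: leb_measurable_itv.
  - exact: hw_meas wB.
  - by move=> t /DP/ppos_gt0 t0; rewrite ltW// (hw_gt0 wB).
apply: haarint_le => // t Dt; have t0 : 0 < t by apply/ppos_gt0/DP.
  by rewrite mulr_ge0 ?powR_ge0// ltW// (hw_gt0 wB).
rewrite mulrC ler_wpM2l ?(ltW (hw_gt0 wB t0))//; apply: powR_le => //; first exact: k0.
apply: knd; [exact/ppos_gt0|exact/ppos_gt0|].
by move: Dt; rewrite /= in_itv/= => /andP[/ltW].
Qed.

Lemma energy_term j : w (2 ^+ j) * k (2 ^+ j) `^ q <= T.
Proof.
apply: le_trans (energy_blocks j.+1); rewrite big_ord_recr/= lerDr.
by apply: sumr_ge0 => i _; rewrite mulr_ge0 ?powR_ge0// ltW.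
Qed.

Definition decay_const : R := 1 + T * (4 * C ^+ 2) / B 1.

Lemma decay_const_ge1 : 1 <= decay_const.
Proof.
have T0 : 0 <= T by apply: le_trans (energy_term 0); rewrite mulr_ge0 ?powR_ge0// ltW.
by rewrite /decay_const lerDl divr_ge0 ?(ltW (hw_gt0 wB ltr01))// mulr_ge0// mulr_ge0// exprn_ge0// ltW.
Qed.

(** The block at [y = 2 ^ j] has mass at least a multiple of [B 1 / sqrt y], and
    its contribution to the energy is at most [T]; so [k y ^ q], and with it
    [k y], is at most a multiple of [sqrt y]. *)
Lemma k_decay j : k (2 ^+ j) / 2 ^+ j <= decay_const * sqrt2i ^+ j.
Proof.
have B1 := hw_gt0 wB ltr01; have jp := p2 j.
set y : R := 2 ^+ j in jp *.
have y1 : 1 <= y by exact: pow2_ge1.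
have s1 : 1 <= Num.sqrt y by rewrite -{1}sqrtr1 ler_wsqrtr.
have [_ b1 _] := block_mass_bounds wB jp.
have [_] := hw_growth wB ltr01 y1; rewrite divr1 => b2.
have By := hw_gt0 wB jp.
have et := energy_term j; rewrite -/y in et.
have kq : k y `^ q <= T * (4 * C ^+ 2) / B 1 * Num.sqrt y.
  have step1 : B 1 * k y `^ q <= (C * Num.sqrt y * (2 * (2 * C))) * T.
    apply: (@le_trans _ _ ((C * Num.sqrt y * (2 * (2 * C))) * (w y * k y `^ q))).
      rewrite mulrA ler_wpM2r ?powR_ge0//; apply: (le_trans b2).
      by rewrite -[leRHS]mulrA ler_wpM2l// mulr_ge0// ltW.
    by rewrite ler_wpM2l// mulr_ge0// ?mulr_ge0// ltW.
  rewrite -(ler_pM2l B1); apply: (le_trans step1); rewrite le_eqVlt; apply/orP; left; apply/eqP.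
  by field; rewrite gt_eqF.
have ky : k y <= decay_const * Num.sqrt y.
  have [k1|k1] := leP (k y) 1.
    apply: (le_trans k1); apply: (le_trans s1); by rewrite ler_peMl ?decay_const_ge1.
  apply: (le_trans (le1r_powR (ltW k1) q1)); apply: (le_trans kq).
  have -> : decay_const * Num.sqrt y = Num.sqrt y + T * (4 * C ^+ 2) / B 1 * Num.sqrt y.
    by rewrite /decay_const; ring.
  by rewrite lerDr sqrtr_ge0.
rewrite -sqrt2iX -/y ler_pdivrMr// mulrA divfK ?gt_eqF//.
Qed.

End Energy.

(** The element [f] is decomposed almost optimally at the ends of the levels, and
    the differences of consecutive decompositions are spread over the levels in
    proportion to the masses of the blocks.  As the tail mass is comparable to
    the mass of a level, the factor [W / w] in [al] compensates for this
    spreading. *)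
Lemma K_to_J : exists2 M : R, 0 < M & forall (f : V) (e T : R), 0 < e ->
  ncarrier (sum_space E F) f ->
  (haarint (ray 1) (fun t => B t * (Kreal E F f t + e) `^ q)%R <= T%:E)%E ->
  exists f0 g u, [/\ ncarrier E f0 /\ ncarrier (sum_space E F) g, f = f0 + g,
    rnorm E f0 `^ q <= M * T, J_representation E F g u &
    (haarint ppos (fun t => al t * Jreal E F t (u t) `^ q)%R <= (M * T)%:E)%E].
Proof.
have [n [n0 nS]] := levels_exist wB.
have lvm := level_mass_gt0 wB nS; have lvs := level_mass_sum wB nS.
have lvP := level_ofP n0 nS; have lvE := level_of_eq n0 nS.
move: (level_of n0 nS) (level_mass B n) lvm lvs lvP lvE => lev m m0 mE levP lev_eq Wm mm.
have ac0 : 0 < dual_weight_const C q := dual_weight_const_gt0 wB q.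
have kap0 : 0 < kap := lt_le_trans ltr01 (tail_ratio_ge1 wB).
pose M2 := dual_weight_const C q * 8 `^ q * (4 * kap) ^+ 2.
have M20 : 0 < M2 by rewrite /M2 !mulr_gt0 ?powR_gt0 ?exprn_gt0 ?mulr_gt0.
exists ((m 1%N)^-1 + M2); first by rewrite addr_gt0 ?invr_gt0.
move=> f e T e0 Sf hT.
pose k t := Kreal E F f t + e.
have kp t : 0 < t -> 0 < k t by move=> t0; rewrite ltr_wpDl// Kreal_ge0.
have k0 t : 0 < t -> 0 <= k t by move=> /kp/ltW.
have knd : nondecreasing_on ppos k by move=> x y Px Py xy; rewrite lerD2r; exact: Kreal_nd.
have eb := energy_blocks k0 knd hT.
have T0 : 0 <= T by have := eb 0; rewrite big_ord0.
pose x k : R := 2 ^+ n k.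
have x0 i : 0 < x i by exact: p2.
have xS i j : (i <= j)%N -> x i <= x j.
  by move=> ij; rewrite ler_eXn2l ?ltr1n//; exact: level_mono.
have knx i j : (i <= j)%N -> k (x i) <= k (x j).
  by move=> /xS xx; apply: knd => //; exact/ppos_gt0.
have msum i y : m i * y = \sum_(n i <= j < n i.+1) w (2 ^+ j) * y.
  by rewrite -mulr_suml mE.
have mass_le i : m i * k (x i) `^ q <= \sum_(n i <= j < n i.+1) w (2 ^+ j) * k (2 ^+ j) `^ q.
  rewrite msum; apply: ler_sum_nat => j /andP[nj _].
  apply: (ler_wpM2l (ltW (w0 j))); apply: (powR_le q1 (k0 _ (x0 i))).
  apply: knd; [exact/ppos_gt0/x0|exact/ppos_gt0/p2|].
  by rewrite /x ler_eXn2l ?ltr1n.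
have /choice[p pP] : forall i, exists p : V * V,
  [/\ decompositions E F f p, rnorm E p.1 <= k (x i) & x i * rnorm F p.2 <= k (x i)].
  by move=> i; exact: Kreal_decomposition.
pose a i := (p i).1; pose b i := (p i).2.
have Ea i : ncarrier E (a i) by have [[]] := pP i.
have Fb i : ncarrier F (b i) by have [[]] := pP i.
have fab i : f = a i + b i by have [[]] := pP i.
have aN i : rnorm E (a i) <= k (x i) by have [] := pP i.
have bN i : rnorm F (b i) <= k (x i) / x i.
  by have [_ _ h] := pP i; rewrite ler_pdivlMr// mulrC.
(* The shift of indices makes [x i.+1], the right end of the level [i], the
   left end of the range [x i.+1 .. x i.+2] of [d i]; on the level,
   [t * rnorm F (d i)] is therefore at most [2 * k (x i.+1)]. *)
pose d i := a i.+2 - a i.+1.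
have dE i : d i = b i.+1 - b i.+2.
  have -> : b i.+1 = f - a i.+1 by rewrite (fab i.+1) addrAC subrr add0r.
  have -> : b i.+2 = f - a i.+2 by rewrite (fab i.+2) addrAC subrr add0r.
  by rewrite /d opprB [RHS]addrC addrA subrK.
have Ed i : ncarrier E (d i) by exact: sn_B.
have Fd i : ncarrier F (d i) by rewrite dE; exact: sn_B.
have rB (G : nspace V) y z : seminormed G -> ncarrier G y -> ncarrier G z ->
    rnorm G (y - z) <= rnorm G y + rnorm G z.
  move=> sG Gy Gz; rewrite -lee_fin EFinD -!rnormE//; last exact: sn_B.
  exact: sn_triB.
have dEn i : rnorm E (d i) <= 2 * k (x i.+2).
  apply: (le_trans (rB _ _ _ sE (Ea _) (Ea _))).
  by have := aN i.+2; have := aN i.+1; have := knx i.+1 i.+2 (leqnSn _); lra.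
have kr i j : (i <= j)%N -> k (x j) / x j <= k (x i) / x i.
  move=> ij; rewrite ler_pdivrMr// mulrAC ler_pdivlMr// !mulrDl; apply: lerD.
    by apply: Kreal_ratio => //; exact: xS.
  by rewrite ler_pM2l// xS.
have dFn i : rnorm F (d i) <= 2 * (k (x i.+1) / x i.+1).
  rewrite dE; apply: (le_trans (rB _ _ _ sF (Fb _) (Fb _))).
  by have := bN i.+2; have := bN i.+1; have := kr i.+1 i.+2 (leqnSn _); lra.
pose dc := decay_const T.
have dc1 : 1 <= dc by exact: decay_const_ge1 k0 knd hT.
have /andP[s0 s1] := @sqrt2i_bounds R.
have kd i j : (i <= j)%N -> k (x j) / x j <= dc * sqrt2i ^+ i.
  move=> ij; apply: (le_trans (k_decay k0 knd hT (n j))).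
  rewrite ler_wpM2l ?(le_trans ler01 dc1)//; apply: ler_wiXn2l; rewrite ?(ltW s0) ?(ltW s1)//.
  by apply: (leq_trans ij); exact: level_ge.
have dFd i : rnorm F (d i) <= 2 * (dc * sqrt2i ^+ i).
  by apply: (le_trans (dFn i)); rewrite ler_pM2l// kd.
pose G := sum_space E F.
have sG : seminormed G := seminormed_sum sE sF.
have GF y : ncarrier F y -> ncarrier G y.
  by move=> Fy; exists (0, y); split => //=; rewrite ?add0r//; exact: sn_0.
have GE y : ncarrier E y -> ncarrier G y.
  by move=> Ey; exists (y, 0); split => //=; rewrite ?addr0//; exact: sn_0.
have rGF y : ncarrier F y -> rnorm G y <= rnorm F y.
  move=> Fy; rewrite -lee_fin -(rnormE sG (GF _ Fy)).
  have dy : decompositions E F y (0, y) by split => //=; rewrite ?add0r//; exact: sn_0.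
  by apply: (le_trans (sum_space_le dy)); rewrite /= (sn_norm0 sE) add0e rnormE.
have h0 j : 0 < h j := block_haar_gt0 j.
(* [w / m] is the share of the block [j] in its level, and the division by
   [h j], the measure of the block, makes [d i] the integral over the level. *)
pose c j := w (2 ^+ j) / (m (lev j) * h j).
have c0 j : 0 < c j by rewrite /c divr_gt0// mulr_gt0.
pose v j := c j *: d (lev j).
pose r i : V := if i is j.+1 then v j else 0.
have Er i : ncarrier E (r i) by case: i => [|j] /=; [exact: sn_0|exact: sn_Z].
have Fr i : ncarrier F (r i) by case: i => [|j] /=; [exact: sn_0|exact: sn_Z].
have sI := seminormed_inter sE sF.
have massE i : \sum_(n i <= j < n i.+1) w (2 ^+ j) / m i = 1.
  by rewrite -mulr_suml mE mulfV// gt_eqF// m0.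
have hc j : h j * c j = w (2 ^+ j) / m (lev j).
  rewrite /c; field; apply/andP; split; rewrite gt_eqF//; exact: m0.
have sumv i : \sum_(n i <= j < n i.+1) h j *: v j = d i.
  rewrite (eq_big_nat _ _ (F2 := fun j => (w (2 ^+ j) / m i) *: d i)).
    by rewrite -scaler_suml massE scale1r.
  by move=> j ij; rewrite /v scalerA hc (lev_eq _ _ ij).
have partial N : \sum_(j < n N) h j *: r j.+1 = a N.+1 - a 1%N.
  rewrite -(big_mkord xpredT (fun j => h j *: r j.+1)) -{1}n0.
  rewrite (level_blocks nS _ (leq0n N)) (eq_bigr d); last by move=> i _; exact: sumv.
  by rewrite (telescope_sumr (fun i => a i.+1)).
(* By [k_decay] and [2 ^ i <= x i], the terms and the remainders of the series
   decay geometrically in [F], hence in [E + F]. *)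
pose err i := (2 * dc / (1 - sqrt2i)) * sqrt2i ^+ i.
have s1' : 0 < 1 - (sqrt2i : R) by rewrite subr_gt0.
have dc0 : 0 < dc := lt_le_trans ltr01 dc1.
have err0 : err i @[i --> \oo] --> 0.
  rewrite -(mulr0 (2 * dc / (1 - sqrt2i))); apply: cvgMr.
  by apply: cvg_expr; rewrite gtr0_norm.
have err_tail N L : \sum_(N <= i < L) 2 * (dc * sqrt2i ^+ i) <= err N.
  rewrite -!mulr_sumr.
  have -> : err N = 2 * (dc * (sqrt2i ^+ N / (1 - sqrt2i))) by rewrite /err; ring.
  rewrite ler_pM2l// ler_pM2l//; apply: geometric_tail_le; by rewrite (ltW s0) s1.
have Gr i : ncarrier G (r i) by exact: GE.
have gE : f = a 1%N + b 1%N := fab 1.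
have boch : is_bochner_integral G (step r) (b 1%N).
  apply: (@bochner_step _ _ _ _ _ n err) => //; first exact: GF.
  - move=> N l.
    have pos j : 0 <= h j * rnorm G (r j.+1) by rewrite mulr_ge0 ?rnorm_ge0// ltW.
    have LN : (N <= maxn N l)%N by rewrite leq_maxl.
    have lL : (l <= n (maxn N l))%N.
      by apply: (leq_trans (leq_maxr N l)); exact: level_ge.
    apply: (@le_trans _ _ (\sum_(n N <= j < n (maxn N l)) h j * rnorm G (r j.+1))).
      rewrite [leRHS]big_geq_mkord/=.
      rewrite -!(big_mkord (fun j => n N <= j)%N (fun j => h j * rnorm G (r j.+1))).
      by rewrite [leRHS](big_cat_nat _ lL)//= lerDl; apply: sumr_ge0.
    rewrite (level_blocks nS _ LN); apply: le_trans (err_tail N (maxn N l)).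
    apply: ler_sum => i _; apply: le_trans (dFd i).
    apply: (@le_trans _ _ (\sum_(n i <= j < n i.+1) w (2 ^+ j) / m i * rnorm F (d i))); last first.
      by rewrite -mulr_suml massE mul1r.
    apply: ler_sum_nat => j ij; rewrite /= /v (lev_eq _ _ ij) -(lev_eq _ _ ij) -hc -mulrA ler_pM2l//.
    have Gd := GF _ (Fd (lev j)).
    apply: (@le_trans _ _ (c j * rnorm G (d (lev j)))); last by rewrite ler_pM2l// rGF.
    rewrite -lee_fin EFinM -!rnormE//; last exact: sn_Z.
    by have := sn_hom sG (c j) Gd; rewrite gtr0_norm.
  - move=> N; rewrite partial.
    have -> : b 1%N - (a N.+1 - a 1%N) = b N.+1.
      by rewrite opprB addrA (addrC (b 1%N)) -gE (fab N.+1) addrAC subrr add0r.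
    rewrite (rnormE sG (GF _ (Fb _))) lee_fin.
    apply: (le_trans (rGF _ (Fb _))); apply: (le_trans (bN _)).
    apply: (le_trans (kd N N.+1 (leqnSn _))).
    rewrite /err ler_wpM2r ?exprn_ge0 ?(ltW s0)// ler_pdivlMr//.
    by rewrite mulrC ler_pM2r//; lra.
exists (a 1%N), (b 1%N), (step r); split => //.
- by split => //; exact: GF.
- have h1 := energy_term k0 knd hT.
  have : m 1%N * k (x 1%N) `^ q <= T.
    apply: le_trans (eb (n 2%N)).
    rewrite -(big_mkord xpredT (fun j => w (2 ^+ j) * k (2 ^+ j) `^ q)).
    rewrite (@big_cat_nat _ _ _ (n 1%N))//=; last exact: ltnW.
    rewrite -[leLHS]add0r; apply: lerD.
      by apply: sumr_ge0 => j _; rewrite mulr_ge0 ?powR_ge0// ltW.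
    exact: mass_le.
  move=> hm; apply: (@le_trans _ _ ((m 1%N)^-1 * T)); last first.
    by rewrite ler_wpM2r// lerDl ltW.
  rewrite ler_pdivlMl//; apply: le_trans hm; rewrite ler_pM2l//.
  by apply: powR_le => //; exact: rnorm_ge0.
- split => //; exact: strongly_measurable_step.
(* A majorant of the integrand, block by block: the factors [w / m] and [W / w]
   have product at most 2, and [2 * k (x i.+2)] bounds the J-functional of
   [d i].  The sum over a level is a multiple of [m i * k (x i.+2) ^ q], and two
   comparisons of consecutive level masses lead to the energy. *)
- pose phi i := if i is j.+1 then
     dual_weight_const C q * 8 `^ q * (w (2 ^+ j) * k (x (lev j).+2) `^ q) else 0.
  have phi0 i : 0 <= phi i.
    by case: i => // j; rewrite /phi mulr_ge0 ?mulr_ge0 ?powR_ge0 ?(ltW ac0)// ltW.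
  apply: (@le_trans _ _ (haarint ppos (fun t => phi (dyadic_idx t)))).
    apply: haarint_le => // t /ppos_gt0 t0.
      rewrite mulr_ge0 ?powR_ge0// alE// mulr_ge0 ?powR_ge0// ltW// (hw_gt0 wB)//.
    rewrite /step; case it : (dyadic_idx t) => [|j] /=.
      by rewrite /Jreal /rnorm !sn_norm0// mulr0 maxxx powR0 ?mulr0// gt_eqF.
    have tj : 2 ^+ j < t <= 2 ^+ j * 2 by rewrite -dyadic_idxS it.
    have [al1 _] := dual_weight_bounds wB q1 alE (p2 j) tj.
    set i := lev j; have /andP[ij ji] : (n i <= j < n i.+1)%N by exact: levP.
    have txi : t <= x i.+1.
      case/andP: tj => _ /le_trans; apply.
      by rewrite -exprSr ler_eXn2l ?ltr1n.
    have Jd : Jreal E F t (d i) <= 2 * k (x i.+2).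
      rewrite /Jreal ge_max dEn/=.
      apply: (@le_trans _ _ (x i.+1 * (2 * (k (x i.+1) / x i.+1)))).
        apply: ler_pM => //; rewrite ?rnorm_ge0 ?(ltW t0)//; exact: dFn.
      have -> : x i.+1 * (2 * (k (x i.+1) / x i.+1)) = 2 * k (x i.+1).
        by field; rewrite gt_eqF.
      by rewrite ler_pM2l// knx.
    have Jv : Jreal E F t (v j) <= c j * (2 * k (x i.+2)).
      apply: (@le_trans _ _ (c j * Jreal E F t (d i))); last by rewrite ler_pM2l.
      have hom (H : nspace V) y : seminormed H -> ncarrier H y -> rnorm H (c j *: y) <= c j * rnorm H y.
        move=> sH Hy; rewrite -lee_fin EFinM -!rnormE//; last exact: sn_Z.
        by have := sn_hom sH (c j) Hy; rewrite gtr0_norm.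
      have J1 : rnorm E (d i) <= Jreal E F t (d i) by rewrite /Jreal le_max lexx.
      have J2 : t * rnorm F (d i) <= Jreal E F t (d i) by rewrite /Jreal le_max lexx orbT.
      rewrite {1}/Jreal ge_max; apply/andP; split.
        by apply: (le_trans (hom _ _ sE (Ed i))); rewrite ler_pM2l.
      apply: (@le_trans _ _ (t * (c j * rnorm F (d i)))).
        by rewrite ler_pM2l// (hom _ _ sF (Fd i)).
      by rewrite mulrCA ler_pM2l.
    have cj : c j <= 2 * (w (2 ^+ j) / m i).
      have [_ hh _] := @block_haarP R j.
      have -> : c j = (h j)^-1 * (w (2 ^+ j) / m i) by rewrite /c -/i invfM; ring.
      apply: ler_wpM2r; first by rewrite divr_ge0 ?(ltW (w0 j)) ?(ltW (m0 i)).
      by rewrite invf_ple ?posrE.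
    have Wj : W (2 ^+ j) / w (2 ^+ j) * (c j * (2 * k (x i.+2))) <= 8 * k (x i.+2).
      have Wj' : W (2 ^+ j) <= 2 * m i.
        apply: le_trans (Wm i); apply: (tail_mass_ni wB) => //.
        by rewrite ler_eXn2l ?ltr1n.
      have Wc4 : W (2 ^+ j) / w (2 ^+ j) * c j <= 4.
        apply: (@le_trans _ _ (2 * m i / w (2 ^+ j) * (2 * (w (2 ^+ j) / m i)))).
          apply: ler_pM.
          - by rewrite divr_ge0 ?(ltW (w0 j))// ltW// (tail_mass_gt0 wB).
          - exact: ltW.
          - by apply: ler_wpM2r; [rewrite invr_ge0 ltW|exact: Wj'].
          - exact: cj.
        rewrite le_eqVlt; apply/orP; left; apply/eqP; field.
        by apply/andP; split; rewrite gt_eqF//; exact: m0.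
      rewrite mulrA; apply: (@le_trans _ _ (4 * (2 * k (x i.+2)))).
        by apply: ler_wpM2r => //; rewrite mulr_ge0 ?k0.
      by rewrite le_eqVlt; apply/orP; left; apply/eqP; ring.
    have Jv0 : 0 <= Jreal E F t (v j) by exact: Jreal_ge0.
    have Wr0 : 0 <= W (2 ^+ j) / w (2 ^+ j).
      by rewrite divr_ge0 ?(ltW (w0 j))// ltW// (tail_mass_gt0 wB).
    apply: (@le_trans _ _ (dual_weight_const C q * (w (2 ^+ j) * (W (2 ^+ j) / w (2 ^+ j)) `^ q) * (c j * (2 * k (x i.+2))) `^ q)).
      apply: ler_pM => //; rewrite ?powR_ge0//; last exact: powR_le.
      by rewrite alE// mulr_ge0 ?powR_ge0// ltW// (hw_gt0 wB).
    have cb0 : 0 <= c j * (2 * k (x i.+2)) by rewrite mulr_ge0 ?(ltW (c0 j))// mulr_ge0 ?k0.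
    have key := powR_le q1 (mulr_ge0 Wr0 cb0) Wj.
    rewrite (powRM _ Wr0 cb0) (@powRM _ 8) ?k0// in key.
    have := ler_wpM2l (ltW ac0) (ler_wpM2l (ltW (w0 j)) key).
    by rewrite [in leRHS](mulrCA (w _)) !mulrA.
  apply: haarint_step_le => // l.
  have wphi j : 0 <= phi j.+1 by exact: phi0.
  apply: (@le_trans _ _ (\sum_(j < n l) phi j.+1)).
    apply: (@le_trans _ _ (\sum_(j < l) phi j.+1)).
      by apply: ler_sum => j _; rewrite ler_piMl//; have [_ _] := @block_haarP R j.
    have ll := level_ge nS l.
    rewrite -!(big_mkord xpredT (fun j => phi j.+1)).
    by rewrite [leRHS](big_cat_nat _ ll)//= lerDl; apply: sumr_ge0 => j _; exact: (wphi j).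
  rewrite -(big_mkord xpredT (fun j => phi j.+1)) -{1}n0 (level_blocks nS _ (leq0n l)).
  apply: (@le_trans _ _ (\sum_(0 <= i < l) dual_weight_const C q * 8 `^ q * (m i * k (x i.+2) `^ q))).
    apply: ler_sum => i _; rewrite msum mulr_sumr; apply: ler_sum_nat => j ij.
    by rewrite /phi (lev_eq _ _ ij).
  rewrite -mulr_sumr.
  have mass2 : \sum_(0 <= i < l) m i * k (x i.+2) `^ q <= (4 * kap) ^+ 2 * T.
    apply: (@le_trans _ _ ((4 * kap) ^+ 2 * \sum_(0 <= i < l) m i.+2 * k (x i.+2) `^ q)).
      rewrite mulr_sumr; apply: ler_sum => i _; rewrite mulrA ler_wpM2r ?powR_ge0//.
      have k4 : 0 < 4 * kap by exact: mulr_gt0.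
      apply: (le_trans (mm i)); apply: (le_trans (ler_wpM2l (ltW k4) (mm i.+1))).
      by rewrite le_eqVlt; apply/orP; left; apply/eqP; ring.
    rewrite ler_pM2l ?exprn_gt0 ?mulr_gt0//.
    apply: (@le_trans _ _ (\sum_(0 <= i < l.+2) m i * k (x i) `^ q)).
      rewrite [leRHS](@big_cat_nat _ _ _ 2%N)//= -[leLHS]add0r; apply: lerD.
        by apply: sumr_ge0 => i _; rewrite mulr_ge0 ?powR_ge0// ltW// m0.
      by rewrite !big_add1.
    apply: le_trans (eb (n l.+2)).
    rewrite -(big_mkord xpredT (fun j => w (2 ^+ j) * k (2 ^+ j) `^ q)) -{2}n0.
    rewrite (level_blocks nS _ (leq0n l.+2)); apply: ler_sum => i _.
    exact: mass_le.
  apply: (@le_trans _ _ (M2 * T)); last by rewrite ler_wpM2r// lerDr invr_ge0 ltW.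
  by rewrite /M2 -[leRHS]mulrA ler_pM2l// mulr_gt0// powR_gt0.
Qed.
End KtoJ.

(** * Sums with the first space *)
Section Embeddings.
Context {R : realType} {V : lmodType R}.
Implicit Types E F G : nspace V.
Local Open Scope ereal_scope.

Definition embeds E F : Prop := ncarrier E `<=` ncarrier F /\
  exists2 C : R, (0 < C)%R & forall f, ncarrier E f -> nnorm F f <= C%:E * nnorm E f.

Lemma embeds_trans E F G : embeds E F -> embeds F G -> embeds E G.
Proof.
move=> [EF [C C0 hC]] [FG [D D0 hD]]; split; first exact: subset_trans FG.
exists (D * C)%R; first exact: mulr_gt0.
move=> f Ef; apply: (le_trans (hD f (EF f Ef))).
by rewrite EFinM -muleA; apply: lee_wpmul2l; [rewrite lee_fin ltW|exact: hC].
Qed.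

Lemma space_eq_embeds E F : (forall f, 0 <= nnorm E f) -> (forall f, 0 <= nnorm F f) ->
  embeds E F -> embeds F E -> space_eq E F.
Proof.
move=> E0 F0 [EF [C C0 hC]] [FE [D D0 hD]]; split; first by apply/seteqP.
exists (Num.max C D); first by rewrite lt_max C0.
move=> f Ef; split.
  apply: (le_trans (hD f (EF f Ef))); apply: lee_wpmul2r => //.
  by rewrite lee_fin le_max lexx orbT.
apply: (le_trans (hC f Ef)); apply: lee_wpmul2r => //.
by rewrite lee_fin le_max lexx.
Qed.

End Embeddings.

Section LqNorm.
Context {R : realType}.
Variable q : R.
Hypothesis q1 : 1 <= q.
Let q0 : 0 < q. Proof. exact: lt_le_trans ltr01 q1. Qed.
Local Open Scope ereal_scope.

(** The factor [t ^ (-1/q)] turns [dt] into [dt/t]. *)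
Lemma Lq_haarint (v k : R -> R) (G : R -> \bar R) :
  (forall t, (0 < t)%R -> (0 <= v t)%R) -> (forall t, (0 < t)%R -> (0 <= k t)%R) ->
  (forall t, (0 < t)%R -> G t = (k t)%:E) ->
  Lq_norm q%:E ppos (fun t => (t `^ (- fine q%:E^-1) * v t)%:E * G t) =
  (haarint ppos (fun t => v t `^ q * k t `^ q)%R) `^ q^-1.
Proof.
move=> v0 k0 Gk; rewrite /Lq_norm unlock; congr (_ `^ _).
rewrite /haarint [RHS]integral_mkcond; apply: eq_integral => t _.
rewrite /patch; case: ifPn => [/set_mem Pt|_]; last by rewrite abse0 poweR0r// gt_eqF.
have t0 : (0 < t)%R by apply/ppos_gt0.
rewrite (Gk _ t0) inver gt_eqF//= ger0_norm ?mulr_ge0 ?powR_ge0 ?v0 ?k0//.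
rewrite powRM ?mulr_ge0 ?powR_ge0 ?v0 ?k0// powRM ?powR_ge0 ?v0// -powRrM.
by rewrite mulNr mulVf ?gt_eqF// powR_inv1 ?(ltW t0)// mulrA.
Qed.

Lemma two_powRD_le (x y : R) : (0 <= x)%R -> (0 <= y)%R ->
  (2 `^ q * (x `^ q + y `^ q) <= (4 * (x + y)) `^ q)%R.
Proof.
move=> x0 y0; have xy0 : (0 <= x + y)%R by rewrite addr_ge0.
have -> : (4 * (x + y) = 2 * (2 * (x + y)))%R by ring.
have t0 : (0 <= 2 * (x + y))%R by rewrite mulr_ge0.
rewrite [leRHS]powRM// ler_pM2l ?powR_gt0// [leRHS]powRM//.
apply: (@le_trans _ _ (2 * (x + y) `^ q)%R).
  by rewrite mulrDl !mul1r; apply: lerD; apply: powR_le => //; rewrite ?lerDl ?lerDr.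
by rewrite ler_wpM2r ?powR_ge0// le1r_powR// ler1n.
Qed.

Lemma poweR_rootK (x : \bar R) : 0 <= x -> (x `^ q^-1) `^ q = x.
Proof. by move=> x0; rewrite -poweRrM mulVf ?gt_eqF// poweRe1. Qed.

Lemma powR_rootK (x : R) : (0 <= x)%R -> (x `^ q `^ q^-1 = x)%R.
Proof. by move=> x0; rewrite -powRrM mulfV ?gt_eqF// powRr1. Qed.

Lemma root_le (x : \bar R) (y : R) : 0 <= x -> (0 <= y)%R ->
  x <= (y `^ q)%:E -> x `^ q^-1 <= y%:E.
Proof.
move=> x0 y0 xy; have -> : y%:E = (y `^ q)%:E `^ q^-1 by rewrite poweR_EFin powR_rootK.
apply: gt0_ler_poweR => //; rewrite ?in_itv/= ?leey ?andbT ?lee_fin ?powR_ge0//.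
by rewrite invr_ge0 ltW.
Qed.

Lemma le_root (x : \bar R) (y : R) : 0 <= x -> (0 <= y)%R ->
  x `^ q^-1 <= y%:E -> x <= (y `^ q)%:E.
Proof.
move=> x0 y0 xy; rewrite -(poweR_rootK x0) -poweR_EFin.
apply: gt0_ler_poweR => //; rewrite ?in_itv/= ?leey ?andbT ?lee_fin ?poweR_ge0//.
exact: ltW.
Qed.

End LqNorm.

Section KSpaces.
Context {R : realType} {V : lmodType R}.
Variables E F : nspace V.
Hypothesis sE : seminormed E.
Hypothesis sF : seminormed F.
Variable q : R.
Hypothesis q1 : 1 <= q.
Let q0 : 0 < q. Proof. exact: lt_le_trans ltr01 q1. Qed.
Local Notation S := (sum_space E F).
Let sS : seminormed S := seminormed_sum sE sF.
Local Notation K := (Kreal E F).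

Lemma carrierE f : ncarrier E f -> ncarrier S f.
Proof. by move=> Ef; exists (f, 0); split => //=; rewrite ?addr0//; exact: sn_0. Qed.

Lemma carrierF f : ncarrier F f -> ncarrier S f.
Proof. by move=> Ff; exists (0, f); split => //=; rewrite ?add0r//; exact: sn_0. Qed.

Lemma Kreal_leE f t : ncarrier E f -> 0 < t -> K f t <= rnorm E f.
Proof.
move=> Ef t0; rewrite -lee_fin -(KrealE sE sF (carrierE Ef) t0) -rnormE//.
have d : decompositions E (scale_space t F) f (f, 0).
  by split => //=; rewrite ?addr0//; exact: sn_0.
by apply: (le_trans (sum_space_le d)); rewrite /= (sn_norm0 sF) mule0 adde0.
Qed.

Lemma Kreal_leF f t : ncarrier F f -> 0 < t -> K f t <= t * rnorm F f.
Proof.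
move=> Ff t0; rewrite -lee_fin -(KrealE sE sF (carrierF Ff) t0) EFinM -rnormE//.
have d : decompositions E (scale_space t F) f (0, f).
  by split => //=; rewrite ?add0r//; exact: sn_0.
by apply: (le_trans (sum_space_le d)); rewrite /= (sn_norm0 sE) add0e.
Qed.

Lemma Kreal_triangle f g t : ncarrier S f -> ncarrier S g -> 0 < t ->
  K (f + g) t <= K f t + K g t.
Proof.
move=> Sf Sg t0; have sT := seminormed_sum sE (seminormed_scale (ltW t0) sF).
rewrite -lee_fin EFinD -!KrealE//; last exact: sn_D.
exact: (sn_tri sT Sf Sg).
Qed.

Definition Kenergy (D : set R) (beta : R -> R) (k : R -> R) : \bar R :=
  haarint D (fun t => beta t * k t `^ q)%R.

Lemma KnormE (v : R -> R) f : (forall t, 0 < t -> 0 <= v t) -> ncarrier S f ->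
  Knorm q%:E v E F f = ((Kenergy ppos (fun t => v t `^ q)%R (K f)) `^ q^-1)%E.
Proof.
move=> v0 Sf; rewrite /Knorm (@Lq_haarint _ q q1 v (K f))// => t t0.
  exact: Kreal_ge0.
exact: KrealE.
Qed.

Lemma Kenergy_ge0 D (beta k : R -> R) : D `<=` ppos -> (forall t, 0 < t -> 0 <= beta t) ->
  (0 <= Kenergy D beta k)%E.
Proof.
move=> DP b0; apply: haarint_ge0 => // t /DP/ppos_gt0 t0.
by rewrite mulr_ge0 ?powR_ge0 ?b0.
Qed.

Lemma Knorm_ge0 (v : R -> R) f : (0 <= Knorm q%:E v E F f)%E.
Proof. exact: Lnorm_ge0. Qed.

Variables (b : R -> R).
Hypothesis b0 : forall t, 0 < t -> 0 < b t.
Hypothesis mb : lmeas b.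
Hypothesis bfin : (haarint ppos (fun t => b t `^ q)%R < +oo)%E.

Let be t := b t `^ q.
Let be0 t : 0 < t -> 0 <= be t. Proof. by move=> _; exact: powR_ge0. Qed.
Let mbe : lmeas be. Proof. exact: lmeas_powR. Qed.
Let bge t : 0 < t -> 0 <= b t. Proof. by move=> /b0/ltW. Qed.
Let P1 : ray (1 : R) `<=` ppos. Proof. exact: tail_ppos. Qed.
Let P01 : oc (0 : R) 1 `<=` ppos. Proof. by apply: itv_ppos; rewrite bnd_simp. Qed.

Definition total_mass : R := fine (haarint ppos be).
Definition far_mass : R := fine (haarint (ray 1) be).

Lemma total_massE : haarint ppos be = total_mass%:E.
Proof.
by rewrite /total_mass fineK// ge0_fin_numE//; apply: haarint_ge0 => [//|t /ppos_gt0/be0].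
Qed.

Lemma far_massE : haarint (ray 1) be = far_mass%:E.
Proof.
have ge : (0 <= haarint (ray 1) be)%E by apply: haarint_ge0 => [//|t /P1/ppos_gt0/be0].
rewrite /far_mass fineK// ge0_fin_numE//; apply: le_lt_trans bfin.
by apply: haarint_subset => // t /ppos_gt0/be0.
Qed.

Lemma total_mass_ge0 : 0 <= total_mass.
Proof. by rewrite -lee_fin -total_massE; apply: haarint_ge0 => [//|t /ppos_gt0/be0]. Qed.

Hypothesis far_mass_gt0 : 0 < far_mass.

Let kmeas (k : R -> R) : nondecreasing_on ppos k -> lmeas k.
Proof. by move=> knd; exact: nondecreasing_leb_measurable. Qed.

Lemma Kenergy_at1 (k : R -> R) : (forall t, 0 < t -> 0 <= k t) ->
  nondecreasing_on ppos k ->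
  ((far_mass * k 1 `^ q)%:E <= Kenergy (ray 1) be k)%E.
Proof.
move=> k0 knd.
have bg t : ray 1 t -> 0 <= be t by move=> /P1/ppos_gt0/be0.
rewrite mulrC EFinM -far_massE.
rewrite -(haarintZ (leb_measurable_itv _) P1 mbe bg (powR_ge0 (k 1) q)).
apply: (haarint_le P1) => t Dt; first by rewrite mulr_ge0 ?powR_ge0 ?bg.
have t0 : 0 < t by apply/ppos_gt0/P1.
rewrite mulrC ler_wpM2l ?bg//; apply: powR_le => //; first exact: k0.
apply: knd; try exact/ppos_gt0.
by move: Dt; rewrite /= in_itv/= andbT => /ltW.
Qed.

(** On [ ]0, 1] ], [k] is at most [k 1], which the energy beyond 1 controls. *)
Lemma Kenergy_far (k : R -> R) : (forall t, 0 < t -> 0 <= k t) ->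
  nondecreasing_on ppos k ->
  (Kenergy ppos be k <= (1 + total_mass / far_mass)%:E * Kenergy (ray 1) be k)%E.
Proof.
move=> k0 knd; have mk := lmeas_powR q (kmeas knd).
have ppE : (ppos : set R) = [set` Interval (BRight 0) (BInfty R false)].
  by apply/seteqP; split => t /=; rewrite in_itv/= andbT => /ppos_gt0.
have bk0 t : 0 < t -> 0 <= be t * k t `^ q by move=> t0; rewrite mulr_ge0 ?powR_ge0 ?be0.
rewrite /Kenergy {1}ppE (@haarint_split _ 0 1)//; last exact: lmeasM.
rewrite EFinD ge0_muleDl ?lee_fin ?divr_ge0 ?total_mass_ge0 ?(ltW far_mass_gt0)//.
rewrite mul1e addeC leeD2l//.
apply: (@le_trans _ _ (haarint (oc 0 1) (fun t => k 1 `^ q * be t)%R)).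
  apply: haarint_le => [//|t /P01/ppos_gt0//|t Dt]; first exact: bk0.
  have t0 : 0 < t by apply/ppos_gt0/P01.
  rewrite mulrC ler_wpM2r ?be0//; apply: powR_le => //; first exact: k0.
  apply: knd; rewrite ?ppos_gt0//; try exact/ppos_gt0.
  by move: Dt; rewrite /= in_itv/= => /andP[].
rewrite haarintZ ?powR_ge0//; last 2 first.
- exact: leb_measurable_itv.
- by move=> t /P01/ppos_gt0/be0.
apply: (@le_trans _ _ ((k 1 `^ q)%:E * total_mass%:E)%E).
  rewrite -total_massE; apply: lee_wpmul2l; first by rewrite lee_fin powR_ge0.
  by apply: haarint_subset => // t /ppos_gt0/be0.
apply: (@le_trans _ _ ((total_mass / far_mass)%:E * (far_mass * k 1 `^ q)%:E)%E).
  rewrite -!EFinM lee_fin le_eqVlt; apply/orP; left; apply/eqP; field.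
  by rewrite gt_eqF.
apply: lee_wpmul2l; first by rewrite lee_fin divr_ge0 ?total_mass_ge0 ?ltW.
exact: Kenergy_at1.
Qed.

Lemma KenergyD (D : set R) (beta k k0 k1 : R -> R) : measurable (D : set (lebType R)) -> D `<=` ppos ->
  lmeas beta -> (forall t, 0 < t -> 0 <= beta t) ->
  lmeas k0 -> lmeas k1 ->
  (forall t, 0 < t -> 0 <= k t) -> (forall t, 0 < t -> 0 <= k0 t) -> (forall t, 0 < t -> 0 <= k1 t) ->
  (forall t, D t -> k t <= k0 t + k1 t) ->
  (Kenergy D beta k <= (2 `^ q)%:E * (Kenergy D beta k0 + Kenergy D beta k1))%E.
Proof.
move=> mD DP mB B0 m0 m1 kk0 kk1 kk2 kle.
have p0 (h : R -> R) t : D t -> 0 <= beta t * h t `^ q.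
  by move=> /DP/ppos_gt0 t0; rewrite mulr_ge0 ?powR_ge0 ?B0.
have mp (h : R -> R) : lmeas h -> lmeas (fun t => beta t * h t `^ q).
  by move=> mh; apply: lmeasM => //; exact: lmeas_powR.
rewrite /Kenergy -haarintD//; try exact: mp; try exact: p0.
rewrite -haarintZ ?powR_ge0//; last 2 first.
- by apply: measurable_funD; exact: mp.
- by move=> t Dt; rewrite addr_ge0 ?p0.
apply: haarint_le => // [t Dt|t Dt]; first exact: p0.
have t0 : 0 < t by apply/ppos_gt0/DP.
rewrite -mulrDr mulrCA ler_wpM2l ?B0//.
apply: le_trans (powRD_le q1 (kk1 _ t0) (kk2 _ t0)).
by apply: powR_le => //; [exact: kk0|exact: kle].
Qed.

(** On [E] the functional [K f] is bounded, and the weight has finite mass; on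
    [G] only the energy beyond 1 has to be estimated, by [Kenergy_far]. *)
Lemma sum_embeds_K (G : nspace V) (M : R) : 0 < M ->
  ncarrier G `<=` ncarrier S ->
  (forall g, 0 <= nnorm G g)%E ->
  (forall g, ncarrier G g -> nnorm G g < +oo)%E ->
  (forall g, ncarrier G g -> forall y, (0 <= y)%R -> (nnorm G g <= y%:E)%E ->
     (Kenergy (ray 1) be (K g) <= ((M * y) `^ q)%:E)%E) ->
  embeds (sum_space E G) (Kspace q%:E b E F).
Proof.
move=> M0 GS G0 Gfin GK.
pose c1 := 1 + total_mass / far_mass.
have c11 : 1 <= c1 by rewrite /c1 lerDl divr_ge0 ?total_mass_ge0 ?ltW.
have c10 : 0 < c1 := lt_le_trans ltr01 c11.
pose M' := 1 + total_mass + c1 * (1 + M).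
pose L := 4 * M'.
have cM := mulr_gt0 c10 (addr_gt0 ltr01 M0); have tm := total_mass_ge0.
have M'1 : 1 <= M' by rewrite /M'; lra.
have M'0 : 0 < M' := lt_le_trans ltr01 M'1.
have tM' : total_mass <= M' by rewrite /M'; lra.
have cM' : c1 * M <= M' by move: cM; rewrite /M' mulrDr mulr1; lra.
have L0 : 0 < L by rewrite /L mulr_gt0.
have main f p0 p1 : decompositions E G f (p0, p1) ->
   ncarrier S f /\ (Knorm q%:E b E F f <= L%:E * (nnorm E p0 + nnorm G p1))%E.
  move=> [/= Ep Gp fE].
  have Sp0 := carrierE Ep; have Sp1 := GS _ Gp.
  have Sf : ncarrier S f by rewrite fE; exact: (sn_D sS).
  split => //.
  pose x := rnorm E p0; pose y := fine (nnorm G p1).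
  have x0 : 0 <= x by exact: rnorm_ge0.
  have yE : nnorm G p1 = y%:E by rewrite /y fineK// ge0_fin_numE// Gfin.
  have y0 : 0 <= y by exact: fine_ge0.
  have e0 : (Kenergy ppos be (K p0) <= ((M' * x) `^ q)%:E)%E.
    apply: (@le_trans _ _ (haarint ppos (fun t => x `^ q * be t)%R)).
      apply: haarint_le => // t /ppos_gt0 t0; first by rewrite mulr_ge0 ?powR_ge0 ?be0.
      rewrite mulrC ler_wpM2r ?be0//; apply: powR_le => //; first exact: Kreal_ge0.
      exact: Kreal_leE.
    rewrite haarintZ ?powR_ge0//; last 2 first.
    - exact: measurable_ppos.
    - by move=> t /ppos_gt0/be0.
    rewrite total_massE -EFinM lee_fin powRM ?(ltW M'0)// mulrC ler_wpM2r ?powR_ge0//.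
    by apply: (le_trans tM'); exact: le1r_powR.
  have e1 : (Kenergy ppos be (K p1) <= ((M' * y) `^ q)%:E)%E.
    apply: (le_trans (Kenergy_far (fun t t0 => Kreal_ge0 sE sF p1 t0) (Kreal_nd sE sF Sp1))).
    have h := GK _ Gp y y0; rewrite yE in h; have {}h := h (lexx _).
    apply: (le_trans (lee_wpmul2l _ h)); first by rewrite lee_fin ltW.
    rewrite -EFinM lee_fin powRM ?(ltW M0)// powRM ?(ltW M'0)// mulrA ler_wpM2r ?powR_ge0//.
    apply: (@le_trans _ _ (c1 `^ q * M `^ q)).
      by rewrite ler_wpM2r ?powR_ge0// le1r_powR.
    by rewrite -powRM ?(ltW c10) ?(ltW M0)//; apply: powR_le => //; rewrite mulr_ge0 ?ltW.
  rewrite (KnormE bge Sf) yE rnormE// -/x -EFinD -EFinM.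
  have nd0 := Kreal_nd sE sF Sp0; have nd1 := Kreal_nd sE sF Sp1.
  apply: root_le => //; first exact: Kenergy_ge0.
    by rewrite mulr_ge0 ?addr_ge0// ltW.
  apply: (@le_trans _ _ ((2 `^ q)%:E * (Kenergy ppos be (K p0) + Kenergy ppos be (K p1)))%E).
    apply: KenergyD => //; first [exact: measurable_ppos|exact: kmeas|by move=> t t0; exact: Kreal_ge0|idtac].
    by move=> t /ppos_gt0 t0; rewrite fE; exact: Kreal_triangle.
  apply: (le_trans (lee_wpmul2l _ (leeD e0 e1))); first by rewrite lee_fin powR_ge0.
  rewrite -EFinD -EFinM lee_fin.
  have -> : L * (x + y) = 4 * (M' * x + M' * y) by rewrite /L; ring.
  by apply: two_powRD_le => //; rewrite mulr_ge0 ?(ltW M'0).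
split.
  move=> f [[p0 p1] d]; have [Sf h] := main f p0 p1 d; split => //.
  apply: (le_lt_trans h); case: d => /= Ep Gp _.
  apply: lte_mul_pinfty; rewrite ?lee_fin ?(ltW L0)//.
  by rewrite lte_add_pinfty ?Gfin// ltey_eq (sn_fin sE Ep).
exists L => // f _; rewrite -lee_pdivrMl//; apply: le_ereal_inf_tmp => _ [[p0 p1] d <-].
by rewrite lee_pdivrMl//; have [] := main f p0 p1 d.
Qed.

(** The decomposition is allowed to depend on the energy of [K f + e] instead of
    [K f], since near-optimal decompositions of [f] are available only up to
    some [e > 0].  This [e] is taken small with respect to an arbitrary [d], which
    disappears when the norm of the sum is estimated. *)
Lemma K_embeds_sum (G : nspace V) (M : R) : 0 < M ->
  (forall g, 0 <= nnorm G g)%E ->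
  (forall f e T, 0 < e -> ncarrier S f ->
     (Kenergy (ray 1) be (fun t => K f t + e)%R <= T%:E)%E ->
     exists f0 g, [/\ ncarrier E f0, ncarrier G g, f = f0 + g,
       rnorm E f0 `^ q <= M * T & (nnorm G g <= ((M * T) `^ q^-1)%:E)%E]) ->
  embeds (Kspace q%:E b E F) (sum_space E G).
Proof.
move=> M0 G0 dec.
pose N := M `^ q^-1; have N0 : 0 < N by rewrite powR_gt0.
have NK : N `^ q = M by rewrite /N -powRrM mulVf ?gt_eqF// powRr1// ltW.
have main f (d : R) : ncarrier (Kspace q%:E b E F) f -> 0 < d ->
    exists f0 g, decompositions E G f (f0, g) /\
      (nnorm E f0 + nnorm G g <= (8 * N)%:E * (Knorm q%:E b E F f + d%:E))%E.
  move=> [Sf ffin] d0.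
  have ge := Knorm_ge0 b f.
  pose x := fine (Knorm q%:E b E F f).
  have xE : Knorm q%:E b E F f = x%:E by rewrite /x fineK// ge0_fin_numE.
  have x0 : 0 <= x by exact: fine_ge0.
  have nd := Kreal_nd sE sF Sf.
  have k0 t : 0 < t -> 0 <= K f t by move=> t0; exact: Kreal_ge0.
  have eng : (Kenergy (ray 1) be (K f) <= (x `^ q)%:E)%E.
    apply: (@le_trans _ _ (Kenergy ppos be (K f))).
      apply: haarint_subset => // t /ppos_gt0 t0; by rewrite mulr_ge0 ?powR_ge0 ?be0.
    apply: le_root => //; first exact: Kenergy_ge0.
    by rewrite -xE (KnormE bge Sf).
  pose e := d / (1 + far_mass).
  have fm1 : 0 < 1 + far_mass by rewrite addr_gt0.
  have e0 : 0 < e by rewrite divr_gt0.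
  have eE : (Kenergy (ray 1) be (fun=> e) <= (d `^ q)%:E)%E.
    rewrite /Kenergy (@eq_haarint _ _ _ (fun t => e `^ q * be t)%R); last by move=> t _; rewrite mulrC.
    rewrite haarintZ ?powR_ge0//; last 2 first.
    - exact: leb_measurable_itv.
    - by move=> t /P1/ppos_gt0/be0.
    rewrite far_massE -EFinM lee_fin.
    have -> : d = e * (1 + far_mass) by rewrite /e divfK// gt_eqF.
    rewrite powRM ?(ltW e0) ?(ltW fm1)//; apply: ler_wpM2l; first exact: powR_ge0.
    apply: (@le_trans _ _ (1 + far_mass)); first by rewrite lerDr.
    by apply: le1r_powR => //; rewrite lerDl ltW.
  pose T := (4 * (x + d)) `^ q.
  have xd0 : 0 <= x + d by rewrite addr_ge0// ltW.
  have hT : (Kenergy (ray 1) be (fun t => (K f t + e)%R) <= T%:E)%E.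
    apply: (@le_trans _ _ ((2 `^ q)%:E * (Kenergy (ray 1) be (K f) + Kenergy (ray 1) be (fun=> e)))%E).
      apply: KenergyD => //.
      - exact: leb_measurable_itv.
      - exact: kmeas.
      - exact: measurable_cst.
      - by move=> t t0; rewrite addr_ge0 ?k0// ltW.
      - by move=> t _; exact: ltW.
    apply: (le_trans (lee_wpmul2l _ (leeD eng eE))); first by rewrite lee_fin powR_ge0.
    rewrite -EFinD -EFinM lee_fin /T.
    by apply: two_powRD_le => //; exact: ltW.
  have [f0 [g [Ef0 Gg fE h1 h2]]] := dec f e T e0 Sf hT.
  have MT : M * T = (N * (4 * (x + d))) `^ q.
    by rewrite (@powRM _ N) ?(ltW N0) ?mulr_ge0// NK.
  have NT0 : 0 <= N * (4 * (x + d)) by rewrite mulr_ge0 ?(ltW N0)// mulr_ge0.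
  exists f0, g; split => //.
  rewrite MT in h1 h2; rewrite powR_rootK// in h2.
  have h1' : rnorm E f0 <= N * (4 * (x + d)).
    have r0 := @rnorm_ge0 _ _ E f0 sE.
    rewrite -(powR_rootK q1 r0) -(powR_rootK q1 NT0).
    by apply: ge0_ler_powR; rewrite ?nnegrE ?powR_ge0// invr_ge0 ltW.
  rewrite xE -EFinD -EFinM.
  have -> : (8 * N * (x + d))%:E = ((N * (4 * (x + d)))%:E + (N * (4 * (x + d)))%:E)%E.
    by rewrite -EFinD; congr (_%:E); ring.
  by apply: leeD => //; rewrite rnormE// lee_fin.
have N80 : 0 < 8 * N by rewrite mulr_gt0.
split.
  by move=> f Lf; have [f0 [g [d _]]] := main f 1 Lf ltr01; exists (f0, g).
exists (8 * N) => // f Lf; apply/lee_addgt0Pr => e e0.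
have [f0 [g [d h]]] := main f (e / (8 * N)) Lf (divr_gt0 e0 N80).
apply: (le_trans (sum_space_le d)); apply: (le_trans h).
rewrite muleDr//; last by rewrite fin_num_adde_defl.
by rewrite -EFinM (mulrC _ (e / _)%R) divfK ?gt_eqF.
Qed.

End KSpaces.

(** * The three spaces *)
Section Weights.
Context {R : realType}.

Lemma conjugate_exponent (q : R) : 1 <= q ->
  q * fine (hoelder_conjugate q%:E)^-1 = q - 1.
Proof.
move=> q1; have q0 := lt_le_trans ltr01 q1.
have qn0 : q%:E != 0%E :> \bar R by rewrite eqe gt_eqF.
have := hoelder_conjugate_eq1 (ltNyr q) qn0; rewrite inver gt_eqF//.
case: (hoelder_conjugate _)^-1%E => [x| |]//= xE; have {xE} := EFin_inj xE => /(canRL (addKr _)) ->.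
by rewrite mulrDr mulrN mulfV ?gt_eqF// mulr1 addrC.
Qed.

Lemma dual_weight_powR (q x y : R) : 1 <= q -> 0 < x -> 0 < y ->
  (x `^ (- (q - 1)) * y) `^ q = x `^ q * (y / x `^ q) `^ q.
Proof.
move=> q1 x0 y0.
rewrite powRM ?powR_ge0 ?(ltW y0)// -powRN powRM ?powR_ge0 ?(ltW y0)// -!powRrM.
rewrite mulrCA mulrC -powRD ?(gt_eqF x0) ?implybT//; congr (_ * _ `^ _); ring.
Qed.

(** The integrals over the blocks below 1 are summed by [head_mass_le], uniformly
    in their number. *)
Lemma near_mass_fin (B : R -> R) (C q : R) : half_weight C B -> 1 <= q ->
  (haarint (oc 0 1) (fun t => B t * t `^ q)%R < +oo)%E.
Proof.
move=> wB q1; have q0 := lt_le_trans ltr01 q1.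
have id0 : lmeas (fun t : R => t `^ q) by apply: lmeas_powR; exact: lmeas_id.
have mf : lmeas (fun t : R => B t * t `^ q) by apply: lmeasM => //; exact: hw_meas wB.
have f0 t : 0 < t -> 0 <= B t * t `^ q.
  by move=> t0; rewrite mulr_ge0 ?powR_ge0// ltW// (hw_gt0 wB).
have -> : `]0, 1]%classic = \bigcup_n `]((2 : R) ^- n.+1), 1]%classic.
  apply/seteqP; split => t /=; rewrite in_itv/=.
    move=> /andP[t0 t1]; have [n tn] := pow2_unbounded t^-1; exists n => //=.
    rewrite in_itv/= t1 andbT invf_plt ?posrE ?exprn_gt0//.
    by apply: (le_lt_trans tn); rewrite ltr_eXn2l ?ltr1n.
  by move=> [n _ /=]; rewrite !in_itv/= => /andP[h ->]; rewrite andbT (lt_trans _ h)// invr_gt0 exprn_gt0.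
pose T := 2 `^ q * (head_const C * (block_mass B 2^-1 * 2^-1 `^ q)).
apply: (@le_lt_trans _ _ T%:E); last exact: ltry.
apply: haarint_bigcup_le => //.
- move=> m n mn; apply/subsetPset => t /=; rewrite !in_itv/= => /andP[h ->]; rewrite andbT.
  by apply: le_lt_trans h; rewrite lef_pV2 ?posrE ?exprn_gt0// ler_eXn2l ?ltr1n.
- by move=> n; exact: leb_measurable_itv.
- by move=> n; apply: itv_ppos; rewrite bnd_simp invr_ge0 exprn_ge0.
move=> n; pose y : R := 2 ^- n.+1.
have y0 : 0 < y by rewrite invr_gt0 exprn_gt0.
have yn : y * 2 ^+ n.+1 = 1 by rewrite mulVf// gt_eqF// exprn_gt0.
have yn' : y * 2 ^+ n = 2^-1.
  by apply: (@mulIf _ 2) => //; rewrite -mulrA -exprSr yn mulVf.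
have := @haarint_dyadic_sum _ y n.+1 _ y0 mf f0; rewrite yn => ->.
have blk i : (haarint (oc (y * 2 ^+ i) (y * 2 ^+ i * 2)) (fun t => B t * t `^ q)%R <=
    (2 `^ q * (block_mass B (y * 2 ^+ i) * (y * 2 ^+ i) `^ q))%:E)%E.
  set z := y * 2 ^+ i; have z0 : 0 < z by rewrite mulr_gt0 ?exprn_gt0.
  have [wE _ _] := block_mass_bounds wB z0; have zP := dyadic_ppos z0.
  have -> : 2 `^ q * (block_mass B z * z `^ q) = (z * 2) `^ q * block_mass B z.
    by rewrite powRM ?(ltW z0)//; ring.
  rewrite EFinM -wE -(haarintZ _ zP (hw_meas wB)) ?powR_ge0//; last 2 first.
  - exact: leb_measurable_itv.
  - by move=> t /zP/ppos_gt0/(hw_gt0 wB)/ltW.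
  apply: (haarint_le zP) => [t /zP/ppos_gt0/f0//|t Dt]; have t0 : 0 < t by apply/ppos_gt0/zP.
  rewrite mulrC ler_wpM2r ?(ltW (hw_gt0 wB t0))//; apply: powR_le => //; first exact: ltW.
  by move: Dt; rewrite /= in_itv/= => /andP[].
apply: (@le_trans _ _ (\sum_(i < n.+1) (2 `^ q * (block_mass B (y * 2 ^+ i) * (y * 2 ^+ i) `^ q))%:E)%E).
  by apply: lee_sum => i _.
rewrite sumEFin lee_fin -mulr_sumr /T ler_wpM2l ?powR_ge0//.
by have := head_mass_le wB q1 n y0; rewrite yn'.
Qed.

End Weights.

Section Interpolation.
Context {R : realType} {V : lmodType R}.
Variables E F : nspace V.
Hypothesis sE : seminormed E.
Hypothesis sF : seminormed F.
Variable q : R.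
Hypothesis q1 : 1 <= q.
Let q0 : 0 < q. Proof. exact: lt_le_trans ltr01 q1. Qed.
Local Notation S := (sum_space E F).
Let sS : seminormed S := seminormed_sum sE sF.
Local Notation K := (Kreal E F).
Variables (b B A : R -> R) (C : R).
Hypothesis b0 : forall t, 0 < t -> 0 < b t.
Hypothesis mb : lmeas b.
Hypothesis bfin : (haarint ppos (fun t => b t `^ q)%R < +oo)%E.
Hypothesis B0 : forall t, 0 < t -> 0 < B t.
Hypothesis wB : half_weight C (fun t => B t `^ q).
Hypothesis Bb : forall t, 1 <= t -> B t = b t.
Local Notation be := (fun t => B t `^ q).
Let P1 : ray (1 : R) `<=` ppos. Proof. exact: tail_ppos. Qed.

Lemma far_mass_gt0 : 0 < far_mass q b.
Proof.
have -> : far_mass q b = tail_mass be 1.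
  rewrite /far_mass (@eq_haarint _ _ _ be)// => t /=.
  by rewrite in_itv/= andbT => /ltW/Bb ->.
exact: tail_mass_gt0 wB _ _.
Qed.

Lemma Kenergy_far_eq k : Kenergy q (ray 1) (fun t => b t `^ q) k = Kenergy q (ray 1) be k.
Proof.
by apply: eq_haarint => t /=; rewrite in_itv/= andbT => /ltW/Bb ->.
Qed.

Let be0 t : 0 < t -> 0 <= be t. Proof. by move=> _; exact: powR_ge0. Qed.
Let B0' t : 0 < t -> 0 <= B t. Proof. by move=> /B0/ltW. Qed.

Lemma sum_K_embeds : embeds (sum_space E (Kspace q%:E B E F)) (Kspace q%:E b E F).
Proof.
apply: (@sum_embeds_K _ _ _ _ sE sF _ q1 _ b0 mb bfin far_mass_gt0 _ 1) => //.
- by move=> g [].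
- by move=> g; exact: Knorm_ge0.
- by move=> g [].
move=> g [Sg _] y y0; rewrite mul1r Kenergy_far_eq /= (KnormE sE sF q1)//.
have ge : (0 <= Kenergy q ppos be (K g))%E by exact: Kenergy_ge0.
move=> /(le_root q1 ge y0); apply: le_trans; apply: haarint_subset => // t /ppos_gt0 t0.
by rewrite mulr_ge0 ?powR_ge0.
Qed.

(** The decomposition [f = p0 + p1] is near-optimal for [K f 1].  On [ ]0, 1] ] the
    functional of [p1] is at most [t] times its norm in [F], and beyond 1 it is at
    most that of [f] plus the norm of [p0] in [E]. *)
Lemma embeds_sum_K : embeds (Kspace q%:E b E F) (sum_space E (Kspace q%:E B E F)).
Proof.
have fm := far_mass_gt0; set m := far_mass q b in fm.
have I1fin := near_mass_fin wB q1; set I := haarint _ _ in I1fin.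
have f0 t : 0 < t -> 0 <= be t * t `^ q by move=> _; rewrite mulr_ge0 ?powR_ge0.
have P01 : oc (0 : R) 1 `<=` ppos by apply: itv_ppos; rewrite bnd_simp.
have I0 : (0 <= I)%E by apply: haarint_ge0 => [//|t /P01/ppos_gt0/f0].
pose I1 := fine I; have IE : I = I1%:E by rewrite /I1 fineK// ge0_fin_numE.
have I10 : 0 <= I1 by exact: fine_ge0.
have mbe : lmeas be by exact: hw_meas wB.
pose M := m^-1 + I1 / m + 2 `^ q.
have m0 : 0 < m^-1 by rewrite invr_gt0.
have Im0 : 0 <= I1 / m by rewrite divr_ge0// ltW.
have M0 : 0 < M by rewrite /M ltr_pwDl ?powR_ge0// ltr_pwDl.
apply: (@K_embeds_sum _ _ _ _ sE sF _ q1 _ b0 mb bfin far_mass_gt0 _ M) => //.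
  by move=> g; exact: Knorm_ge0.
move=> f e T e0 Sf eng.
have [[p0 p1] [[/= Ep Fp fE]]] := Kreal_decomposition sE sF Sf ltr01 e0.
rewrite mul1r; set x := K f 1 + e => h0 h1.
have x0 : 0 <= x by rewrite addr_ge0 ?(Kreal_ge0 sE sF)// ltW.
pose k t := K f t + e.
have kf0 t : 0 < t -> 0 <= k t by move=> t0; rewrite /k addr_ge0 ?(Kreal_ge0 sE sF)// ltW.
have knd : nondecreasing_on ppos k.
  by move=> s t Ps Pt st; rewrite /k lerD2r; exact: (Kreal_nd sE sF Sf).
have mk : lmeas k by exact: nondecreasing_leb_measurable.
have mx : m * x `^ q <= T.
  have := Kenergy_at1 q1 mb bfin kf0 knd; rewrite -lee_fin => /le_trans; exact.
have T0 : 0 <= T by apply: le_trans mx; rewrite mulr_ge0 ?powR_ge0// ltW.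
have xq : x `^ q <= m^-1 * T by rewrite mulrC ler_pdivlMr// mulrC.
have Sp1 := carrierF sE Fp; have Sp0 := carrierE sF Ep.
have kp0 t : 0 < t -> 0 <= K p1 t by move=> t0; exact: Kreal_ge0.
have mT t : 0 <= t <= M -> t * T <= M * T by move=> /andP[_ h]; rewrite ler_wpM2r.
have near : (haarint (oc 0 1) (fun t => be t * K p1 t `^ q)%R <= (I1 / m * T)%:E)%E.
  apply: (@le_trans _ _ (haarint (oc 0 1) (fun t => x `^ q * (be t * t `^ q))%R)).
    apply: (haarint_le P01) => t /P01/ppos_gt0 t0; first by rewrite mulr_ge0 ?powR_ge0.
    rewrite mulrCA ler_wpM2l ?powR_ge0// -powRM ?(ltW t0)//.
    apply: powR_le => //; first exact: kp0.
    apply: (le_trans (Kreal_leF sE sF Fp t0)); rewrite mulrC ler_wpM2r// ltW//.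
  rewrite haarintZ ?powR_ge0//; last 3 first.
  - exact: leb_measurable_itv.
  - by apply: lmeasM => //; apply: lmeas_powR; exact: lmeas_id.
  - by move=> t /P01/ppos_gt0/f0.
  rewrite -/I IE -EFinM lee_fin mulrC -mulrA ler_wpM2l//.
have far : (haarint (ray 1) (fun t => be t * K p1 t `^ q)%R <= (2 `^ q * T)%:E)%E.
  apply: (@le_trans _ _ (haarint (ray 1) (fun t => 2 `^ q * (be t * k t `^ q))%R)).
    apply: (haarint_le P1) => t Dt; have t0 : 0 < t by apply/ppos_gt0/P1.
      by rewrite mulr_ge0 ?powR_ge0.
    rewrite mulrCA ler_wpM2l ?powR_ge0// -powRM ?kf0//.
    apply: powR_le => //; first exact: kp0.
    have t1 : 1 <= t by move: Dt; rewrite /= in_itv/= andbT => /ltW.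
    have -> : p1 = f + - p0 by rewrite fE addrC addKr.
    have SNp0 := carrierE sF (sn_N sE Ep).
    apply: (le_trans (Kreal_triangle sE sF Sf SNp0 t0)).
    have h2 : K (- p0) t <= k t.
      apply: (le_trans (Kreal_leE sE sF (sn_N sE Ep) t0)).
      apply: (@le_trans _ _ (rnorm E p0)).
        by rewrite -lee_fin -!rnormE//; [exact: sn_normN|exact: sn_N].
      by apply: (le_trans h0); apply: knd => //; exact/ppos_gt0.
    by move: h2; rewrite /k; lra.
  rewrite haarintZ ?powR_ge0//; last 3 first.
  - exact: leb_measurable_itv.
  - by apply: lmeasM => //; apply: lmeas_powR.
  - by move=> t /P1/ppos_gt0 t0; rewrite mulr_ge0 ?powR_ge0.
  rewrite EFinM; apply: lee_wpmul2l; first by rewrite lee_fin powR_ge0.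
  by rewrite -[X in (X <= _)%E](Kenergy_far_eq k).
have ken : (Kenergy q ppos be (K p1) <= (M * T)%:E)%E.
  have ppE : (ppos : set R) = [set` Interval (BRight 0) (BInfty R false)].
    by apply/seteqP; split => t /=; rewrite in_itv/= andbT => /ppos_gt0.
  have mK : lmeas (K p1) by apply: nondecreasing_leb_measurable; exact: (Kreal_nd sE sF Sp1).
  rewrite /Kenergy {1}ppE (@haarint_split _ 0 1)//; last 2 first.
  - by apply: lmeasM => //; exact: lmeas_powR.
  - by move=> t t0; rewrite mulr_ge0 ?powR_ge0.
  apply: (le_trans (leeD near far)); rewrite -EFinD lee_fin -mulrDl ler_wpM2r//.
  by rewrite /M -addrA lerDr invr_ge0 ltW.
have kn : (Knorm q%:E B E F p1 <= ((M * T) `^ q^-1)%:E)%E.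
  rewrite (KnormE sE sF q1 B0' Sp1); apply: (root_le q1).
  - by apply: Kenergy_ge0.
  - exact: powR_ge0.
  by rewrite -powRrM mulVf ?gt_eqF// powRr1// mulr_ge0// ltW.
exists p0, p1; split => //.
  by split => //; apply: (le_lt_trans kn); exact: ltry.
apply: le_trans (mT m^-1 _); last first.
  by rewrite invr_ge0 ltW//= /M -addrA lerDl addr_ge0 ?powR_ge0// divr_ge0// ltW.
apply: le_trans xq; apply: powR_le => //; exact: rnorm_ge0.
Qed.

(* The weight of the theorem, as [q / q' = q - 1] ([conjugate_exponent]). *)
Hypothesis AE : forall t, 0 < t -> A t = B t `^ (- (q - 1)) * tail_mass be t.

Let al t := A t `^ q.

Lemma dual_weight_ge0 t : 0 < t -> 0 <= A t.
Proof. by move=> t0; rewrite AE// mulr_ge0 ?powR_ge0// ltW// (tail_mass_gt0 wB). Qed.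

Lemma dual_weightE t : 0 < t -> al t = be t * (tail_mass be t / be t) `^ q.
Proof.
by move=> t0; rewrite /al AE// dual_weight_powR ?B0// (tail_mass_gt0 wB).
Qed.

Hypothesis mB : lmeas B.

Lemma lmeas_dual_weight : lmeas al.
Proof.
have mW : lmeas (tail_mass be).
  apply: nonincreasing_leb_measurable => y z /ppos_gt0 y0 _; exact: (tail_mass_ni wB).
have : lmeas (fun t => (B t `^ (- (q - 1)) * tail_mass be t) `^ q).
  by apply: lmeas_powR; apply: lmeasM => //; exact: lmeas_powR.
apply: eq_measurable_fun => t /set_mem/ppos_gt0 t0.
by rewrite /al AE.
Qed.

Lemma Lq_Jreal g u : J_representation E F g u ->
  Lq_norm q%:E ppos (fun t => (t `^ (- fine q%:E^-1) * A t)%:E * Jfun E F (u t) t)%E =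
  ((haarint ppos (fun t => al t * Jreal E F t (u t) `^ q)%R) `^ q^-1)%E.
Proof.
move=> [[Eu _] _]; apply: Lq_haarint => //.
- exact: dual_weight_ge0.
- by move=> t _; exact: Jreal_ge0.
move=> t /ppos_gt0/Eu[Et Ft]; exact: JfunE.
Qed.

Lemma Jnorm_ge0 g : (0 <= Jnorm q%:E A E F g)%E.
Proof. by apply: le_ereal_inf_tmp => _ [u _ <-]; exact: Lnorm_ge0. Qed.

(** The infimum over the representations of [g] need not be attained, so the
    Hardy inequality is applied to one within [d] of it. *)
Lemma sum_J_embeds : embeds (sum_space E (Jspace q%:E A E F)) (Kspace q%:E b E F).
Proof.
pose H := 2 `^ q * (2 `^ q * hardyK_const C q).
have H0 : 0 < H.
  have hK := hardyK_const_gt0 q wB; have p2 : 0 < (2 : R) `^ q by exact: powR_gt0.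
  exact: mulr_gt0 p2 (mulr_gt0 p2 hK).
pose N := H `^ q^-1; have N0 : 0 < N by exact: powR_gt0.
have NH : N `^ q = H by rewrite /N -powRrM mulVf ?gt_eqF// powRr1// ltW.
apply: (@sum_embeds_K _ _ _ _ sE sF _ q1 _ b0 mb bfin far_mass_gt0 _ N) => //.
- by move=> g [].
- exact: Jnorm_ge0.
- by move=> g [].
move=> g [Sg _ _] y y0 gy; rewrite Kenergy_far_eq.
have ge : (0 <= Kenergy q (ray 1) be (K g))%E by exact: Kenergy_ge0.
have Ny0 : 0 <= N * y by rewrite mulr_ge0// ltW.
apply: (le_root q1 ge Ny0); apply/lee_addgt0Pr => e e0.
pose d := e / N; have d0 : 0 < d by rewrite divr_gt0.
have fin : Jnorm q%:E A E F g \is a fin_num.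
  by rewrite ge0_fin_numE ?Jnorm_ge0//; apply: (le_lt_trans gy); exact: ltry.
have [_ [u Ju <-] hu] := lb_ereal_inf_adherent d0 fin.
have yd0 : 0 <= y + d by rewrite addr_ge0// ltW.
have T : (haarint ppos (fun t => al t * Jreal E F t (u t) `^ q)%R <= ((y + d) `^ q)%:E)%E.
  apply: (le_root q1); [|exact: yd0|].
    by apply: haarint_ge0 => [|t _]; [|rewrite mulr_ge0 ?powR_ge0].
  rewrite -(Lq_Jreal Ju); apply: ltW; apply: (lt_le_trans hu).
  by rewrite EFinD leeD2r.
have -> : (N * y)%:E + e%:E = (N * (y + d))%:E.
  by rewrite -EFinD mulrDr /d (mulrC N (e / N)) divfK ?gt_eqF.
apply: (root_le q1 ge); first by rewrite mulr_ge0// ltW.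
have Nyd : (N * (y + d)) `^ q = 2 `^ q * (2 `^ q * (hardyK_const C q * (y + d) `^ q)).
  by rewrite powRM ?(ltW N0)// NH /H; ring.
rewrite Nyd.
apply: (hardy_majorant wB q1 dual_weightE lmeas_dual_weight (h := fun t => Jreal E F t (u t))) => //.
- by apply: measurable_Jreal => //; case: Ju.
- by move=> t _; exact: Jreal_ge0.
- by move=> t; exact: Kreal_ge0.
- exact: (Kreal_nd sE sF Sg).
- exact: (Kreal_double sE sF Sg).
move=> t t0; rewrite -(KrealE sE sF Sg)//; exact: J_representation_K.
Qed.

Lemma embeds_sum_J : embeds (Kspace q%:E b E F) (sum_space E (Jspace q%:E A E F)).
Proof.
have [M M0 main] := K_to_J sE sF wB q1 dual_weightE.
apply: (@K_embeds_sum _ _ _ _ sE sF _ q1 _ b0 mb bfin far_mass_gt0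
  (Jspace q%:E A E F) M M0 Jnorm_ge0).
move=> f e T e0 Sf; rewrite Kenergy_far_eq => eng.
have [f0 [g [u [[Ef0 Sg] fE h0 Ju h1]]]] := main f e T e0 Sf eng.
have T0 : 0 <= M * T by apply: le_trans h0; exact: powR_ge0.
have jn : (Jnorm q%:E A E F g <= ((M * T) `^ q^-1)%:E)%E.
  apply: (@le_trans _ _ _ _ _ (ereal_inf_lbound _)); first by exists u.
  rewrite (Lq_Jreal Ju); apply: (root_le q1).
  - by apply: haarint_ge0 => [|t _]; [|rewrite mulr_ge0 ?powR_ge0].
  - exact: powR_ge0.
  by rewrite -powRrM mulVf ?gt_eqF// powRr1.
exists f0, g; split => //; split => //; first by exists u.
by apply: (le_lt_trans jn); exact: ltry.
Qed.

End Interpolation.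

Lemma sum_space_ge0 (R : realType) (V : lmodType R) (E F : nspace V) f :
  (forall g, 0 <= nnorm E g)%E -> (forall g, 0 <= nnorm F g)%E ->
  (0 <= nnorm (sum_space E F) f)%E.
Proof. by move=> E0 F0; apply: le_ereal_inf_tmp => _ [p _ <-]; rewrite adde_ge0. Qed.

Lemma lmeas_slowly_varying (R : realType) (b : R -> R) : slowly_varying b -> lmeas b.
Proof. by case. Qed.

Theorem corollary1p14 (R : realType) (X0 X1 : completeNormedModType R)
    (V : topologicalLmodType R)
    (i0 : {linear X0 -> V}) (i1 : {linear X1 -> V})
    (q : R) (b beta B A : R -> R)
    (hX : compatible_couple i0 i1)
    (hq : 1 <= q)
    (hb : slowly_varying b)
    (hbint : (\int[leb R]_(t in `]0%R, +oo[) (t^-1 * b t `^ q)%:E < +oo)%E)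
    (hbeta : slowly_varying beta)
    (hbetafin : forall x : R, 0 < x ->
      (\int[leb R]_(t in `]x, +oo[) (t^-1 * beta t `^ q)%:E < +oo)%E)
    (hbetainf :
      (\int[leb R]_(t in `]0%R, +oo[) (t^-1 * beta t `^ q)%:E = +oo)%E)
    (hB : slowly_varying B)
    (hBb : forall x : R, 1 <= x -> B x = b x)
    (hBbeta : approx_on `]0, 1[ B beta)
    (hA : forall x : R, 0 < x ->
      A x = B x `^ (- (q * fine (hoelder_conjugate q%:E)^-1)) *
            \int[leb R]_(t in `]x, +oo[) (t^-1 * B t `^ q)) :
  let Y0 := embedded i0 in
  let Y1 := embedded i1 in
  space_eq (Kspace q%:E b Y0 Y1)
           (sum_space Y0 (Kspace q%:E B Y0 Y1)) /\
  space_eq (sum_space Y0 (Kspace q%:E B Y0 Y1))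
           (sum_space Y0 (Jspace q%:E A Y0 Y1)).
Proof.
move=> Y0 Y1; case: hX => _ [inj0 _] [inj1 _].
have s0 : seminormed Y0 by exact: seminormed_embedded.
have s1 : seminormed Y1 by exact: seminormed_embedded.
have b0 t : 0 < t -> 0 < b t by case: hb => h _ _ _ t0; apply: h; exact/ppos_gt0.
have B0 t : 0 < t -> 0 < B t by case: hB => h _ _ _ t0; apply: h; exact/ppos_gt0.
have mb := lmeas_slowly_varying hb; have mB := lmeas_slowly_varying hB.
have [C C1 grB] := sv_growth hq hB.
have be0 t : 0 < t -> 0 <= b t `^ q by move=> _; exact: powR_ge0.
have wB : half_weight C (fun t => B t `^ q).
  split; [by move=> t /B0/powR_gt0|exact: lmeas_powR|exact: C1|exact: grB|].
  rewrite (@eq_haarint _ _ _ (fun t => b t `^ q)); last first.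
    by move=> t /=; rewrite in_itv/= andbT => /ltW/hBb ->.
  apply: le_lt_trans hbint; apply: haarint_subset => [|//|t /ppos_gt0/be0//].
  exact: tail_ppos.
have AE t : 0 < t -> A t = B t `^ (- (q - 1)) * tail_mass (fun t => B t `^ q) t.
  by move=> t0; rewrite hA// conjugate_exponent.
have KbM := embeds_sum_K s0 s1 hq b0 mb hbint B0 wB hBb.
have MKb := sum_K_embeds s0 s1 hq b0 mb hbint B0 wB hBb.
have KbJ := embeds_sum_J s0 s1 hq b0 mb hbint B0 wB hBb AE.
have JKb := sum_J_embeds s0 s1 hq b0 mb hbint B0 wB hBb AE mB.
have K0 v f : (0 <= nnorm (Kspace q%:E v Y0 Y1) f)%E by exact: Knorm_ge0.
have J0 f : (0 <= nnorm (Jspace q%:E A Y0 Y1) f)%E by exact: Jnorm_ge0.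
have n0 := sn_ge0 s0.
split; apply: space_eq_embeds => //; try by move=> f; exact: sum_space_ge0.
- exact: embeds_trans MKb KbJ.
- exact: embeds_trans JKb KbM.
Qed.
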